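(* Let $W_i=(\Delta Y_i,D_i,X_i)$, $i=1,\dots,n$, be i.i.d. copies of $W=(\Delta Y,D,X)$, and let $\widehat\tau$ be the $K$-fold cross-fitted doubly robust estimator $$\widehat\tau=\frac1n\sum_{k=1}^K\sum_{i\in\mathcal I_k}\Big[\frac{D_i}{\widehat p}\{\widehat{\Delta Y}_i-\widehat\mu_0^{(-k)}(X_i)\}-\frac{(1-D_i)\widehat\pi^{(-k)}(X_i)}{\widehat p\{1-\widehat\pi^{(-k)}(X_i)\}}\{\widehat{\Delta Y}_i-\widehat\mu_0^{(-k)}(X_i)\}\Big],\qquad \widehat p=\frac1n\sum_{i=1}^nD_i .$$ Suppose: (A1) There is $\underline c\in(0,1/2)$ with $\underline c\le\pi_0(X)\le1-\underline c$ a.s., and $p_0\in(0,1)$; $\mathbb E\|\Delta Y\|_{\mathcal H}^2<\infty$, $\mathbb E\|\phi(W;\eta_0)\|_{\mathcal H}^2<\infty$, and $\sup_x\mathbb E\{\|\Delta Y-\mu_0(X)\|_{\mathcal H}^2\mid X=x,D=0\}<\infty$. (A2) For each $k$, $(\widehat\pi^{(-k)},\widehat\mu_0^{(-k)})$ is trained only on the data of units $i\notin\mathcal I_k$; for some $\underline c\in(0,1/2)$, with probability tending to one, $\underline c\le\widehat\pi^{(-k)}(X_i)\le1-\underline c$ for all $i\in\mathcal I_k$, $k=1,\dots,K$; and $\max_{1\le k\le K}\|\widehat\mu_0^{(-k)}\|_2=O_p(1)$. (A3) For each $k$: $\|\widehat\mu_0^{(-k)}-\mu_0\|_2=o_p(1)$,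 $\|\widehat\pi^{(-k)}-\pi_0\|_2=o_p(1)$, and $\|\widehat\mu_0^{(-k)}-\mu_0\|_2\,\|\widehat\pi^{(-k)}-\pi_0\|_2=o_p(n^{-1/2})$. (A4) $\max_{1\le i\le n}\|\widehat{\Delta Y}_i-\Delta Y_i\|_{\mathcal H}=o_p(n^{-1/2})$ (and the rates in (A3) hold for the nuisance estimators actually used, i.e. those trained on the reconstructed curves if reconstruction is used). Then $$\sqrt n(\widehat\tau-\tau_0)=\frac1{\sqrt n}\sum_{i=1}^n\phi(W_i;\eta_0)+r_n\quad\text{in }\mathcal H,\qquad \|r_n\|_{\mathcal H}=o_p(1).$$
   Context: $\mathcal T\subset\mathbb R$ is a compact interval, $\mathcal H=L^2(\mathcal T)$. $\Delta Y\in\mathcal H$ is the pre-to-post change of an outcome curve, $D\in\{0,1\}$ the treated-group indicator, $X\in\mathbb R^p$ covariates; $P$ is the law of $W$. $\pi_0(x)=P(D=1\mid X=x)$, $p_0=P(D=1)$, $\mu_0(x)=\mathbb E\{\Delta Y\mid X=x,D=0\}\in\mathcal H$, $\eta_0=(\pi_0,\mu_0)$. $\tau_0\in\mathcal H$ is the functional average treatment effect on the treated; under the standing causal assumptions (consistency, no anticipation, conditional parallel trends, overlap) it equals $$\tau_0=\mathbb E\Big\{\frac{D}{p_0}\Delta Y\Big\}-\mathbb E\Big\{\frac{(1-D)\pi_0(X)}{p_0\{1-\pi_0(X)\}}\Delta Y\Big\}.$$ The influence function is $$\phi(W;\eta_0)=\frac{D}{p_0}\{\Delta Y-\mu_0(X)-\tau_0\}-\frac{(1-D)\pi_0(X)}{p_0\{1-\pi_0(X)\}}\{\Delta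 Y-\mu_0(X)\}.$$ $K$ is fixed, $\{\mathcal I_k\}_{k=1}^K$ is a partition of $\{1,\dots,n\}$ chosen independently of the data, and $\widehat\pi^{(-k)}$ (real-valued) and $\widehat\mu_0^{(-k)}$ ($\mathcal H$-valued) are estimators of the functions $\pi_0,\mu_0$. $\widehat{\Delta Y}_i$ is a reconstruction of $\Delta Y_i$ from discrete noisy observations ($\widehat{\Delta Y}_i=\Delta Y_i$ if curves are fully observed). $\|\cdot\|_2$ is the $L^2(P)$ norm of scalar functions of $X$ and the $L^2(P;\mathcal H)$ norm $\{\int\|h(x)\|_{\mathcal H}^2\,dP_X(x)\}^{1/2}$ of $\mathcal H$-valued functions of $X$ (with the estimated function held fixed). *)

(* Defs.v *)
From HB Require Import structures.
From mathcomp Require Import all_boot all_order all_algebra.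
From mathcomp Require Import all_classical all_reals all_analysis.

Set Implicit Arguments.
Unset Strict Implicit.
Unset Printing Implicit Defensive.

Import Order.TTheory GRing.Theory Num.Theory.
Import numFieldNormedType.Exports.

Local Open Scope classical_set_scope.
Local Open Scope ring_scope.

Section curves.
Context {R : realType}.

Definition lebesgue_on (a b : R) : {measure set (measurableTypeR R) -> \bar R} :=
  mrestr lebesgue_measure (measurable_itv `[a, b] : measurable (`[a, b]%classic)).

(* The Hilbert space H = L^2([a, b]), through square-integrable representatives:
   [hnorm] below is a seminorm, and two representatives stand for the same
   element of H iff the [hnorm] of their difference is 0, i.e., iff they agree
   almost everywhere on [a, b]. *)
Definition L2 (a b : R) : Type := LfunType (lebesgue_on a b) (lee1n 2).

HB.instance Definition _ a b := GRing.Lmodule.on (L2 a b).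
HB.instance Definition _ a b := isPointed.Build (L2 a b) (0 : L2 a b).

Definition hnorm a b (f : L2 a b) : R :=
  fine ('N[lebesgue_on a b]_(2%:R)%:E[EFin \o (f : R -> R)])%E.

Definition L2_open a b : set (set (L2 a b)) :=
  [set U | forall f, U f -> exists2 r : R, 0 < r &
     forall g : L2 a b, hnorm (g - f) < r -> U g].

HB.instance Definition _ a b := @isMeasurable.Build
  (sigma_display (@L2_open a b)) (L2 a b) <<s @L2_open a b >>
  (@sigma_algebra0 _ setT _) (@sigma_algebraC _ _)
  (@sigma_algebra_bigcup _ setT _).

End curves.

Section random_curves.
Context {R : realType} {d : measure_display} {T : measurableType d} (a b : R).

(* A list of pairs (A_j, h_j) stands for the simple map \sum_j 1_{A_j} h_j. *)
Definition simple_curve (s : seq (set T * L2 a b)) (t : T) : L2 a b :=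
  \sum_(q <- s) \1_(q.1) t *: q.2.

Definition simple_mean (P : probability T R) (s : seq (set T * L2 a b)) : L2 a b :=
  \sum_(q <- s) fine (P q.1) *: q.2.

Definition simple_measurable (s : seq (set T * L2 a b)) : Prop :=
  forall q, q \in s -> measurable q.1.

(* Strong (Bochner) measurability, which is Borel measurability since
   L^2([a, b]) is separable. *)
Definition random_curve (f : T -> L2 a b) : Prop :=
  exists s : nat -> seq (set T * L2 a b),
    (forall j, simple_measurable (s j)) /\
    (forall t, hnorm (simple_curve (s j) t - f t) @[j --> \oo] --> (0 : R)).

(* f is Bochner integrable and m is its Bochner integral. *)
Definition has_mean (P : probability T R) (f : T -> L2 a b) (m : L2 a b) : Prop :=
  random_curve f /\
  exists s : nat -> seq (set T * L2 a b),
    [/\ forall j, simple_measurable (s j),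
        (\int[P]_t (hnorm (simple_curve (s j) t - f t))%:E)%E @[j --> \oo] --> 0%E
      & hnorm (simple_mean P (s j) - m) @[j --> \oo] --> (0 : R)].

End random_curves.

Section conditional_expectation.
Context {R : realType} {d d' : measure_display}
  {T : measurableType d} {T' : measurableType d'}.
Variables (P : probability T R) (X : {RV P >-> T'}).

(* v is a version of x |-> E(Z | X = x, E). *)
Definition is_cond_mean (E : set T) (Z : T -> R) (v : T' -> R) : Prop :=
  [/\ measurable_fun setT v,
      P.-integrable E (EFin \o Z),
      P.-integrable E (EFin \o (v \o X))
    & forall B, measurable B ->
      (\int[P]_(w in E `&` X @^-1` B) (Z w)%:E =
       \int[P]_(w in E `&` X @^-1` B) (v (X w))%:E)%E].

(* v is a version of x |-> E(Z | X = x, E) for H-valued Z. *)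
Definition is_cond_mean_curve a b (E : set T) (Z : T -> L2 a b)
    (v : T' -> L2 a b) : Prop :=
  random_curve v /\
  forall B, measurable B -> exists m : L2 a b,
    has_mean P (fun w => \1_(E `&` X @^-1` B) w *: Z w) m /\
    has_mean P (fun w => \1_(E `&` X @^-1` B) w *: v (X w)) m.

End conditional_expectation.

Section independence.
Context {R : realType} {d d' : measure_display}
  {T : measurableType d} {T' : measurableType d'} (P : probability T R).

(* Taking B i = setT for some i gives the product rule for every subfamily. *)
Definition mutually_independent n (U : 'I_n -> T -> T') : Prop :=
  forall B : 'I_n -> set T', (forall i, measurable (B i)) ->
    P [set w | forall i, B i (U i w)] = (\prod_(i < n) P (U i @^-1` B i))%E.

Definition independent_of (F : finType) (V : T -> F) (U : T -> T') : Prop :=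
  forall (c : F) (B : set T'), measurable B ->
    P (V @^-1` [set c] `&` U @^-1` B) = (P (V @^-1` [set c]) * P (U @^-1` B))%E.

End independence.

Section stochastic_orders.
Context {R : realType} {d : measure_display} {T : measurableType d}
  (P : probability T R).

(* U_n = o_p(r_n) *)
Definition little_op (U : nat -> T -> \bar R) (r : nat -> R) : Prop :=
  forall eps : R, 0 < eps ->
    P [set w | ((eps * r n)%:E < `|U n w|)%E] @[n --> \oo] --> 0%E.

(* U_n = O_p(r_n) *)
Definition big_Op (U : nat -> T -> \bar R) (r : nat -> R) : Prop :=
  forall eps : R, 0 < eps -> exists M : R, \forall n \near \oo,
    (P [set w | ((M * r n)%:E < `|U n w|)%E] <= eps%:E)%E.

End stochastic_orders.

Section L2P_norms.
Context {R : realType} {d d' : measure_display}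
  {T : measurableType d} {T' : measurableType d'}.
Variables (P : probability T R) (X : {RV P >-> T'}).

Definition L2P_norm (h : T' -> R) : \bar R :=
  ('N[distribution P X]_(2%:R)%:E[(fun x => (h x)%:E)])%E.

Definition L2PH_norm a b (h : T' -> L2 a b) : \bar R :=
  ('N[distribution P X]_(2%:R)%:E[(fun x => (hnorm (h x))%:E)])%E.

End L2P_norms.

Section estimator.
Context {R : realType} (a b : R) (p : nat).

(* W = (Delta Y, D, X), with treated units coded by D = true. *)
Definition obs : Type := (L2 a b * bool * p.-tuple R)%type.
HB.instance Definition _ := Measurable.on obs.

(* (D / q) (y - m) - ((1 - D) e / (q (1 - e))) (y - m), the summand of the
   estimator at p = q, pi(X) = e, mu_0(X) = m. *)
Definition dr_summand (q e : R) (m y : L2 a b) (D : bool) : L2 a b :=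
  (D%:R / q) *: (y - m) - ((1 - D%:R) * e / (q * (1 - e))) *: (y - m).

Definition influence (p0 : R) (pi0 : p.-tuple R -> R)
    (mu0 : p.-tuple R -> L2 a b) (tau0 : L2 a b) (w : obs) : L2 a b :=
  let: (y, D, x) := w in
  (D%:R / p0) *: (y - mu0 x - tau0)
  - ((1 - D%:R) * pi0 x / (p0 * (1 - pi0 x))) *: (y - mu0 x).

(* The data used by the estimation are n records u, one per unit, in a space O.
   [fhat w k] is the function of x fitted for fold k at the sample point w; with
   unit i in fold [fold w i], it is a function g of the fold assignment and of
   the records, which ignores the records of fold k.  [meas] is the measurability
   required of V-valued maps. *)
Definition cross_fitted (T O V : Type) K n
    (meas : (n.-tuple O * p.-tuple R -> V) -> Prop)
    (fold : T -> {ffun 'I_n -> 'I_K}) (records : T -> n.-tuple O)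
    (fhat : T -> 'I_K -> p.-tuple R -> V) : Prop :=
  exists g : {ffun 'I_n -> 'I_K} -> 'I_K -> n.-tuple O -> p.-tuple R -> V,
    [/\ forall c k, meas (fun z => g c k z.1 z.2),
        forall (c : {ffun 'I_n -> 'I_K}) (k : 'I_K) (u v : n.-tuple O),
          (forall i, c i != k -> tnth u i = tnth v i) -> g c k u = g c k v
      & forall w k, fhat w k = g (fold w) k (records w)].

(* [yhat i], [D i], [x i] are the i-th reconstructed curve, treatment
   indicator and covariates; [pihat k], [muhat k] are the fits for fold k. *)
Definition tau_hat K n (c : {ffun 'I_n -> 'I_K})
    (pihat : 'I_K -> p.-tuple R -> R) (muhat : 'I_K -> p.-tuple R -> L2 a b)
    (yhat : 'I_n -> L2 a b) (D : 'I_n -> bool) (x : 'I_n -> p.-tuple R) : L2 a b :=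
  let phat := n%:R^-1 * \sum_(i < n) (D i)%:R in
  n%:R^-1 *: \sum_(k < K) \sum_(i < n | c i == k)
    dr_summand phat (pihat k (x i)) (muhat k (x i)) (yhat i) (D i).

End estimator.

(* Main.v *)
(* Write psi_i for the unnormalized doubly robust summand
   D (Y - mu0) - (1 - D) pi0 / (1 - pi0) (Y - mu0) of unit i, psihat_i for its
   estimated version, rho = D - (1 - D) pi0 / (1 - pi0) for the weight (rhohat
   with pihat), gap = pihat / (1 - pihat) - pi0 / (1 - pi0), and Phi for the sum
   of the influence functions.  Then
     r_n = n^(-1/2) [ phat^-1 \sum (psihat_i - psi_i) + (p0 / phat - 1) Phi ],
     psihat - psi = rhohat (Yhat - Y) - (1 - D) gap (Y - mu0)
                    - rho (muhat - mu0) + (1 - D) gap (muhat - mu0).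
   The (Yhat - Y) terms are o_p(1) by (A4).  Given the folds and the data outside
   a fold, the sums of the second and of the third terms over that fold have
   independent centred summands whose second moments are bounded by the L^2
   errors of pihat and muhat, so after division by sqrt n they vanish by
   Chebyshev.  The last term is bounded by Cauchy-Schwarz with the product rate.
   Finally n^(-1/2) Phi = O_p(1), its summands being centred, and phat -> p0.
   To make the conditional bounds hold for every value of the training data,
   propensities are clipped to [c, 1 - c], which changes nothing with probability
   tending to 1. *)
Require Import Defs.
From mathcomp Require Import all_boot all_order all_algebra.
From mathcomp Require Import all_classical all_reals all_analysis.
From mathcomp Require Import measurable_realfun ring lra.

Set Implicit Arguments.
Unset Strict Implicit.
Unset Printing Implicit Defensive.

Import Order.TTheory GRing.Theory Num.Theory.
Import numFieldNormedType.Exports.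

Local Open Scope classical_set_scope.
Local Open Scope ring_scope.

(** Measurability shapes the proof. A curve is random as a pointwise limit of simple curves, while
    [obs] carries Borel sets of a space whose separability is not invoked. Instead, the values of
    [Y] and of all the [Yi] lie in the closure of one countable set. This makes these curves Borel
    measurable and yields a map [kap] that fixes their values and is itself a limit of simple maps,
    so that functions of a record are again such limits.

    Conditioning on the training data is replaced by freezing: independence gives a Fubini formula
    that integrates one record while the others are held fixed, so moments need only be bounded for
    each frozen value. As (A3) controls the errors only with high probability, summands are
    multiplied by the indicator that the error of the fit is below a threshold; the bounds then hold
    for every frozen value, and on a likely event nothing has changed. Random folds are averaged
    over their finitely many values.

    Curve-valued centring is used only through inner products with fixed vectors: in a cross
    product, freezing all records but one makes the other factor such a vector. *)

(** * The semidefinite inner product behind [hnorm] *)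

Section inner_product.
Context {R : realType} (a b : R).
Local Notation mu := (lebesgue_on a b).
Implicit Types (f g h : L2 a b) (c : R).

Definition hinner f g : R := \int[mu]_x (f x * g x).

Lemma L2_Lfun f : (f : R -> R) \in Lfun mu 2%:E.
Proof. exact: LfunP. Qed.

Lemma hinner_integrable f g : mu.-integrable setT (EFin \o (fun x => f x * g x)).
Proof. exact/Lfun1_integrable/Lfun2_mul_Lfun1/L2_Lfun/L2_Lfun. Qed.

Lemma hinnerC f g : hinner f g = hinner g f.
Proof. by apply: eq_Rintegral => x _; rewrite mulrC. Qed.

Lemma hinnerDl f g h : hinner (f + g) h = hinner f h + hinner g h.
Proof.
transitivity (\int[mu]_x (f x * h x + g x * h x)).
  by apply: eq_Rintegral => x _; rewrite -mulrDl.
by rewrite RintegralD//; exact: hinner_integrable.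
Qed.

Lemma hinnerZl c f g : hinner (c *: f) g = c * hinner f g.
Proof.
transitivity (\int[mu]_x (c * (f x * g x))).
  by apply: eq_Rintegral => x _; rewrite mulrA.
by rewrite RintegralZl//; exact: hinner_integrable.
Qed.

Lemma hinnerNl f g : hinner (- f) g = - hinner f g.
Proof. by rewrite -scaleN1r hinnerZl mulN1r. Qed.

Lemma hinnerBl f g h : hinner (f - g) h = hinner f h - hinner g h.
Proof. by rewrite hinnerDl hinnerNl. Qed.

Lemma hinner0l f : hinner 0 f = 0.
Proof. by rewrite -(scale0r (0 : L2 a b)) hinnerZl mul0r. Qed.

Lemma hinner_suml I (s : seq I) (p : pred I) (F : I -> L2 a b) h :
  hinner (\sum_(i <- s | p i) F i) h = \sum_(i <- s | p i) hinner (F i) h.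
Proof.
elim/big_rec2 : _ => [|i y1 y2 _ <-]; first exact: hinner0l.
by rewrite hinnerDl.
Qed.

Lemma hinnerDr f g h : hinner h (f + g) = hinner h f + hinner h g.
Proof. by rewrite hinnerC hinnerDl !(hinnerC h). Qed.

Lemma hinnerZr c f g : hinner f (c *: g) = c * hinner f g.
Proof. by rewrite hinnerC hinnerZl hinnerC. Qed.

Lemma hinnerNr f g : hinner f (- g) = - hinner f g.
Proof. by rewrite hinnerC hinnerNl hinnerC. Qed.

Lemma hinnerBr f g h : hinner h (f - g) = hinner h f - hinner h g.
Proof. by rewrite hinnerDr hinnerNr. Qed.

Lemma hinner_sumr I (s : seq I) (p : pred I) (F : I -> L2 a b) h :
  hinner h (\sum_(i <- s | p i) F i) = \sum_(i <- s | p i) hinner h (F i).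
Proof. by rewrite hinnerC hinner_suml; under eq_bigr do rewrite hinnerC. Qed.

Lemma hnorm_ge0 f : 0 <= hnorm f.
Proof. by rewrite fine_ge0// Lnorm_ge0. Qed.

Lemma hnorm_sqr f : hnorm f ^+ 2 = hinner f f.
Proof.
have h0 := hnorm_ge0 f.
apply: EFin_inj; rewrite -powR_mulrn// -poweR_EFin.
rewrite /hnorm (@finite_norm_fine _ _ _ mu 2%:E (lee1n 2) f) powR_Lnorm//.
rewrite /hinner fineK; last first.
  exact/(integrable_fin_num measurableT)/hinner_integrable.
by apply: eq_integral => x _ /=; rewrite powR_mulrn// real_normK ?num_real// expr2.
Qed.

Lemma hinner_ge0 f : 0 <= hinner f f.
Proof. by rewrite -hnorm_sqr sqr_ge0. Qed.

(** The quadratic [c |-> |f - c g|^2] is nonnegative. As [hnorm] is only a seminorm,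
    [hinner g g = 0] does not force [g = 0], hence the separate case. *)
Lemma hinner_le f g : `|hinner f g| <= hnorm f * hnorm g.
Proof.
rewrite -(@ler_pXn2r _ 2)// ?nnegrE ?mulr_ge0 ?hnorm_ge0//.
rewrite real_normK ?num_real// exprMn !hnorm_sqr.
have key c : 0 <= hinner f f - 2 * c * hinner f g + c ^+ 2 * hinner g g.
  have := hinner_ge0 (f - c *: g).
  rewrite hinnerBl !hinnerBr !hinnerZl !hinnerZr (hinnerC g f).
  by congr (_ <= _); ring.
have [g0|g0] := eqVneq (hinner g g) 0; last first.
  have gp : 0 < hinner g g by rewrite lt_neqAle eq_sym g0 hinner_ge0.
  (* The minimizer of the quadratic. *)
  have := key (hinner f g / hinner g g).
  rewrite -(pmulr_lge0 _ gp) => /le_trans H; rewrite -subr_ge0; apply: H.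
  by rewrite le_eqVlt; apply/orP; left; apply/eqP; field.
(* With [hinner g g = 0] the quadratic is affine in [c]; the coefficient chosen next would give it
   the value -1. *)
rewrite g0 mulr0; have [->|fg0] := eqVneq (hinner f g) 0; first by rewrite expr0n.
have := key ((hinner f f + 1) / (2 * hinner f g)); rewrite g0.
suff -> : hinner f f - 2 * ((hinner f f + 1) / (2 * hinner f g)) * hinner f g +
   ((hinner f f + 1) / (2 * hinner f g)) ^+ 2 * 0 = -1 by move=> ?; exfalso; lra.
by field.
Qed.

Lemma hnorm0 : hnorm (0 : L2 a b) = 0.
Proof. by apply/eqP; rewrite -sqrf_eq0 hnorm_sqr hinner0l. Qed.

Lemma hnormZ c f : hnorm (c *: f) = `|c| * hnorm f.
Proof.
apply/eqP; rewrite -(@eqrXn2 _ 2)// ?mulr_ge0 ?hnorm_ge0//.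
by rewrite exprMn !hnorm_sqr hinnerZl hinnerZr mulrA -expr2 real_normK ?num_real.
Qed.

Lemma hnormN f : hnorm (- f) = hnorm f.
Proof. by rewrite -scaleN1r hnormZ normrN1 mul1r. Qed.

Lemma hnorm_distC f g : hnorm (f - g) = hnorm (g - f).
Proof. by rewrite -hnormN opprB. Qed.

Lemma hnormD f g : hnorm (f + g) <= hnorm f + hnorm g.
Proof.
rewrite -(@ler_pXn2r _ 2)// ?nnegrE ?addr_ge0 ?hnorm_ge0//.
rewrite sqrrD !hnorm_sqr hinnerDl !hinnerDr (hinnerC g f).
have := le_trans (ler_norm _) (hinner_le f g); lra.
Qed.

Lemma hnormB f g : hnorm (f - g) <= hnorm f + hnorm g.
Proof. by rewrite (le_trans (hnormD _ _))// hnormN. Qed.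

Lemma hnorm_dist f g : `|hnorm f - hnorm g| <= hnorm (f - g).
Proof.
have := hnormD (f - g) g; rewrite subrK => H1.
have := hnormD (g - f) f; rewrite subrK hnorm_distC => H2.
by rewrite ler_norml; apply/andP; split; lra.
Qed.

Lemma hnorm_triangle f g h : hnorm (f - g) <= hnorm (f - h) + hnorm (h - g).
Proof. by have := hnormD (f - h) (h - g); rewrite addrA subrK. Qed.

Lemma hnorm_sum I (s : seq I) (p : pred I) (F : I -> L2 a b) :
  hnorm (\sum_(i <- s | p i) F i) <= \sum_(i <- s | p i) hnorm (F i).
Proof.
elim/big_rec2 : _ => [|i y1 y2 _ h]; first by rewrite hnorm0.
by rewrite (le_trans (hnormD _ _))// lerD2l.
Qed.

Lemma hnorm_sqr_sum I (s : seq I) (p : pred I) (F : I -> L2 a b) :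
  hnorm (\sum_(i <- s | p i) F i) ^+ 2 =
  \sum_(i <- s | p i) \sum_(j <- s | p j) hinner (F i) (F j).
Proof.
rewrite hnorm_sqr hinner_suml; apply: eq_bigr => i _.
by rewrite hinner_sumr.
Qed.

End inner_product.

(** * Measurability of curve-valued maps without separability *)

Section curve_measurability.
Context {R : realType} (a b : R).

Inductive simple_mcurve d (T : measurableType d) : (T -> L2 a b) -> Prop :=
| simple_mcurve0 : simple_mcurve (fun=> 0)
| simple_mcurveS (c : T -> R) (h : L2 a b) f : measurable_fun setT c ->
    simple_mcurve f -> simple_mcurve (fun t => c t *: h + f t).

(* Unlike [random_curve], this class is visibly stable under multiplication by
   measurable scalar functions; the two notions agree. *)
Definition mcurve d (T : measurableType d) (f : T -> L2 a b) :=
  exists2 s : nat -> T -> L2 a b, forall j, simple_mcurve (s j) &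
    forall t, hnorm (s j t - f t) @[j --> \oo] --> (0 : R).

Lemma cvg0_le (u v : nat -> R) : (forall j, 0 <= u j <= v j) ->
  v j @[j --> \oo] --> (0 : R) -> u j @[j --> \oo] --> (0 : R).
Proof.
move=> uv v0; apply: (@squeeze_cvgr _ _ _ _ (fun=> 0) v) => //.
- by apply: nearW.
- exact: cvg_cst.
Qed.

Section closure.
Context d (T : measurableType d).
Implicit Types (f g : T -> L2 a b) (c : T -> R).

Lemma simple_mcurve_cst h : simple_mcurve (fun _ : T => h).
Proof.
have := @simple_mcurveS _ T (cst 1) h _ (measurable_cst _) (simple_mcurve0 T).
by congr simple_mcurve; apply/funext => t /=; rewrite scale1r addr0.
Qed.

Lemma simple_mcurveD f g :
  simple_mcurve f -> simple_mcurve g -> simple_mcurve (fun t => f t + g t).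
Proof.
elim=> [|c h {}f mc mf IH] mg.
  by rewrite (_ : (fun _ => _) = g)//; apply/funext => t; rewrite add0r.
have := simple_mcurveS h mc (IH mg).
by congr simple_mcurve; apply/funext => t; rewrite addrA.
Qed.

Lemma simple_mcurveZ c f : measurable_fun setT c ->
  simple_mcurve f -> simple_mcurve (fun t => c t *: f t).
Proof.
move=> mc; elim=> [|e h {}f me mf IH].
  have := simple_mcurve0 T; congr simple_mcurve.
  by apply/funext => t; rewrite scaler0.
have := simple_mcurveS h (measurable_funM mc me) IH.
by congr simple_mcurve; apply/funext => t; rewrite scalerDr scalerA.
Qed.

Lemma simple_mcurve_comp d' (T' : measurableType d') (u : T' -> T) f :
  measurable_fun setT u -> simple_mcurve f -> simple_mcurve (fun t => f (u t)).
Proof.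
move=> mu; elim=> [|e h {}f me mf IH]; first exact: simple_mcurve0.
exact: (simple_mcurveS h (measurableT_comp me mu) IH).
Qed.

Lemma simple_curve_mcurve (s : seq (set T * L2 a b)) :
  simple_measurable s -> simple_mcurve (simple_curve s).
Proof.
rewrite /simple_curve; elim: s => [|q s IH] ms.
  have := simple_mcurve0 T; congr simple_mcurve.
  by apply/funext => t; rewrite big_nil.
have ms' : simple_measurable s by move=> r rs; apply: ms; rewrite inE rs orbT.
have mq : measurable_fun setT (\1_(q.1) : T -> R).
  by apply/measurable_indic/ms; rewrite inE eqxx.
have := simple_mcurveS q.2 mq (IH ms').
by congr simple_mcurve; apply/funext => t; rewrite big_cons.
Qed.

Lemma simple_mcurve_hinner f g : simple_mcurve f -> simple_mcurve g ->
  measurable_fun setT (fun t => hinner (f t) (g t)).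
Proof.
move=> sf sg; have H h : measurable_fun setT (fun t => hinner h (g t)).
  elim: sg => [|c k {}g mc _ IH].
    by rewrite (_ : (fun _ => _) = cst (hinner h 0)).
  rewrite (_ : (fun _ => _) = (fun t => c t * hinner h k + hinner h (g t))).
    by apply: measurable_funD => //; apply: measurable_funM.
  by apply/funext => t; rewrite hinnerDr hinnerZr.
elim: sf => [|c k {}f mc _ IH].
  rewrite (_ : (fun _ => _) = cst 0)//.
  by apply/funext => t; rewrite hinner0l.
rewrite (_ : (fun _ => _) = (fun t => c t * hinner k (g t) + hinner (f t) (g t))).
  by apply: measurable_funD => //; apply: measurable_funM.
by apply/funext => t; rewrite hinnerDl hinnerZl.
Qed.

Lemma measurable_sqrt : measurable_fun setT (@Num.sqrt R).
Proof. apply: continuous_measurable_fun; exact: sqrt_continuous. Qed.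

Lemma hnorm_sqrt (f : L2 a b) : hnorm f = Num.sqrt (hinner f f).
Proof. by rewrite -hnorm_sqr sqrtr_sqr ger0_norm// hnorm_ge0. Qed.

(** For simple curves bilinearity reduces the inner product to products of measurable coefficients;
    [hnorm] is 1-Lipschitz, so the limit inherits measurability. *)
Lemma mcurve_hnorm f : mcurve f -> measurable_fun setT (fun t => hnorm (f t)).
Proof.
move=> [s ms sf].
apply: (@measurable_fun_cvg _ _ _ _ (fun j t => hnorm (s j t))) => [j|t _].
  rewrite (_ : (fun _ => _) = (fun t => Num.sqrt (hinner (s j t) (s j t)))).
    by apply: measurableT_comp measurable_sqrt _; apply: simple_mcurve_hinner.
  by apply/funext => t; rewrite hnorm_sqrt.
apply/cvgrPdist_lt => e e0; have /cvgrPdist_lt/(_ _ e0) := sf t.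
apply: filterS => j; rewrite sub0r normrN ger0_norm ?hnorm_ge0// => h.
by rewrite (le_lt_trans _ h)// distrC hnorm_dist.
Qed.

Lemma mcurve_cst h : mcurve (fun _ : T => h).
Proof.
exists (fun _ _ => h) => [_|t]; first exact: simple_mcurve_cst.
by rewrite subrr hnorm0; exact: cvg_cst.
Qed.

Lemma mcurveD f g : mcurve f -> mcurve g -> mcurve (fun t => f t + g t).
Proof.
move=> [s ms sf] [s' ms' sg]; exists (fun j t => s j t + s' j t) => [j|t].
  exact: simple_mcurveD.
apply: (@cvg0_le _ (fun j => hnorm (s j t - f t) + hnorm (s' j t - g t))) => [j|].
  by rewrite hnorm_ge0/= opprD addrACA hnormD.
by rewrite -[X in _ --> X]addr0; apply: cvgD.
Qed.

Lemma mcurveZ c f : measurable_fun setT c -> mcurve f ->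
  mcurve (fun t => c t *: f t).
Proof.
move=> mc [s ms sf]; exists (fun j t => c t *: s j t) => [j|t].
  exact: simple_mcurveZ.
apply: (@cvg0_le _ (fun j => `|c t| * hnorm (s j t - f t))) => [j|].
  by rewrite hnorm_ge0/= -scalerBr hnormZ.
by rewrite -[X in _ --> X](mulr0 `|c t|); apply: cvgM => //; exact: cvg_cst.
Qed.

Lemma mcurveB f g : mcurve f -> mcurve g -> mcurve (fun t => f t - g t).
Proof.
move=> mf mg; have := mcurveD mf (mcurveZ (@measurable_cst _ _ T R setT (-1)) mg).
by congr mcurve; apply/funext => t /=; rewrite scaleN1r.
Qed.

Lemma mcurve_sum I (r : seq I) (p : pred I) (F : I -> T -> L2 a b) :
  (forall i, p i -> mcurve (F i)) -> mcurve (fun t => \sum_(i <- r | p i) F i t).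
Proof.
move=> mF; elim: r => [|i r IH].
  have := mcurve_cst 0; congr mcurve.
  by apply/funext => t; rewrite big_nil.
have [pi|pi] := boolP (p i).
  have := mcurveD (mF i pi) IH; congr mcurve.
  by apply/funext => t; rewrite big_cons pi.
move: IH; congr mcurve.
by apply/funext => t; rewrite big_cons (negbTE pi).
Qed.

Lemma mcurve_comp d' (T' : measurableType d') (u : T' -> T) f :
  measurable_fun setT u -> mcurve f -> mcurve (fun t => f (u t)).
Proof.
move=> mu [s ms sf]; exists (fun j t => s j (u t)) => [j|t]; last exact: sf.
exact: simple_mcurve_comp.
Qed.

Lemma random_mcurve f : random_curve f -> mcurve f.
Proof.
by move=> [s [ms sf]]; exists (fun j => simple_curve (s j)) => // j;
  exact: simple_curve_mcurve.
Qed.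

(** By polarization this reduces to norms of curves. *)
Lemma mcurve_hinner f g : mcurve f -> mcurve g ->
  measurable_fun setT (fun t => hinner (f t) (g t)).
Proof.
move=> mf mg; rewrite (_ : (fun _ => _) = (fun t => 4^-1 *
    (hnorm (f t + g t) ^+ 2 - hnorm (f t - g t) ^+ 2))).
  apply: measurable_funM => //; apply: measurable_funB; apply: measurable_funX;
    apply: mcurve_hnorm; [exact: mcurveD|exact: mcurveB].
apply/funext => t; rewrite !hnorm_sqr hinnerBl !hinnerBr hinnerDl !hinnerDr.
by rewrite (hinnerC (g t) (f t)); lra.
Qed.

End closure.

(** Balls are open by the triangle inequality, hence belong to the generator of the Borel sets. *)
Lemma measurable_hnormB (h : L2 a b) :
  measurable_fun setT (fun y : L2 a b => hnorm (y - h)).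
Proof.
apply: (measurability _ (RGenCInfty.measurableE R)) => // _ [_ [x ->] <-].
rewrite setTI (_ : _ @^-1` _ = ~` [set y | hnorm (y - h) < x]); last first.
  apply/seteqP; split=> y /=; rewrite in_itv/= andbT => hx.
    by apply/negP; rewrite -leNgt.
  by rewrite leNgt; apply/negP.
apply: measurableC; apply: sub_sigma_algebra => f /= fx.
exists (x - hnorm (f - h)); first by rewrite subr_gt0.
move=> g gf; have := hnorm_triangle g h f; lra.
Qed.

(** A simple curve takes finitely many values, one for each choice of the indicators that are
    switched on. Over all curves [l] and all stages [j] of the approximation this leaves countably
    many values. *)
Lemma random_curve_dense d (T : measurableType d) (f : nat -> T -> L2 a b) :
  (forall l, random_curve (f l)) ->
  exists h : nat -> L2 a b, forall l t e, 0 < e ->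
    exists m, hnorm (f l t - h m) < e.
Proof.
move=> /choice[s sP].
(* The code is the curve, the stage, and the bits telling which indicators equal 1. *)
pose H (z : nat * nat * seq bool) := \sum_(x <- zip z.2 (s z.1.1 z.1.2))
  (x.1)%:R *: x.2.2.
exists (fun m => if unpickle m is Some z then H z else 0) => l t e e0.
have [_ /(_ t)/cvgrPdist_lt/(_ _ e0)[j _ /(_ j (leqnn _))]] := sP l.
rewrite sub0r normrN ger0_norm ?hnorm_ge0// hnorm_distC => sj.
exists (pickle (l, j, [seq `[<q.1 t>] | q <- s l j])); rewrite pickleK.
suff -> : H (l, j, [seq `[<q.1 t>] | q <- s l j]) = simple_curve (s l j) t by [].
rewrite /H /simple_curve /=; elim: (s l j) => [|q r IH] /=.
  by rewrite !big_nil.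
by rewrite !big_cons/= IH; congr (_ *: _ + _); rewrite indicE; congr (_ %:R);
  rewrite asboolE.
Qed.

Section dense.
Context (h : nat -> L2 a b).

Let closure_h := [set y : L2 a b | forall e, 0 < e -> exists m, hnorm (y - h m) < e].

Let closure_hE : closure_h =
  \bigcap_(k : nat) \bigcup_m [set y | hnorm (y - h m) < k.+1%:R^-1].
Proof.
apply/seteqP; split=> y /= hy.
  move=> k _; have [|m hm] := hy k.+1%:R^-1; first by rewrite invr_gt0.
  by exists m.
move=> e e0; have [k _ ke] := near_infty_natSinv_lt (PosNum e0).
by have [m _ hm] := hy k I; exists m; rewrite (lt_trans hm)//; exact: ke k (leqnn _).
Qed.

Let measurable_ball_h m e : measurable [set y | hnorm (y - h m) < e].
Proof.
have /(_ measurableT `]-oo, e[%classic) := measurable_hnormB (h m).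
by rewrite setTI; apply.
Qed.

Let measurable_closure : measurable closure_h.
Proof.
rewrite closure_hE; apply: bigcapT_measurable => k.
exact: bigcupT_measurable.
Qed.

(** On the range of [f] an open set agrees with a countable union of balls with centres [h m] and
    radii [1 / (k + 1)], and the preimage of each ball is measurable because [hnorm (f t - h m)]
    is. *)
Lemma dense_range_measurable d (T : measurableType d) (f : T -> L2 a b) :
  mcurve f -> (forall t e, 0 < e -> exists m, hnorm (f t - h m) < e) ->
  measurable_fun setT f.
Proof.
move=> mf fh; have mf' m := mcurve_hnorm (mcurveB mf (mcurve_cst T (h m))).
apply: (measurability _ (erefl : <<s @L2_open R a b >> = _)) => // _ [U oU <-].
pose J m := [set k | [set y | hnorm (y - h m) < k.+1%:R^-1] `<=` U].
rewrite setTI (_ : _ @^-1` _ =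
  \bigcup_m \bigcup_(k in J m) [set t | hnorm (f t - h m) < k.+1%:R^-1]).
  apply: bigcupT_measurable => m; apply: bigcup_measurable => k _.
  have /(_ measurableT `]-oo, k.+1%:R^-1[%classic) := mf' m.
  by rewrite setTI; apply.
apply/seteqP; split=> t /=; last by move=> [m _ [k Jmk]] /Jmk.
(* If the ball of radius [r] about [f t] lies in [U] and [1 / (k + 1) < r / 2], a centre [h m]
   within [1 / (k + 1)] of [f t] has its ball of that radius inside [U]. *)
move=> /oU[r r0 rU]; have r20 : 0 < r / 2 by rewrite divr_gt0.
have [k _ /(_ k (leqnn _))/= kr] := near_infty_natSinv_lt (PosNum r20).
have {}kr : k.+1%:R^-1 < r / 2 := kr.
have [|m hm] := fh t k.+1%:R^-1; first by rewrite invr_gt0.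
exists m => //; exists k => //= y /= ym; apply: rU.
have := hnorm_triangle y (f t) (h m); rewrite (hnorm_distC (h m)).
move: kr ym hm; set z := k.+1%:R^-1; lra.
Qed.

(** The point closest to [y] among [0, h 0, ..., h n.-1], the earlier one being kept in case of a
    tie. The recursion makes it a simple curve with measurable cells. *)
Fixpoint nearest n (y : L2 a b) : L2 a b :=
  if n is m.+1 then
    if hnorm (y - h m) < hnorm (y - nearest m y) then h m else nearest m y
  else 0.

Let measurable_nearest_dist n :
  measurable_fun setT (fun y : L2 a b => hnorm (y - nearest n y)).
Proof.
elim: n => [|n IH]; first exact: measurable_hnormB.
rewrite (_ : (fun _ => _) = (fun y : L2 a b => Num.min (hnorm (y - h n)) (hnorm (y - nearest n y)))).
  by apply: measurable_minr => //; exact: measurable_hnormB.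
by apply/funext => y; rewrite /= /Order.min; case: ifP.
Qed.

Let simple_mcurve_nearest n : simple_mcurve (nearest n).
Proof.
elim: n => [|n IH]; first exact: simple_mcurve0.
set A := [set y : L2 a b | hnorm (y - h n) < hnorm (y - nearest n y)].
have mA : measurable_fun setT (\1_A : _ -> R).
  apply: measurable_indic; rewrite -[A]setTI.
  exact: (measurable_fun_ltr (measurable_hnormB (h n)) (measurable_nearest_dist n)).
have mB : measurable_fun setT (fun y : L2 a b => 1 - \1_A y : R).
  exact: measurable_funB.
have := simple_mcurveS (h n) mA (simple_mcurveZ mB IH).
congr simple_mcurve; apply/funext => y /=; rewrite indicE.
have -> : (y \in A) = (hnorm (y - h n) < hnorm (y - nearest n y)).
  by apply/idP/idP; rewrite inE.
case: ifP => _; first by rewrite scale1r subrr scale0r addr0.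
by rewrite scale0r add0r subr0 scale1r.
Qed.

Let nearest_le n m y : (m < n)%N -> hnorm (y - nearest n y) <= hnorm (y - h m).
Proof.
elim: n => // n IH; rewrite ltnS leq_eqVlt => /predU1P[->|/IH mn] /=.
  by case: ltP => // /le_trans->.
by case: ltP => // /ltW/le_trans->.
Qed.

(* A curve-valued map on L2 itself which is a limit of simple ones and fixes the
   closure of the range of h: composing with it replaces the separability of
   L^2([a, b]). *)
Lemma dense_retraction : exists2 k : L2 a b -> L2 a b, mcurve k &
  forall y, (forall e, 0 < e -> exists m, hnorm (y - h m) < e) -> k y = y.
Proof.
exists (fun y => \1_closure_h y *: y); last first.
  by move=> y yh; rewrite indicE mem_set ?scale1r.
(* Outside the closure [nearest n y] need not converge; the indicator forces the limit 0 there. *)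
exists (fun n y => \1_closure_h y *: nearest n y) => [n|y].
  by apply: simple_mcurveZ => //; exact: measurable_indic.
rewrite indicE; have [yh|yh] := boolP (y \in closure_h); last first.
  by under eq_fun do rewrite !scale0r subrr hnorm0; exact: cvg_cst.
move: yh; rewrite inE => yh.
apply/cvgrPdist_lt => e e0; have [m ym] := yh e e0.
exists m.+1 => // n /= mn.
rewrite sub0r normrN ger0_norm ?hnorm_ge0// -scalerBr scale1r hnorm_distC.
by rewrite (le_lt_trans _ ym)// nearest_le.
Qed.

End dense.

End curve_measurability.

Lemma cvge0_ltP (R : realType) (u : nat -> \bar R) : (forall j, 0 <= u j)%E ->
  u j @[j --> \oo] --> 0%E <->
  forall e : R, 0 < e -> \forall j \near \oo, (u j < e%:E)%E.
Proof.
move=> u0; split=> [cu e e0|H].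
  by apply: (cu [set x | (x < e%:E)%E]); exact: (@open_ereal_lt' R 0%E e%:E).
apply/fine_cvgP; split.
  apply: filterS (H 1 ltr01) => j uj.
  by rewrite ge0_fin_numE// (lt_trans uj)// ltry.
apply/cvgrPdist_lt => e e0; apply: filterS (H e e0) => j uj.
rewrite sub0r normrN ger0_norm ?fine_ge0// -lte_fin fineK//.
by rewrite ge0_fin_numE// (lt_trans uj)// ltry.
Qed.

(** * From integrals over the events of [X] to integrals against weights [h (X w)] *)

Section integral_weights.
Local Open Scope ereal_scope.
Context d d' (T : measurableType d) (T' : measurableType d') (R : realType).
Variables (P : {measure set T -> \bar R}) (X : T -> T').
Hypothesis mX : measurable_fun setT X.

Import HBNNSimple.

Let mXB B : measurable B -> measurable (X @^-1` B).
Proof. by move=> mB; rewrite -[_ @^-1` _]setTI; exact: mX. Qed.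

Lemma nnsfun_comp_integral (Z : T -> R) (g : {nnsfun T' >-> R}) :
  measurable_fun setT Z -> (forall w, (0 <= Z w)%R) ->
  \int[P]_w ((g (X w))%:E * (Z w)%:E) =
  \sum_(y \in range g) y%:E * \int[P]_(w in X @^-1` (g @^-1` [set y])) (Z w)%:E.
Proof.
move=> mZ Z0.
have mZ' : measurable_fun setT (EFin \o Z) by exact/measurable_EFinP.
have H w : (g (X w))%:E * (Z w)%:E =
    \sum_(y \in range g) (y * \1_(g @^-1` [set y]) (X w))%:E * (Z w)%:E.
  rewrite (fimfunE g) -fsumEFin//.
  rewrite !fsbig_finite//= ge0_sume_distrl// => y _.
  exact: nnfun_muleindic_ge0.
under eq_integral do rewrite H.
have m1 y : measurable_fun setT (fun w => (y * \1_(g @^-1` [set y]) (X w))%:E).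
  apply/measurable_EFinP; apply: measurable_funM => //.
  by apply: (measurableT_comp _ mX); exact: measurable_indic.
rewrite ge0_integral_fsum//; last 2 first.
- by move=> y; apply: emeasurable_funM.
- by move=> y w _; rewrite mule_ge0 ?lee_fin//; exact: nnfun_muleindic_ge0.
apply: eq_fsbigr => y; rewrite inE => -[x _ <-].
under eq_integral do rewrite EFinM -muleA.
rewrite ge0_integralZl//; last 3 first.
- apply: emeasurable_funM => //; apply/measurable_EFinP.
  by apply: (measurableT_comp _ mX); exact: measurable_indic.
- by move=> w _; rewrite mule_ge0 ?lee_fin.
- by rewrite lee_fin.
congr (_ * _); rewrite [RHS]integral_mkcond.
apply: eq_integral => w _; rewrite patchE indicE.
have -> : (X w \in g @^-1` [set g x]) = (w \in X @^-1` (g @^-1` [set g x])).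
  by apply/idP/idP; rewrite !inE.
by case: ifP => _; rewrite ?mul1e ?mul0e.
Qed.

(** Simple weights give finite sums of the assumed inequalities, and monotone convergence reaches
    every nonnegative [h]. This stands in for taking a function of [X] out of a conditional
    expectation. *)
Lemma ge0_integral_comp_le (Z1 Z2 : T -> R) (h : T' -> R) :
  measurable_fun setT Z1 -> (forall w, (0 <= Z1 w)%R) ->
  measurable_fun setT Z2 -> (forall w, (0 <= Z2 w)%R) ->
  (forall B, measurable B ->
    \int[P]_(w in X @^-1` B) (Z1 w)%:E <= \int[P]_(w in X @^-1` B) (Z2 w)%:E) ->
  measurable_fun setT h -> (forall x, (0 <= h x)%R) ->
  \int[P]_w ((h (X w))%:E * (Z1 w)%:E) <= \int[P]_w ((h (X w))%:E * (Z2 w)%:E).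
Proof.
move=> mZ1 Z10 mZ2 Z20 Z12 mh h0.
have mh' : measurable_fun setT (EFin \o h) by exact/measurable_EFinP.
pose g := nnsfun_approx measurableT mh'.
have cvgZ (Z : T -> R) : measurable_fun setT Z -> (forall w, (0 <= Z w)%R) ->
    \int[P]_w ((g n (X w))%:E * (Z w)%:E) @[n --> \oo] --> \int[P]_w ((h (X w))%:E * (Z w)%:E).
  move=> mZ Z0; have [mg gn0] : (forall n, measurable_fun setT
      (fun w => (g n (X w))%:E * (Z w)%:E)) /\ (forall n w, 0 <= (g n (X w))%:E * (Z w)%:E).
    split=> [n|n w]; last by rewrite mule_ge0 ?lee_fin.
    apply: emeasurable_funM; apply/measurable_EFinP => //.
    exact: (measurableT_comp _ mX).
  rewrite [X in _ --> X](_ : _ = \int[P]_w limn (fun n => (g n (X w))%:E * (Z w)%:E)).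
    apply: cvg_monotone_convergence => // w _ m n mn.
    by rewrite lee_wpmul2r// ?lee_fin//; exact/lefP/nd_nnsfun_approx.
  apply: eq_integral => w _; apply/esym/cvg_lim => //.
  apply: cvgeZr => //.
  exact: (cvg_nnsfun_approx measurableT mh' (fun x _ => h0 x) (I : setT (X w))).
have c1 := cvgZ _ mZ1 Z10; have c2 := cvgZ _ mZ2 Z20.
rewrite -(cvg_lim _ c1)// -(cvg_lim _ c2)//.
apply: lee_lim; [by apply/cvg_ex; eexists; exact: c1
                |by apply/cvg_ex; eexists; exact: c2|].
apply: nearW => n; rewrite !nnsfun_comp_integral// !fsbig_finite//=.
rewrite big_seq [leRHS]big_seq; apply: lee_sum => y.
rewrite in_fset_set// inE => -[x _ <-]; rewrite lee_wpmul2l ?lee_fin//.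
exact/Z12/measurable_funPTI.
Qed.

Lemma ge0_integral_comp_eq (Z1 Z2 : T -> R) (h : T' -> R) :
  measurable_fun setT Z1 -> (forall w, (0 <= Z1 w)%R) ->
  measurable_fun setT Z2 -> (forall w, (0 <= Z2 w)%R) ->
  (forall B, measurable B ->
    \int[P]_(w in X @^-1` B) (Z1 w)%:E = \int[P]_(w in X @^-1` B) (Z2 w)%:E) ->
  measurable_fun setT h -> (forall x, (0 <= h x)%R) ->
  \int[P]_w ((h (X w))%:E * (Z1 w)%:E) = \int[P]_w ((h (X w))%:E * (Z2 w)%:E).
Proof.
move=> mZ1 Z10 mZ2 Z20 Z12 mh h0; apply/eqP; rewrite eq_le.
by apply/andP; split; apply: ge0_integral_comp_le => // B mB; rewrite Z12.
Qed.

End integral_weights.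

(** * Bochner means tested against a fixed curve *)

Section weak_mean.
Context {R : realType} (a b : R) d (T : measurableType d) (P : probability T R).
Implicit Types (f : T -> L2 a b) (g m : L2 a b).

Let integrable_simple (s : seq (set T * L2 a b)) g : simple_measurable s ->
  P.-integrable setT (EFin \o (fun t => hinner (simple_curve s t) g)) /\
  \int[P]_t hinner (simple_curve s t) g = hinner (simple_mean P s) g.
Proof.
rewrite /simple_curve /simple_mean; elim: s => [|q s IH] ms.
  rewrite (_ : (fun _ => _) = cst 0).
    by rewrite big_nil hinner0l; split; [exact: integrable0|by rewrite /Rintegral /= integral0].
  by apply/funext => t; rewrite big_nil hinner0l.
have [IH1 IH2] : _ /\ _ := IH (fun r rs => ms r (mem_behead (s := q :: s) rs)).
have mq : measurable q.1 by apply: ms; rewrite inE eqxx.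
have iq : P.-integrable setT (EFin \o (fun t => hinner q.2 g * \1_(q.1) t)).
  rewrite (_ : _ \o _ = (fun t => ((hinner q.2 g)%:E * (\1_(q.1) t)%:E)%E)).
    by apply: integrableZl => //; exact: integrable_indic.
  by apply/funext => t /=; rewrite EFinM.
rewrite (_ : (fun _ => _) = (fun t => hinner q.2 g * \1_(q.1) t +
    hinner (\sum_(r <- s) \1_(r.1) t *: r.2) g)); last first.
  by apply/funext => t; rewrite big_cons hinnerDl hinnerZl mulrC.
split.
  have := integrableD measurableT iq IH1.
  by apply: eq_integrable => // t _ /=; rewrite EFinD.
rewrite RintegralD// IH2 big_cons hinnerDl hinnerZl; congr (_ + _).
rewrite RintegralZl//; last exact: integrable_indic.
by rewrite mulrC /Rintegral integral_indic// setIT.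
Qed.

(** By Cauchy-Schwarz, convergence of the simple curves in L^1 and of their means in norm passes to
    inner products with [g]. All later uses of a Bochner mean go through this weak form. *)
Lemma has_mean_hinner f m g : has_mean P f m ->
  P.-integrable setT (EFin \o (fun t => hinner (f t) g)) /\
  \int[P]_t hinner (f t) g = hinner m g.
Proof.
move=> [/random_mcurve mf [s [ms sf sm]]].
have msf j : measurable_fun setT (fun t => hnorm (simple_curve (s j) t - f t)).
  apply: mcurve_hnorm; apply: mcurveB => //; apply: random_mcurve.
  exists (fun=> s j); split => // t.
  by under eq_fun do rewrite subrr hnorm0; exact: cvg_cst.
have msfg j : measurable_fun setT (fun t => hinner (simple_curve (s j) t - f t) g).
  apply: mcurve_hinner; last exact: mcurve_cst.
  apply: mcurveB => //; apply: random_mcurve.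
  exists (fun=> s j); split => // t.
  by under eq_fun do rewrite subrr hnorm0; exact: cvg_cst.
have ifin j : (\int[P]_t (hnorm (simple_curve (s j) t - f t))%:E < +oo)%E ->
    P.-integrable setT (EFin \o (fun t => hnorm (simple_curve (s j) t - f t))).
  move=> fin; apply/integrableP; split; first exact/measurable_EFinP.
  by under eq_integral do rewrite /= ger0_norm ?hnorm_ge0//.
have idiff j : (\int[P]_t (hnorm (simple_curve (s j) t - f t))%:E < +oo)%E ->
    P.-integrable setT (EFin \o (fun t => hinner (simple_curve (s j) t - f t) g)).
  move=> /ifin ij; apply: (le_integrable _ _ _ (integrableZl _ (hnorm g) ij)) => //.
    exact/measurable_EFinP.
  move=> t _ /=; rewrite lee_fin (le_trans (hinner_le _ _))// mulrC.
  by rewrite ger0_norm// mulr_ge0 ?hnorm_ge0.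
have fmain j : (\int[P]_t (hnorm (simple_curve (s j) t - f t))%:E < +oo)%E ->
    P.-integrable setT (EFin \o (fun t => hinner (f t) g)).
  move=> /idiff ij; have [ij1 _] := integrable_simple g (ms j).
  have := integrableB measurableT ij1 ij; apply: eq_integrable => // t _ /=.
  by rewrite -EFinB hinnerBl subKr.
have small (e : R) : 0 < e -> exists j,
    (\int[P]_t (hnorm (simple_curve (s j) t - f t))%:E < e%:E)%E /\
    hnorm (simple_mean P (s j) - m) < e.
  move=> e0; have /cvgrPdist_lt/(_ _ e0) s1 := sm.
  have s2 : \forall j \near \oo,
      (\int[P]_t (hnorm (simple_curve (s j) t - f t))%:E < e%:E)%E.
    have /cvge0_ltP := sf; apply => // n.
    by apply: integral_ge0 => t _; rewrite lee_fin hnorm_ge0.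
  have [j _ /(_ j (leqnn _))[j1 j2]] := filterI s1 s2; exists j; split => //.
  by move: j1; rewrite sub0r normrN ger0_norm ?hnorm_ge0.
have [j0 [j0P _]] := small 1 ltr01.
have intf : P.-integrable setT (EFin \o (fun t => hinner (f t) g)).
  by apply: (fmain j0); rewrite (lt_trans j0P)// ltry.
split => //; apply/eqP; rewrite -subr_eq0 -normr_le0.
suff key (e : R) : 0 < e -> `|\int[P]_t hinner (f t) g - hinner m g| <= e.
  by apply/ler_addgt0Pl => e e0; rewrite addr0; exact: key.
move=> e0; have hg := hnorm_ge0 g.
have hg1 : 0 < hnorm g + 1 by rewrite ltr_wpDl.
have hg2 : hnorm g + 1 != 0 by rewrite gt_eqF.
(* Two errors, each at most [e' * hnorm g], then add up to at most [e]; the [+ 1] covers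
   [hnorm g = 0]. *)
pose e' : R := e / (2 * (hnorm g + 1)).
have [|j [j1 j2]] := small e'; first by rewrite divr_gt0// mulr_gt0.
have jfin := lt_trans j1 (ltry e').
have [ij1 ij2] := integrable_simple g (ms j).
have -> : \int[P]_t hinner (f t) g - hinner m g =
    hinner (simple_mean P (s j) - m) g -
    \int[P]_t hinner (simple_curve (s j) t - f t) g.
  rewrite hinnerBl -ij2 (_ : \int[P]_t hinner (simple_curve (s j) t - f t) g =
    \int[P]_t hinner (simple_curve (s j) t) g - \int[P]_t hinner (f t) g); first lra.
  by rewrite -RintegralB//; apply: eq_Rintegral => t _; rewrite hinnerBl.
have h1 : `|hinner (simple_mean P (s j) - m) g| <= e' * hnorm g.
  by rewrite (le_trans (hinner_le _ _))// ler_wpM2r// ltW.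
have h2 : `|\int[P]_t hinner (simple_curve (s j) t - f t) g| <= e' * hnorm g.
  rewrite (le_trans (le_normr_Rintegral _ (idiff _ jfin)))//.
  apply: (@le_trans _ _ (\int[P]_t (hnorm g * hnorm (simple_curve (s j) t - f t)))).
    apply: le_Rintegral => //; first exact: integrable_norm (idiff _ jfin).
      exact: integrableZl (ifin _ jfin).
    by move=> t _; rewrite mulrC hinner_le.
  rewrite RintegralZl//; last exact: ifin.
  rewrite mulrC ler_wpM2r// ltW//.
  by rewrite -lte_fin /Rintegral fineK// (integrable_fin_num _ (ifin _ jfin)).
rewrite (le_trans (ler_normB _ _))// (le_trans (lerD h1 h2))//.
have -> : e' * hnorm g + e' * hnorm g = e * (hnorm g / (hnorm g + 1)).
  by rewrite /e'; field.
by rewrite ler_piMr// ?ltW// ltr_pdivrMr// mul1r ltrDl.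
Qed.

End weak_mean.

(** * Integrating one record while the others are frozen *)

Section decoupling.
Local Open Scope ereal_scope.
Context {R : realType} {d dO : measure_display}
  {T : measurableType d} {O : measurableType dO} (P : probability T R) (n : nat).
Variable U : 'I_n -> T -> O.
Hypothesis mU : forall i, measurable_fun setT (U i).
Hypothesis iU : mutually_independent P U.

Let record w := [tuple U i w | i < n].

Lemma measurable_record : measurable_fun setT (fun w => [tuple U i w | i < n]).
Proof.
apply/measurable_fun_tnthP => i.
rewrite (_ : _ \o _ = U i)//; apply/funext => w /=.
by rewrite tnth_mktuple.
Qed.

(** A family closed under intersection that generates the product sigma-algebra; mutual independence
    prescribes the law of the records on it. *)
Definition boxes : set (set (n.-tuple O)) := [set B |
  exists2 C : 'I_n -> set O, forall j, measurable (C j) &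
    B = [set v | forall j, C j (tnth v j)]].

Lemma measurable_box (C : 'I_n -> set O) : (forall j, measurable (C j)) ->
  measurable [set v : n.-tuple O | forall j, C j (tnth v j)].
Proof.
move=> mC; rewrite (_ : [set _ | _] = \bigcap_(j in [set: 'I_n])
    ((fun v => tnth v j) @^-1` (C j))).
  apply: fin_bigcap_measurable => // j _.
  by rewrite -[_ @^-1` _]setTI; exact: measurable_tnth.
by apply/seteqP; split=> v /= h; [move=> j _; exact: h|move=> j; exact: (h j I)].
Qed.

Lemma measurable_tuple_boxes : @measurable _ (n.-tuple O) = <<s boxes >>.
Proof.
apply/seteqP; split; last first.
  apply: smallest_sub; first exact: sigma_algebra_measurable.
  by move=> _ [C mC ->]; exact: measurable_box.
apply: smallest_sub; first exact: smallest_sigma_algebra.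
move=> B; rewrite -bigcup_seq => -[i _ [C mC <-]]; apply: sub_sigma_algebra.
exists (fun j => if j == i then C else setT).
  by move=> j; case: ifP.
rewrite setTI; apply/seteqP; split=> v /= h; last by have := h i; rewrite eqxx.
by move=> j; case: eqP => // ->.
Qed.

Section coordinate.
Variable i : 'I_n.

(** Overwriting the i-th record by [point] removes the dependence on [U i] while keeping the tuple
    type, so that functions of a full tuple still apply. *)
Let rest w : n.-tuple O := [tuple if j == i then point else U j w | j < n].

Let mrest : measurable_fun setT rest.
Proof.
apply/measurable_fun_tnthP => j; rewrite (_ : _ \o _ =
    if j == i then cst point else U j); first by case: ifP.
by apply/funext => w /=; rewrite tnth_mktuple; case: ifP.
Qed.

Let mUA A : measurable A -> measurable (U i @^-1` A).
Proof. by move=> mA; rewrite -[_ @^-1` _]setTI; exact: mU. Qed.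

Let indep_rect A B : measurable A -> measurable B ->
  P (U i @^-1` A `&` rest @^-1` B) = P (U i @^-1` A) * P (rest @^-1` B).
Proof.
move=> mA mB.
pose rX : {mfun T >-> n.-tuple O} := mfun_Sub (mem_set mrest).
pose m1 := pushforward (mrestr P (mUA mA)) rX.
pose k : {nonneg R} := NngNum (fine_ge0 (measure_ge0 P (U i @^-1` A))).
pose m2 := mscale k (distribution P rX).
have kE : (k%:num)%:E = P (U i @^-1` A).
  by rewrite /k /= fineK// fin_num_measure//; exact: mUA.
have m2E X : m2 X = P (U i @^-1` A) * P (rest @^-1` X) by rewrite /m2 /mscale kE.
have m1E X : m1 X = P (U i @^-1` A `&` rest @^-1` X).
  by rewrite /m1 /pushforward /mrestr setIC.
suff : m1 B = m2 B by rewrite m1E m2E.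
apply: (@measure_unique _ _ _ boxes (fun=> setT)) => //.
- exact: measurable_tuple_boxes.
- move=> _ _ [C mC ->] [C' mC' ->]; exists (fun j => C j `&` C' j).
    by move=> j; exact: measurableI.
  by apply/seteqP; split=> v /= => [[h1 h2] j|h]; [split|split=> j; have [] := h j].
- by move=> _; exists (fun=> setT) => //; apply/seteqP; split.
- by apply/seteqP; split => // v _; exists 0%N.
- move=> _ [C mC ->]; rewrite [LHS]m1E [RHS]m2E.
  (* Coordinate [i] of [rest] is always [point], so a box that excludes it has empty preimage and
     both sides vanish. *)
  have [Ci|Ci] := pselect (C i point); last first.
    rewrite (_ : rest @^-1` _ = set0) ?setI0 ?measure0 ?mule0//.
    apply/seteqP; split=> // w /= /(_ i).
    by rewrite tnth_mktuple eqxx => /Ci.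
  (* Stated for all [A'], so that [A' = setT] also evaluates the probability of the box alone. *)
  have restE A' : measurable A' ->
      P (U i @^-1` A' `&` rest @^-1` [set v | forall j, C j (tnth v j)]) =
      P (U i @^-1` A') * \prod_(j < n | j != i) P (U j @^-1` (C j)).
    move=> mA'; have := iU (B := fun j => if j == i then A' else C j).
    rewrite (_ : [set w | _] = U i @^-1` A' `&`
        rest @^-1` [set v | forall j, C j (tnth v j)]).
      move=> ->; last by move=> j; case: ifP.
      rewrite (bigD1 i)//= eqxx; congr (_ * _).
      by apply: eq_bigr => j /negbTE ->.
    apply/seteqP; split=> w /=.
      move=> h; split; first by have := h i; rewrite eqxx.
      move=> j; rewrite tnth_mktuple; have := h j.
      by case: (j =P i) => // -> _.
    move=> [h1 h2] j; have := h2 j; rewrite tnth_mktuple.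
    by case: eqP => // ->.
  rewrite restE//; have := restE _ (@measurableT _ O).
  by rewrite preimage_setT setTI => ->; rewrite probability_setT mul1e.
- move=> _; rewrite [ltLHS]m1E (le_lt_trans (probability_le1 _ _)) ?ltry//.
  by rewrite preimage_setT setIT; exact: mUA.
Qed.

(** The pair formed by [U i] and [rest] has a product law, so Tonelli applies; [G] ignores the
    coordinate in which [rest] differs from the full tuple. *)
Lemma decoupling_ge0 (G : O * n.-tuple O -> \bar R) :
  measurable_fun setT G -> (forall z, 0 <= G z) ->
  (forall o v v', (forall j, j != i -> tnth v j = tnth v' j) -> G (o, v) = G (o, v')) ->
  \int[P]_w G (U i w, [tuple U j w | j < n]) =
  \int[P]_w \int[P]_w' G (U i w', [tuple U j w | j < n]).
Proof.
move=> mG G0 Goff.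
have GE o w : G (o, [tuple U j w | j < n]) = G (o, rest w).
  by apply: Goff => j ji; rewrite !tnth_mktuple (negbTE ji).
under eq_integral do rewrite GE.
under [RHS]eq_integral do under eq_integral do rewrite GE.
have mUi := mU i; have mpair := measurable_fun_pair mUi mrest.
pose m1 := distribution P (mfun_Sub (mem_set mUi)).
pose m2 := distribution P (mfun_Sub (mem_set mrest)).
pose m12 := distribution P (mfun_Sub (mem_set mpair)).
have mE X : measurable X -> (m1 \x m2) X = m12 X.
  apply: product_measure_unique => A B mA mB.
  by rewrite -indep_rect.
have -> : \int[P]_w G (U i w, rest w) = \int[m12]_z G z.
  by rewrite ge0_integral_distribution.
transitivity (\int[m1 \x m2]_z G z).
  by apply: eq_measure_integral => A mA _; exact/esym/mE.
rewrite fubini_tonelli2// ge0_integral_distribution//; last 2 first.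
- exact: measurable_fun_fubini_tonelli_G.
- by move=> v; exact: integral_ge0.
apply: eq_integral => w _; rewrite /= /fubini_G ge0_integral_distribution//.
by apply: (measurableT_comp mG); exact: measurable_fun_pair.
Qed.

(** Centring at each frozen [v] is stated as equality of the integrals of the positive and negative
    parts, because the nonnegative decoupling applies to each part separately. Integrability then
    lets the two totals cancel. *)
Lemma decoupling_eq0 (G : O * n.-tuple O -> R) :
  measurable_fun setT G ->
  (forall o v v', (forall j, j != i -> tnth v j = tnth v' j) -> G (o, v) = G (o, v')) ->
  P.-integrable setT (fun w => (G (U i w, [tuple U j w | j < n]))%:E) ->
  (forall v, \int[P]_w (EFin \o G)^\+ (U i w, v) = \int[P]_w (EFin \o G)^\- (U i w, v)) ->
  \int[P]_w (G (U i w, [tuple U j w | j < n]))%:E = 0.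
Proof.
move=> mG Goff iG G0.
have mG' : measurable_fun setT (EFin \o G) by exact/measurable_EFinP.
have offp (s : O * n.-tuple O -> \bar R) : s = (EFin \o G)^\+ \/ s = (EFin \o G)^\- ->
    forall o v v', (forall j, j != i -> tnth v j = tnth v' j) -> s (o, v) = s (o, v').
  by case=> -> o v v' vv'; rewrite ?funeposE ?funenegE /= (Goff o v v').
have Ep := decoupling_ge0 (measurable_funepos mG') (funepos_ge0 _) (offp _ (or_introl erefl)).
have En := decoupling_ge0 (measurable_funeneg mG') (funeneg_ge0 _) (offp _ (or_intror erefl)).
have fin := integrable_pos_fin_num measurableT iG.
rewrite integralE.
have -> : \int[P]_w (fun w => (G (U i w, [tuple U j w | j < n]))%:E)^\- w =
    \int[P]_w (fun w => (G (U i w, [tuple U j w | j < n]))%:E)^\+ w.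
  transitivity (\int[P]_w (EFin \o G)^\- (U i w, [tuple U j w | j < n])).
    by apply: eq_integral => w _; rewrite !funenegE.
  transitivity (\int[P]_w (EFin \o G)^\+ (U i w, [tuple U j w | j < n])).
    by rewrite En Ep; apply: eq_integral => w _; exact/esym/G0.
  by apply: eq_integral => w _; rewrite !funeposE.
by rewrite subee.
Qed.

End coordinate.
End decoupling.

(** * Averaging over an independent variable with finitely many values *)

Section mixing.
Local Open Scope ereal_scope.
Context {R : realType} {d d' : measure_display}
  {T : measurableType d} {T' : measurableType d'} (P : probability T R)
  (F : finType) (V : T -> F) (U : T -> T').
Hypothesis mV : forall c, measurable (V @^-1` [set c]).
Hypothesis mU : measurable_fun setT U.

Lemma measurable_fun_case d2 (T2 : measurableType d2) (H : F -> T -> T2) :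
  (forall c, measurable_fun setT (H c)) -> measurable_fun setT (fun w => H (V w) w).
Proof.
move=> mH _ B mB; rewrite setTI.
rewrite (_ : _ @^-1` _ = \bigcup_(c in [set: F]) (V @^-1` [set c] `&` H c @^-1` B)).
  apply: fin_bigcup_measurable => // c _; apply: measurableI => //.
  by rewrite -[_ @^-1` _]setTI; exact: mH.
apply/seteqP; split=> w /=; first by move=> h; exists (V w).
by move=> [c _ [<-]].
Qed.

Lemma mcurve_case (a b : R) (H : F -> T -> L2 a b) :
  (forall c, mcurve (H c)) -> mcurve (fun w => H (V w) w).
Proof.
move=> mH; have : mcurve (fun w => (\sum_(c : F) \1_(V @^-1` [set c]) w *: H c w)%R).
  by apply: mcurve_sum => c _; apply: mcurveZ => //; exact: measurable_indic.
congr mcurve; apply/funext => w; rewrite (bigD1 (V w))//= big1 ?addr0.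
  by rewrite indicE mem_set//= scale1r.
move=> c cV; rewrite indicE memNset ?scale0r//= => Vc.
by move: cV; rewrite -Vc eqxx.
Qed.

(** Splitting according to the value of [V] gives, by independence, an average of the integrals for
    fixed [c] with the weights [P (V = c)], which sum to 1. It permits treating a random fold
    assignment as fixed. *)
Lemma mixing_le (H : F -> T' -> R) (v : \bar R) : independent_of P V U ->
  (forall c, measurable_fun setT (H c)) -> (forall c u, (0 <= H c u)%R) ->
  (forall c, \int[P]_w (H c (U w))%:E <= v) ->
  \int[P]_w (H (V w) (U w))%:E <= v.
Proof.
move=> iVU mH H0 Hv.
have mHU c : measurable_fun setT (fun w => (H c (U w))%:E).
  by apply/measurable_EFinP; exact: (measurableT_comp (mH c) mU).
have mI' c : measurable_fun setT (fun w => (\1_(V @^-1` [set c]) w : R)%:E).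
  exact/measurable_EFinP.
have HE w : (H (V w) (U w))%:E =
    \sum_(c : F) (H c (U w))%:E * (\1_(V @^-1` [set c]) w)%:E.
  rewrite (bigD1 (V w))//= big1 ?adde0.
    by rewrite indicE mem_set//= mule1.
  move=> c cV; rewrite indicE memNset ?mule0//= => Vc.
  by move: cV; rewrite -Vc eqxx.
have v0 : 0 <= v.
  by apply: le_trans (Hv (V point)); apply: integral_ge0 => w _; rewrite lee_fin.
under eq_integral do rewrite HE.
rewrite ge0_integral_sum//; last 2 first.
- by move=> c; exact: emeasurable_funM.
- by move=> c w _; rewrite mule_ge0 ?lee_fin.
have E c : \int[P]_w ((H c (U w))%:E * (\1_(V @^-1` [set c]) w)%:E) =
    P (V @^-1` [set c]) * \int[P]_w (H c (U w))%:E.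
  have fin : P (V @^-1` [set c]) \is a fin_num by rewrite fin_num_measure.
  (* By independence the indicator of [V = c] and the constant [P (V = c)] have the same integral
     over every event of [U], hence against the nonnegative weight [H c (U w)]. *)
  transitivity (\int[P]_w ((H c (U w))%:E * (fine (P (V @^-1` [set c])))%:E)).
    apply: (@ge0_integral_comp_eq _ _ _ _ _ P U mU _
      (cst (fine (P (V @^-1` [set c]))))) => // [w|B mB].
      by rewrite /= fine_ge0.
    have mUB : measurable (U @^-1` B) by rewrite -[_ @^-1` _]setTI; exact: mU.
    rewrite integral_indic//= iVU// integral_cst//= fineK//.
  rewrite ge0_integralZr//; last 2 first.
  - by move=> w _; rewrite lee_fin.
  - by rewrite lee_fin fine_ge0.
  by rewrite fineK// muleC.
under eq_bigr do rewrite E.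
apply: (@le_trans _ _ (\sum_(c : F) P (V @^-1` [set c]) * v)).
  by apply: lee_sum => c _; rewrite lee_wpmul2l.
rewrite -ge0_sume_distrl// -[leRHS]mul1e lee_wpmul2r//.
have -> : \sum_(c : F) P (V @^-1` [set c]) =
    \int[P]_w \sum_(c : F) (\1_(V @^-1` [set c]) w)%:E.
  rewrite ge0_integral_sum//.
  by apply: eq_bigr => c _; rewrite integral_indic// setIT.
rewrite -[leRHS](@probability_setT _ _ _ P) -[leRHS]mul1e -integral_cst//.
rewrite le_eqVlt; apply/orP; left; apply/eqP.
apply: eq_integral => w _; rewrite (bigD1 (V w))//= big1 ?adde0.
  by rewrite indicE mem_set.
move=> c cV; rewrite indicE memNset//= => Vc.
by move: cV; rewrite -Vc eqxx.
Qed.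

End mixing.

(** * First and second moments of sums over a fold, with frozen training data *)

Lemma integral_sum_cond d (T : measurableType d) (R : realType)
    (mu : {measure set T -> \bar R}) J (s : seq J) (Q : pred J)
    (f : J -> T -> \bar R) :
  (forall j, Q j -> mu.-integrable setT (f j)) ->
  (\int[mu]_x \sum_(j <- s | Q j) f j x = \sum_(j <- s | Q j) \int[mu]_x f j x)%E.
Proof.
move=> fi; pose f' j := if Q j then f j else cst 0%E.
have f'i j : mu.-integrable setT (f' j).
  by rewrite /f'; case: ifPn => [/fi//|_]; exact: integrable0.
transitivity (\int[mu]_x \sum_(j <- s | Q j) f' j x)%E.
  by apply: eq_integral => x _; apply: eq_bigr => j Qj; rewrite /f' Qj.
rewrite integral_sum//; apply: eq_bigr => j Qj.
by apply: eq_integral => x _; rewrite /f' Qj.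
Qed.

Lemma integral_funeposneg d (T : measurableType d) (R : realType)
    (mu : {measure set T -> \bar R}) A (f : T -> R) : measurable A ->
  mu.-integrable A (EFin \o f) -> (\int[mu]_(w in A) (f w)%:E = 0)%E ->
  (\int[mu]_(w in A) (EFin \o f)^\+ w = \int[mu]_(w in A) (EFin \o f)^\- w)%E.
Proof.
move=> mA fi; rewrite [in X in X -> _]integralE.
have fp := integrable_pos_fin_num mA fi.
have fn := integrable_neg_fin_num mA fi.
rewrite -(fineK fp) -(fineK fn) -EFinB => -[] /eqP.
by rewrite subr_eq0 => /eqP ->.
Qed.

Section moments.
Context {R : realType} {d dO : measure_display}
  {T : measurableType d} {O : measurableType dO} (P : probability T R) (n : nat).
Variable U : 'I_n -> T -> O.
Hypothesis mU : forall i, measurable_fun setT (U i).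
Hypothesis iU : mutually_independent P U.

Let record w := [tuple U i w | i < n].

Let mrecord : measurable_fun setT record.
Proof. exact: measurable_record. Qed.

Let mpair i : measurable_fun setT (fun w => (record w, U i w)).
Proof. exact: measurable_fun_pair. Qed.

Variable I : pred 'I_n.

(** Here [I] is the set of units of the fold, and [H] sees the tuple only through the units outside
    [I]. In particular it ignores record [i] of the tuple, so decoupling applies and a bound valid
    for every frozen tuple survives averaging. *)
Lemma first_moment_le1 (H : n.-tuple O * O -> R) (V : \bar R) i : I i ->
  measurable_fun setT H -> (forall z, 0 <= H z) ->
  (forall o u u', (forall j, ~~ I j -> tnth u j = tnth u' j) -> H (u, o) = H (u', o)) ->
  (forall u, (\int[P]_w (H (u, U i w))%:E <= V)%E) ->
  (\int[P]_w (H ([tuple U j w | j < n], U i w))%:E <= V)%E.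
Proof.
move=> Ii mH H0 Hoff HV.
have mG : measurable_fun setT (fun z : O * n.-tuple O => (H (z.2, z.1))%:E).
  apply/measurable_EFinP; apply: (measurableT_comp mH).
  exact: measurable_swap.
rewrite (@decoupling_ge0 _ _ _ _ _ P n U mU iU i (fun z => (H (z.2, z.1))%:E))//.
- apply: (@le_trans _ _ (\int[P]_w V)%E); last first.
    have V0 : (0 <= V)%E.
      by apply: le_trans (HV (record point)); apply: integral_ge0 => w _; rewrite lee_fin.
    rewrite (integral_cst P measurableT V) -[leRHS]mule1 lee_wpmul2l//.
    exact: probability_le1.
  apply: ge0_le_integral => //.
  + by move=> w _; apply: integral_ge0 => w' _; rewrite lee_fin.
  + pose rX : {mfun T >-> n.-tuple O} := mfun_Sub (mem_set mrecord).
    pose rU : {mfun T >-> O} := mfun_Sub (mem_set (mU i)).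
    have mGG := @measurable_fun_fubini_tonelli_G _ _ _ (n.-tuple O) R
      (distribution P rU) _ mG (fun z => H0 _).
    have := measurableT_comp mGG mrecord.
    apply: eq_measurable_fun => w _ /=; rewrite /fubini_G.
    rewrite (@ge0_integral_distribution _ _ _ _ _ P rU)//.
      by apply: (measurableT_comp mG); exact: measurable_fun_pair.
    by move=> o; rewrite lee_fin.
  + by move=> ? _; exact: HV.
- by move=> z; rewrite lee_fin.
- move=> o v v' vv' /=; congr EFin; apply: Hoff => j Ij; apply: vv'.
  by apply: contraNneq Ij => ->.
Qed.

Lemma first_moment_le (H : n.-tuple O * O -> R) (V : R) :
  measurable_fun setT H -> (forall z, 0 <= H z) ->
  (forall o u u', (forall j, ~~ I j -> tnth u j = tnth u' j) -> H (u, o) = H (u', o)) ->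
  (forall i, I i -> forall u, (\int[P]_w (H (u, U i w))%:E <= V%:E)%E) ->
  (\int[P]_w (\sum_(i < n | I i) H ([tuple U j w | j < n], U i w))%:E
    <= (#|I|%:R * V)%:E)%E.
Proof.
move=> mH H0 Hoff HV.
under eq_integral do rewrite -sumEFin -big_filter.
have mHi i : measurable_fun setT (fun w => (H (record w, U i w))%:E).
  by apply/measurable_EFinP; exact: (measurableT_comp mH).
rewrite ge0_integral_sum => [|//|//|i w _]; last by rewrite lee_fin.
rewrite big_filter; apply: (@le_trans _ _ (\sum_(i < n | I i) V%:E)%E).
  by apply: lee_sum => i Ii; apply: first_moment_le1 => //; exact: HV.
by rewrite sumEFin sumr_const mulr_natl.
Qed.

(** Expanding the square, the diagonal terms are first moments. An off-diagonal term vanishes: with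
    all records but the i-th frozen, it is the inner product of a centred curve with a constant
    one. *)
Lemma variance_le (a b : R) (F : n.-tuple O * O -> L2 a b) (V : R) :
  mcurve F ->
  (forall o u u', (forall j, ~~ I j -> tnth u j = tnth u' j) -> F (u, o) = F (u', o)) ->
  (forall i, I i -> forall u, (\int[P]_w (hnorm (F (u, U i w)) ^+ 2)%:E <= V%:E)%E) ->
  (forall i, I i -> forall u g, (\int[P]_w (hinner (F (u, U i w)) g)%:E = 0)%E) ->
  (\int[P]_w (hnorm (\sum_(i < n | I i) F ([tuple U j w | j < n], U i w)) ^+ 2)%:E
    <= (#|I|%:R * V)%:E)%E.
Proof.
move=> mF Foff FV F0.
pose x i j w := hinner (F (record w, U i w)) (F (record w, U j w)).
have mFi i : mcurve (fun w => F (record w, U i w)) by exact: mcurve_comp.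
have mFu u i : mcurve (fun w => F (u, U i w)).
  by apply: mcurve_comp => //; exact: measurable_fun_pair.
have mn2 : measurable_fun setT (fun z => hnorm (F z) ^+ 2).
  by apply: measurable_funX; exact: mcurve_hnorm.
have FV1 i : I i -> (\int[P]_w (hnorm (F (record w, U i w)) ^+ 2)%:E <= V%:E)%E.
  move=> Ii; apply: (@first_moment_le1 (fun z => hnorm (F z) ^+ 2) V%:E i Ii) => //.
  - by move=> z; exact: sqr_ge0.
  - by move=> o u u' uu' /=; rewrite (Foff _ _ _ uu').
  - exact: FV.
have int2 (f : T -> L2 a b) : mcurve f ->
    (\int[P]_w (hnorm (f w) ^+ 2)%:E <= V%:E)%E ->
    P.-integrable setT (EFin \o (fun w => hnorm (f w) ^+ 2)).
  move=> mf fV; apply/integrableP; split.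
    by apply/measurable_EFinP/measurable_funX/mcurve_hnorm.
  by under eq_integral do rewrite /= ger0_norm ?sqr_ge0//; rewrite (le_lt_trans fV)// ltry.
have ix i j : I i -> I j -> P.-integrable setT (EFin \o x i j).
  move=> Ii Ij; have := integrableD measurableT (int2 _ (mFi i) (FV1 i Ii))
    (int2 _ (mFi j) (FV1 j Ij)).
  apply: le_integrable => //.
    by apply/measurable_EFinP; exact: mcurve_hinner.
  move=> w _ /=; rewrite lee_fin (le_trans (hinner_le _ _))//.
  rewrite ger0_norm ?addr_ge0 ?sqr_ge0//.
  have := sqr_ge0 (hnorm (F (record w, U i w)) - hnorm (F (record w, U j w))).
  have := sqr_ge0 (hnorm (F (record w, U i w)) + hnorm (F (record w, U j w))).
  rewrite sqrrB sqrrD; lra.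
have x0 i j : I i -> I j -> i != j -> (\int[P]_w (x i j w)%:E = 0)%E.
  move=> Ii Ij ij.
  (* The j-th record is read off the tuple itself, so freezing the tuple also freezes the second
     factor. *)
  pose G (z : O * n.-tuple O) := hinner (F (z.2, z.1)) (F (z.2, tnth z.2 j)).
  transitivity (\int[P]_w (G (U i w, record w))%:E)%E.
    by apply: eq_integral => w _; rewrite /G /= tnth_mktuple.
  apply: (@decoupling_eq0 _ _ _ _ _ P n U mU iU i G).
  - apply: mcurve_hinner; apply: mcurve_comp => //; first exact: measurable_swap.
    apply: measurable_fun_pair => //.
    apply: (measurableT_comp (f := fun v : n.-tuple O => tnth v j)).
      exact: measurable_tnth.
    exact: measurable_snd.
  - move=> o v v' vv'; have vI k : ~~ I k -> tnth v k = tnth v' k.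
      by move=> Ik; apply: vv'; apply: contraNneq Ik => ->.
    by rewrite /G /= vv' 1?eq_sym// !(Foff _ _ _ vI).
  - have := ix i j Ii Ij; apply: eq_integrable => // w _ /=.
    by rewrite /x /G /= tnth_mktuple.
  - move=> v; pose f w := hinner (F (v, U i w)) (F (v, tnth v j)).
    have fi : P.-integrable setT (EFin \o f).
      have ic : P.-integrable setT (EFin \o cst (hnorm (F (v, tnth v j)) ^+ 2)).
        exact: finite_measure_integrable_cst.
      have := integrableD measurableT (int2 _ (mFu v i) (FV i Ii v)) ic.
      apply: le_integrable => //.
        by apply/measurable_EFinP; apply: mcurve_hinner => //; exact: mcurve_cst.
      move=> w _ /=; rewrite lee_fin (le_trans (hinner_le _ _))//.
      rewrite ger0_norm ?addr_ge0 ?sqr_ge0//.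
      have := sqr_ge0 (hnorm (F (v, U i w)) - hnorm (F (v, tnth v j))).
      have := sqr_ge0 (hnorm (F (v, U i w)) + hnorm (F (v, tnth v j))).
      rewrite sqrrB sqrrD; lra.
    have := integral_funeposneg measurableT fi (F0 i Ii v _) => H.
    transitivity (\int[P]_w (EFin \o f)^\+ w)%E.
      by apply: eq_integral => w _; rewrite !funeposE.
    by rewrite H; apply: eq_integral => w _; rewrite !funenegE.
have -> : (\int[P]_w (hnorm (\sum_(i < n | I i) F (record w, U i w)) ^+ 2)%:E =
    \int[P]_w \sum_(i < n | I i) \sum_(j < n | I j) (x i j w)%:E)%E.
  apply: eq_integral => w _; rewrite hnorm_sqr_sum -sumEFin.
  by apply: eq_bigr => i _; rewrite sumEFin.
have ixs i : I i -> P.-integrable setT (fun w => \sum_(j < n | I j) (x i j w)%:E)%E.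
  move=> Ii; apply: (@integrable_sum _ _ _ P setT measurableT _ _ _ (fun j w => (x i j w)%:E)).
  by move=> j Ij; exact: ix.
rewrite integral_sum_cond//.
apply: (@le_trans _ _ (\sum_(i < n | I i) V%:E)%E).
  apply: lee_sum => i Ii; rewrite integral_sum_cond; last by move=> j Ij; exact: ix.
  rewrite (bigD1 i)//= big1 ?adde0.
    by rewrite (le_trans _ (FV1 i Ii))//; under eq_integral do rewrite /x -hnorm_sqr.
  by move=> j /andP[Ij ji]; apply: x0 => //; rewrite eq_sym.
by rewrite sumEFin sumr_const mulr_natl.
Qed.

End moments.

(** * Calculus of events of probability tending to one and of vanishing sequences *)

Section likely.
Context {R : realType} {d : measure_display} {T : measurableType d}
  (P : probability T R).
Implicit Types (G H : nat -> T -> Prop) (X Y : nat -> T -> R).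

(* Stated, like [vanishing], for the outer probability, so that no measurability
   is required. *)
Definition likely G := forall dl : R, 0 < dl -> \forall n \near \oo,
  exists A, [/\ measurable A, (P A <= dl%:E)%E & forall w, ~ A w -> G n w].

Definition vanishing X := forall e : R, 0 < e -> likely (fun n w => X n w <= e).

Lemma likelyT G : (\forall n \near \oo, forall w, G n w) -> likely G.
Proof.
move=> hG dl dl0; apply: filterS hG => n hG; exists set0.
by split => //; rewrite measure0 lee_fin ltW.
Qed.

Lemma likelyI G H : likely G -> likely H -> likely (fun n w => G n w /\ H n w).
Proof.
move=> lG lH dl dl0; have dl20 : 0 < dl / 2 by rewrite divr_gt0.
apply: filterS2 (lG _ dl20) (lH _ dl20) => n [A [mA PA GA]] [B [mB PB HB]].
exists (A `|` B); split; first exact: measurableU.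
  rewrite (le_trans (measureU2 _ mA mB))// (le_trans (leeD PA PB))//.
  by rewrite -EFinD -splitr.
by move=> w /not_orP[nA nB]; split; [exact: GA|exact: HB].
Qed.

Lemma likelyS G H : (\forall n \near \oo, forall w, G n w -> H n w) ->
  likely G -> likely H.
Proof.
move=> GH lG dl dl0; apply: filterS2 GH (lG _ dl0) => n GH [A [mA PA GA]].
by exists A; split => // w /GA/GH.
Qed.

Lemma likely_cvg1 (E : nat -> set T) : (forall n, measurable (E n)) ->
  P (E n) @[n --> \oo] --> 1%E -> likely (fun n w => E n w).
Proof.
move=> mE PE dl dl0; have PE' := PE _ (@open_ereal_gt' R 1%E (1 - dl)%:E _).
have {PE'} : \forall n \near \oo, ((1 - dl)%:E < P (E n))%E.
  by apply: PE'; rewrite lte_fin; lra.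
apply: filterS => n hn; exists (~` E n); split; first exact: measurableC.
  rewrite probability_setC//.
  have fin : P (E n) \is a fin_num by rewrite fin_num_measure.
  by move: hn; rewrite -(fineK fin) -EFinB lee_fin lte_fin; lra.
by move=> w /contrapT.
Qed.

Lemma likely_negligible (N : nat -> set T) : (forall n, P.-negligible (N n)) ->
  likely (fun n w => ~ N n w).
Proof.
move=> N0 dl dl0; apply: nearW => n; have [A [mA A0 NA]] := N0 n.
exists A; split => //; first by rewrite [leLHS]A0 lee_fin ltW.
by move=> w nA /NA.
Qed.

Lemma little_op_likely (U : nat -> T -> \bar R) (r : nat -> R) :
  (forall n, measurable_fun setT (U n)) -> little_op P U r ->
  forall e : R, 0 < e -> likely (fun n w => (`|U n w| <= (e * r n)%:E)%E).
Proof.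
move=> mU oU e e0 dl dl0.
have /cvge0_ltP H := oU e e0; apply: filterS (H _ _ dl0) => [n hn|n]; last first.
  exact: measure_ge0.
exists [set w | ((e * r n)%:E < `|U n w|)%E]; split; last 2 first.
- exact: ltW.
- by move=> w /negP; rewrite -leNgt.
rewrite -[X in measurable X]setTI; apply: emeasurable_fun_o_infty => //.
exact: measurableT_comp.
Qed.

Lemma vanishing_little_op X : (forall n, measurable_fun setT (X n)) ->
  (forall n w, 0 <= X n w) -> vanishing X ->
  little_op P (fun n w => (X n w)%:E) (fun=> 1).
Proof.
move=> mX X0 vX e e0; apply/cvge0_ltP => [n|dl dl0]; first exact: measure_ge0.
have dl20 : 0 < dl / 2 by rewrite divr_gt0.
apply: filterS (vX e e0 _ dl20) => n [A [mA PA XA]].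
apply: le_lt_trans (_ : (P A < _)%E); last first.
  by rewrite (le_lt_trans PA)// lte_fin ltr_pdivrMr// ltr_pMr// ltr1n.
apply: le_measure; rewrite ?inE//.
  rewrite -[X in measurable X]setTI; apply: emeasurable_fun_o_infty => //.
  by do 2 apply: measurableT_comp => //.
move=> w /=; rewrite mulr1 ger0_norm// lte_fin => h; apply: contrapT => /XA.
by rewrite leNgt h.
Qed.

Lemma vanishing_le X Y : likely (fun n w => X n w <= Y n w) ->
  vanishing Y -> vanishing X.
Proof.
move=> XY vY e e0; apply: likelyS (likelyI XY (vY e e0)).
by apply: nearW => n w [/le_trans]; exact.
Qed.

Lemma vanishingD X Y : vanishing X -> vanishing Y ->
  vanishing (fun n w => X n w + Y n w).
Proof.
move=> vX vY e e0; have e20 : 0 < e / 2 by rewrite divr_gt0.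
apply: likelyS (likelyI (vX _ e20) (vY _ e20)); apply: nearW => n w [h1 h2].
by rewrite [leRHS]splitr lerD.
Qed.

Lemma vanishing0 : vanishing (fun _ _ => 0).
Proof. by move=> e e0; apply: likelyT; apply: nearW => n w; exact: ltW. Qed.

Lemma vanishing_sum (J : finType) (X : J -> nat -> T -> R) :
  (forall j, vanishing (X j)) -> vanishing (fun n w => \sum_j X j n w).
Proof.
move=> vX; elim: (index_enum J) => [|j s IH].
  apply: vanishing_le vanishing0; apply: likelyT; apply: nearW => n w.
  by rewrite big_nil.
apply: vanishing_le (vanishingD (vX j) IH); apply: likelyT; apply: nearW => n w.
by rewrite big_cons.
Qed.

Lemma vanishingZ (c : R) X : 0 < c -> vanishing X ->
  vanishing (fun n w => c * X n w).
Proof.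
move=> c0 vX e e0; have ec0 : 0 < e / c by rewrite divr_gt0.
apply: likelyS (vX _ ec0); apply: nearW => n w.
by rewrite ler_pdivlMr// mulrC.
Qed.

Lemma vanishing_sqr X : (forall n w, 0 <= X n w) ->
  vanishing (fun n w => X n w ^+ 2) -> vanishing X.
Proof.
move=> X0 vX e e0; have e20 : 0 < e ^+ 2 by rewrite exprn_gt0.
apply: likelyS (vX _ e20); apply: nearW => n w.
by rewrite ler_pXn2r ?nnegrE// ltW.
Qed.

(** Markov's inequality for a measurable majorant that need only dominate on a likely event. The
    majorant may depend on [eta], which leaves room for a truncation level chosen after [eta]. *)
Lemma vanishing_markov X :
  (forall eta : R, 0 < eta -> exists H : nat -> T -> R,
    [/\ forall n, measurable_fun setT (H n), forall n w, 0 <= H n w,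
        \forall n \near \oo, (\int[P]_w (H n w)%:E <= eta%:E)%E
      & likely (fun n w => X n w <= H n w)]) -> vanishing X.
Proof.
move=> HX e e0 dl dl0.
have dl20 : 0 < dl / 2 by rewrite divr_gt0.
have [|H [mH H0 HE HXl]] := HX (e * (dl / 2)); first by rewrite mulr_gt0.
apply: filterS2 HE (HXl _ dl20) => n HE [A [mA PA XA]].
pose B := [set w | e <= H n w].
have mB : measurable B.
  rewrite -[B]setTI.
  have := mH n measurableT `[e, +oo[%classic (measurable_itv _).
  rewrite (_ : _ @^-1` _ = B)//; apply/seteqP; split=> w /=;
    by rewrite in_itv/= andbT.
exists (A `|` B); split; first exact: measurableU.
  rewrite (le_trans (measureU2 _ mA mB))// [in leRHS](splitr dl) EFinD leeD//.
  rewrite -(@lee_pmul2l _ e%:E) ?lte_fin//.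
  rewrite -EFinM (le_trans _ HE)//.
  have -> : (e%:E * P B = \int[P]_w (e%:E * (\1_B w)%:E))%E.
    rewrite ge0_integralZl//; last by rewrite lee_fin ltW.
      by rewrite integral_indic// setIT.
    by apply/measurable_EFinP; exact: measurable_indic.
  apply: ge0_le_integral => //.
  - by move=> w _; rewrite mule_ge0 ?lee_fin// ltW.
  - apply: emeasurable_funM => //; apply/measurable_EFinP.
    exact: measurable_indic.
  - exact/measurable_EFinP.
  - move=> w _; rewrite -EFinM lee_fin indicE.
    by have [|] := boolP (w \in B); rewrite ?inE ?mulr1 ?mulr0.
move=> w /not_orP[nA nB]; rewrite (le_trans (XA w nA))// leNgt.
by apply/negP => h; apply: nB; exact: ltW.
Qed.

End likely.

(** * Truncation at small training error, and the resulting limits over one fold *)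

Section cross_terms.
Context {R : realType} {d dO : measure_display}
  {T : measurableType d} {O : measurableType dO} (P : probability T R).
Variables (U : forall n, 'I_n -> T -> O) (K : nat)
  (fold : forall n, T -> {ffun 'I_n -> 'I_K}) (k : 'I_K).
Hypothesis mU : forall n i, measurable_fun setT (@U n i).
Hypothesis iU : forall n, mutually_independent P (@U n).
Hypothesis mfold : forall n (c : {ffun 'I_n -> 'I_K}), measurable (fold n @^-1` [set c]).
Hypothesis ifold : forall n,
  independent_of P (@fold n) (fun w => [tuple U i w | i < n]).

Let record n w := [tuple @U n i w | i < n].

Let mrecord n : measurable_fun setT (@record n).
Proof. exact: measurable_record. Qed.

Let mpair n i : measurable_fun setT (fun w => (@record n w, @U n i w)).
Proof. by apply: measurable_fun_pair; [exact: mrecord|exact: mU]. Qed.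

Let card_fold n (c : {ffun 'I_n -> 'I_K}) :
  n%:R^-1 * #|[pred i | c i == k]|%:R <= 1 :> R.
Proof.
case: n c => [|n] c; first by rewrite invr0 mul0r.
rewrite mulrC ler_pdivrMr ?ltr0n// mul1r ler_nat.
by rewrite (leq_trans (max_card _))// card_ord.
Qed.

(** The error of the fit for fold [k], later an L^2 norm or a product of two, seen as a function of
    the fold assignment and of the records outside the fold. *)
Variable N : forall n, {ffun 'I_n -> 'I_K} -> n.-tuple O -> \bar R.
Hypothesis mN : forall n (c : {ffun 'I_n -> 'I_K}), measurable_fun setT (@N n c).
Hypothesis Noff : forall n (c : {ffun 'I_n -> 'I_K}) (u u' : n.-tuple O),
  (forall j, c j != k -> tnth u j = tnth u' j) -> N c u = N c u'.

(** The good training data. Multiplying by this indicator preserves both centring and the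
    independence from the records of fold [k]. *)
Let A n c (e : R) : set (n.-tuple O) := [set u | (@N n c u <= e%:E)%E].

Let mA n c e : measurable (@A n c e).
Proof.
by rewrite -[X in measurable X]setTI; apply: emeasurable_fun_infty_c.
Qed.

Let mIA n c e : measurable_fun setT (\1_(@A n c e) : n.-tuple O -> R).
Proof. by apply: measurable_indic; exact: mA. Qed.

Let Aoff n (c : {ffun 'I_n -> 'I_K}) e (u u' : n.-tuple O) :
  (forall j, c j != k -> tnth u j = tnth u' j) -> \1_(@A n c e) u = \1_(@A n c e) u' :> R.
Proof.
move=> uu'; rewrite !indicE; suff -> : (u \in A c e) = (u' \in A c e) by [].
by apply/idP/idP; rewrite !inE /A /= (Noff uu').
Qed.

(** After truncation the summands have second moment at most [C * e ^+ 2] for every training data,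
    and a fold has at most [n] units; so the squared normalized sum has mean at most [C * e ^+ 2],
    uniformly in [n], with [e] arbitrary. *)
Lemma cross_variance_vanishing (a b C : R)
    (F : forall n, {ffun 'I_n -> 'I_K} -> n.-tuple O * O -> L2 a b) :
  0 < C -> (forall n (c : {ffun 'I_n -> 'I_K}), mcurve (@F n c)) ->
  (forall n (c : {ffun 'I_n -> 'I_K}) o (u u' : n.-tuple O), (forall j, c j != k -> tnth u j = tnth u' j) ->
    F n c (u, o) = F n c (u', o)) ->
  (forall n (c : {ffun 'I_n -> 'I_K}) u (i : 'I_n) (e : R), 0 < e -> (@N n c u <= e%:E)%E ->
    (\int[P]_w (hnorm (F n c (u, U i w)) ^+ 2)%:E <= (C * e ^+ 2)%:E)%E /\
    forall g, (\int[P]_w (hinner (F n c (u, U i w)) g)%:E = 0)%E) ->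
  (forall e : R, 0 < e -> likely P (fun n w =>
    (@N n (fold n w) [tuple U i w | i < n] <= e%:E)%E)) ->
  vanishing P (fun n w => (Num.sqrt n%:R)^-1 *
    hnorm (\sum_(i < n | fold n w i == k)
      F n (fold n w) ([tuple U j w | j < n], U i w))).
Proof.
move=> C0 mF Foff FN Nlikely.
apply: vanishing_sqr; first by move=> n w; rewrite mulr_ge0 ?invr_ge0 ?sqrtr_ge0 ?hnorm_ge0.
apply: vanishing_markov => eta eta0.
(* The threshold for which [C * e ^+ 2 = eta]. *)
pose e := Num.sqrt (eta / C).
have e0 : 0 < e by rewrite sqrtr_gt0 divr_gt0.
have eE : C * e ^+ 2 = eta by rewrite sqr_sqrtr ?divr_ge0 ?ltW// mulrCA divff ?mulr1// gt_eqF.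
pose F' n (c : {ffun 'I_n -> 'I_K}) (z : n.-tuple O * O) := \1_(A c e) z.1 *: F n c z.
have mF' n c : mcurve (F' n c).
  apply: mcurveZ => //; exact: (measurableT_comp (mIA c e) measurable_fst).
pose H n (c : {ffun 'I_n -> 'I_K}) (u : n.-tuple O) := n%:R^-1 *
  hnorm (\sum_(i < n | c i == k) F' n c (u, tnth u i)) ^+ 2.
have mtn n (i : 'I_n) : measurable_fun setT (fun u : n.-tuple O => (u, tnth u i)).
  by apply: measurable_fun_pair => //; exact: measurable_tnth.
have mH n c : measurable_fun setT (H n c).
  apply: measurable_funM => //; apply: measurable_funX; apply: mcurve_hnorm.
  by apply: mcurve_sum => i _; exact: (mcurve_comp (mtn n i) (mF' n c)).
have H0 n c u : 0 <= H n c u by rewrite mulr_ge0 ?invr_ge0 ?sqr_ge0.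
exists (fun n w => H n (fold n w) (record n w)); split => //.
- move=> n; apply: (measurable_fun_case (@mfold n) (H := fun c w => H n c (record n w))) => c.
  exact: (measurableT_comp (mH n c) (@mrecord n)).
- apply: nearW => n; apply: (mixing_le (@mfold n) (@mrecord n) (@ifold n) (mH n) (H0 n)) => c.
  have -> : (\int[P]_w (H n c (record n w))%:E = (n%:R^-1)%:E * \int[P]_w
      (hnorm (\sum_(i < n | c i == k) F' n c (record n w, U i w)) ^+ 2)%:E)%E.
    rewrite -ge0_integralZl//; last 2 first.
    - apply/measurable_EFinP; apply: measurable_funX; apply: mcurve_hnorm.
      by apply: mcurve_sum => i _; exact: (mcurve_comp (@mpair n i) (mF' n c)).
    - by move=> w _; rewrite lee_fin sqr_ge0.
    apply: eq_integral => w _; rewrite /H -EFinM; congr (_ * hnorm _ ^+ 2)%:E.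
    by apply: eq_bigr => i _; rewrite tnth_mktuple.
  apply: (@le_trans _ _ ((n%:R^-1)%:E * (#|[pred i | c i == k]|%:R * eta)%:E)%E).
    rewrite lee_wpmul2l// ?lee_fin//.
    apply: (variance_le (@mU n) (@iU n) (I := fun i => c i == k)) => //.
    + move=> o u u' uu'; rewrite /F' /= (Aoff e uu'); congr (_ *: _).
      exact: Foff.
    + move=> i _ u; rewrite /F' /= indicE.
      have [uA|uA] := boolP (u \in A c e).
        rewrite (_ : (fun _ => _) = (fun w => (hnorm (F n c (u, U i w)) ^+ 2)%:E)).
          by move: uA; rewrite inE => /(FN n c u i e e0)[]; rewrite eE.
        by apply/funext => w; rewrite scale1r.
      under eq_integral do rewrite scale0r hnorm0 expr0n/=.
      by rewrite integral0 lee_fin ltW.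
    + move=> i _ u g; rewrite /F' /= indicE.
      have [uA|uA] := boolP (u \in A c e).
        under eq_integral do rewrite scale1r.
        by move: uA; rewrite inE => /(FN n c u i e e0)[_]; exact.
      under eq_integral do rewrite scale0r hinner0l.
      by rewrite integral0.
  by rewrite -EFinM lee_fin mulrA ger_pMl.
- apply: likelyS (Nlikely _ e0); apply: nearW => n w Ne.
  rewrite /H exprMn exprVn sqr_sqrtr// le_eqVlt; apply/orP; left; apply/eqP.
  congr (_ * hnorm _ ^+ 2); apply: eq_bigr => i _.
  by rewrite /F' /= tnth_mktuple indicE mem_set ?scale1r.
Qed.

(** There is no cancellation between these nonnegative summands: up to [n] of them are divided only
    by [sqrt n], so the error must be small at the scale [n^(-1/2)]. *)
Lemma cross_mean_vanishing (C : R)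
    (G : forall n, {ffun 'I_n -> 'I_K} -> n.-tuple O * O -> R) :
  0 < C -> (forall n (c : {ffun 'I_n -> 'I_K}), measurable_fun setT (@G n c)) ->
  (forall n (c : {ffun 'I_n -> 'I_K}) z, 0 <= @G n c z) ->
  (forall n (c : {ffun 'I_n -> 'I_K}) o (u u' : n.-tuple O), (forall j, c j != k -> tnth u j = tnth u' j) ->
    G n c (u, o) = G n c (u', o)) ->
  (forall n (c : {ffun 'I_n -> 'I_K}) u (i : 'I_n) (e : R), 0 < e -> (@N n c u <= e%:E)%E ->
    (\int[P]_w (G n c (u, U i w))%:E <= (C * e)%:E)%E) ->
  (forall e : R, 0 < e -> likely P (fun n w =>
    (@N n (fold n w) [tuple U i w | i < n] <= (e * (Num.sqrt n%:R)^-1)%:E)%E)) ->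
  vanishing P (fun n w => (Num.sqrt n%:R)^-1 *
    \sum_(i < n | fold n w i == k) G n (fold n w) ([tuple U j w | j < n], U i w)).
Proof.
move=> C0 mG G0 Goff GN Nlikely; apply: vanishing_markov => eta eta0.
(* With this threshold each mean is at most [eta / sqrt n], and the normalized sum of at most [n] of
   them at most [eta]. *)
pose e n : R := (eta / C) * (Num.sqrt n%:R)^-1.
pose G' n (c : {ffun 'I_n -> 'I_K}) (z : n.-tuple O * O) := \1_(A c (e n)) z.1 * G n c z.
have mG' n c : measurable_fun setT (G' n c).
  have mI : measurable_fun setT (fun z : n.-tuple O * O => \1_(A c (e n)) z.1 : R).
    exact: (measurableT_comp (mIA c (e n)) measurable_fst).
  exact: (measurable_funM mI (mG n c)).
have G'0 n c z : 0 <= G' n c z by rewrite mulr_ge0// indicE.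
pose H n (c : {ffun 'I_n -> 'I_K}) (u : n.-tuple O) := (Num.sqrt n%:R)^-1 *
  \sum_(i < n | c i == k) G' n c (u, tnth u i).
have mtn n (i : 'I_n) : measurable_fun setT (fun u : n.-tuple O => (u, tnth u i)).
  by apply: measurable_fun_pair => //; exact: measurable_tnth.
have mH n c : measurable_fun setT (H n c).
  apply: measurable_funM => //.
  have mS i : measurable_fun setT (fun u : n.-tuple O => G' n c (u, tnth u i)).
    exact: (measurableT_comp (mG' n c) (mtn n i)).
  rewrite (_ : (fun _ => _) = (fun u : n.-tuple O =>
      \sum_(i <- [seq i <- index_enum 'I_n | c i == k]) G' n c (u, tnth u i))).
    exact: measurable_sum.
  by apply/funext => u; rewrite big_filter.
have H0 n c u : 0 <= H n c u by rewrite mulr_ge0 ?invr_ge0 ?sqrtr_ge0// sumr_ge0.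
exists (fun n w => H n (fold n w) (record n w)); split => //.
- move=> n; apply: (measurable_fun_case (@mfold n) (H := fun c w => H n c (record n w))) => c.
  exact: (measurableT_comp (mH n c) (@mrecord n)).
(* At [n = 0] the inverse square root is 0 and the threshold would not be positive. *)
- exists 1%N => // n /= n0; have sn0 : 0 < Num.sqrt n%:R :> R by rewrite sqrtr_gt0 ltr0n.
  have en0 : 0 < e n by rewrite /e !mulr_gt0// invr_gt0.
  have enE : C * e n = eta * (Num.sqrt n%:R)^-1.
    by rewrite /e mulrA mulrCA divff ?mulr1// gt_eqF.
  apply: (mixing_le (@mfold n) (@mrecord n) (@ifold n) (mH n) (H0 n)) => c.
  have -> : (\int[P]_w (H n c (record n w))%:E = ((Num.sqrt n%:R)^-1)%:E * \int[P]_w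
      (\sum_(i < n | c i == k) G' n c (record n w, U i w))%:E)%E.
    have mS (i : 'I_n) : measurable_fun setT (fun w : T => G' n c (record n w, U i w)).
      exact: (measurableT_comp (mG' n c) (@mpair n i)).
    have mSum : measurable_fun setT (fun w : T =>
        (\sum_(i < n | c i == k) G' n c (record n w, U i w))%:E).
      apply/measurable_EFinP; rewrite (_ : (fun _ => _) = (fun w : T =>
        \sum_(i <- [seq i <- index_enum 'I_n | c i == k]) G' n c (record n w, U i w))).
        exact: measurable_sum.
      by apply/funext => w; rewrite big_filter.
    have S0 (w : T) : setT w ->
        (0 <= (\sum_(i < n | c i == k) G' n c (record n w, U i w))%:E)%E.
      by move=> _; rewrite lee_fin sumr_ge0.
    have s0 : (0 <= ((Num.sqrt n%:R)^-1)%:E :> \bar R)%E by rewrite lee_fin invr_ge0 sqrtr_ge0.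
    rewrite -(ge0_integralZl P measurableT mSum S0 s0).
    apply: eq_integral => w _; rewrite /H -EFinM; congr (_ * _)%:E.
    by apply: eq_bigr => i _; rewrite tnth_mktuple.
  apply: (@le_trans _ _ (((Num.sqrt n%:R)^-1)%:E *
      (#|[pred i | c i == k]|%:R * (C * e n))%:E)%E).
    rewrite lee_wpmul2l ?lee_fin ?invr_ge0 ?sqrtr_ge0//.
    apply: (first_moment_le (@mU n) (@iU n) (I := fun i => c i == k)) => //.
    + move=> o u u' uu'; rewrite /G' /= (Aoff (e n) uu'); congr (_ * _).
      exact: Goff.
    + move=> i _ u; rewrite /G' /= indicE.
      have [uA|uA] := boolP (u \in A c (e n)).
        under eq_integral do rewrite mul1r.
        by move: uA; rewrite inE => /(GN n c u i _ en0).
      under eq_integral do rewrite mul0r.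
      by rewrite integral0 lee_fin mulr_ge0// ltW.
  rewrite -EFinM lee_fin enE.
  have -> : (Num.sqrt n%:R)^-1 * (#|[pred i | c i == k]|%:R *
      (eta * (Num.sqrt n%:R)^-1)) = n%:R^-1 * #|[pred i | c i == k]|%:R * eta :> R.
    rewrite -[in RHS](@sqr_sqrtr _ n%:R)// expr2 invfM; ring.
  by rewrite ger_pMl.
- have eC0 : 0 < eta / C by rewrite divr_gt0.
  apply: likelyS (Nlikely _ eC0); apply: nearW => n w Ne.
  rewrite /H le_eqVlt; apply/orP; left; apply/eqP.
  congr (_ * _); apply: eq_bigr => i _.
  by rewrite /G' /= tnth_mktuple indicE mem_set ?mul1r.
Qed.

End cross_terms.

(** * Clipping of propensities *)

Section clip.
Context {R : realType}.
Implicit Types (c x y : R).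

Definition clip c x : R := Num.min (1 - c) (Num.max c x).

Lemma clip_itv c x : 0 < c < 2^-1 -> c <= clip c x <= 1 - c.
Proof.
move=> /andP[c0 c2]; rewrite /clip ge_min lexx/= andbT le_min le_max lexx/= andbT.
lra.
Qed.

Lemma clip_id c x : c <= x <= 1 - c -> clip c x = x.
Proof. by move=> /andP[cx xc]; rewrite /clip max_r// min_r. Qed.

(** Clipping projects onto an interval that contains [y]. Hence it does not increase the L^2 error
    of a propensity fit. *)
Lemma clip_dist c x y : c <= y <= 1 - c -> `|clip c x - y| <= `|x - y|.
Proof.
move=> /andP[cy yc]; rewrite ler_norml.
have h1 := ler_norm (x - y); have h2 := ler_norm (y - x).
rewrite distrC in h2; rewrite /clip /Order.min /Order.max.
by case: (ltP c x) => h3; case: (ltP (1 - c)) => h4; apply/andP; split; lra.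
Qed.

Lemma measurable_clip c d (T : measurableType d) (f : T -> R) :
  measurable_fun setT f -> measurable_fun setT (fun t => clip c (f t)).
Proof. by move=> mf; apply: measurable_minr => //; apply: measurable_maxr. Qed.

End clip.

(** * Weights in [X] against variables centred given [X] *)

Section orthogonality.
Local Open Scope ereal_scope.
Context d d' (T : measurableType d) (T' : measurableType d') (R : realType).
Variables (P : {measure set T -> \bar R}) (X : T -> T').
Hypothesis mX : measurable_fun setT X.

(** Over each event of [X] the parts of [Z] have equal integrals, hence also against both parts of
    [h]. Recombining shows that the two parts of the product have equal integrals, and integrability
    of the product alone permits the subtraction. *)
Lemma integral_comp_eq0 (Z : T -> R) (h : T' -> R) :
  P.-integrable setT (EFin \o Z) ->
  (forall B, measurable B -> \int[P]_(w in X @^-1` B) (Z w)%:E = 0) ->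
  measurable_fun setT h ->
  P.-integrable setT (EFin \o (fun w => h (X w) * Z w)%R) ->
  \int[P]_w (h (X w) * Z w)%:E = 0.
Proof.
move=> iZ Z0 mh ihZ.
have mZ : measurable_fun setT Z by apply/measurable_EFinP; case/integrableP: iZ.
pose Zp w := Num.max (Z w) 0%R; pose Zn w := Num.max (- Z w)%R 0%R.
pose hp x := Num.max (h x) 0%R; pose hn x := Num.max (- h x)%R 0%R.
have mZp : measurable_fun setT Zp by exact: measurable_maxr.
have mZn : measurable_fun setT Zn by apply: measurable_maxr => //; exact: measurable_funN.
have mhp : measurable_fun setT hp by exact: measurable_maxr.
have mhn : measurable_fun setT hn by apply: measurable_maxr => //; exact: measurable_funN.
have max0 (x : R) : (0 <= Num.max x 0)%R by rewrite le_max lexx orbT.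
have ZB B : measurable B ->
    \int[P]_(w in X @^-1` B) (Zp w)%:E = \int[P]_(w in X @^-1` B) (Zn w)%:E.
  move=> mB; have mXB : measurable (X @^-1` B).
    by rewrite -[_ @^-1` _]setTI; exact: mX.
  have := integral_funeposneg mXB (integrableS measurableT mXB (@subsetT _ _) iZ) (Z0 B mB).
  under eq_integral do rewrite funeposE /= -[0%E]/(0%R%:E) -EFin_max.
  by under [RHS]eq_integral do rewrite funenegE /= ?EFinN -[0%E]/(0%R%:E) -EFin_max.
have Ep := ge0_integral_comp_eq mX mZp (fun w => max0 _) mZn (fun w => max0 _) ZB mhp (fun w => max0 _).
have En := ge0_integral_comp_eq mX mZp (fun w => max0 _) mZn (fun w => max0 _) ZB mhn (fun w => max0 _).
have mM (k : T' -> R) (z : T -> R) : measurable_fun setT k -> measurable_fun setT z ->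
    measurable_fun setT (fun w => (k (X w))%:E * (z w)%:E).
  move=> mk mz; apply: emeasurable_funM; apply/measurable_EFinP => //.
  exact: (measurableT_comp mk mX).
have M0 (k z : R) : (0 <= (Num.max k 0)%:E * (Num.max z 0)%:E).
  by rewrite mule_ge0 ?lee_fin.
(* The positive part of a product collects the two combinations of equal signs; applied to [- y] it
   gives the negative part. *)
have maxM (x y : R) : (Num.max (x * y) 0 =
    Num.max x 0 * Num.max y 0 + Num.max (- x) 0 * Num.max (- y) 0)%R.
  rewrite /Order.max !oppr_lt0.
  have [x0|x0|->] := ltgtP x 0%R; have [y0|y0|->] := ltgtP y 0%R;
    rewrite ?(mulr0,mul0r,addr0,add0r,ltxx,mulrNN,oppr0)//.
  - by rewrite ltNge (mulr_le0 (ltW x0) (ltW y0)).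
  - by rewrite (nmulr_rlt0 _ x0) y0.
  - by rewrite (pmulr_rlt0 _ x0) y0.
  - by rewrite ltNge (mulr_ge0 (ltW x0) (ltW y0)).
have Epos : \int[P]_w (EFin \o (fun w => h (X w) * Z w)%R)^\+ w =
    \int[P]_w ((hp (X w))%:E * (Zp w)%:E) + \int[P]_w ((hn (X w))%:E * (Zn w)%:E).
  rewrite -(ge0_integralD P measurableT (fun w _ => M0 _ _) (mM _ _ mhp mZp)
    (fun w _ => M0 _ _) (mM _ _ mhn mZn)).
  apply: eq_integral => w _; rewrite funeposE /= -[0%E]/(0%R%:E) -EFin_max maxM.
  by rewrite EFinD !EFinM.
have Eneg : \int[P]_w (EFin \o (fun w => h (X w) * Z w)%R)^\- w =
    \int[P]_w ((hp (X w))%:E * (Zn w)%:E) + \int[P]_w ((hn (X w))%:E * (Zp w)%:E).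
  rewrite -(ge0_integralD P measurableT (fun w _ => M0 _ _) (mM _ _ mhp mZn)
    (fun w _ => M0 _ _) (mM _ _ mhn mZp)).
  apply: eq_integral => w _; rewrite funenegE /= ?EFinN -[0%E]/(0%R%:E) -EFin_max.
  by rewrite -mulrN maxM opprK EFinD !EFinM.
rewrite integralE [X in _ - X]Eneg -Ep En -Epos subee//.
exact: integrable_pos_fin_num ihZ.
Qed.

End orthogonality.

Lemma measurable_funV d (T : measurableType d) (R : realType) (f : T -> R) :
  measurable_fun setT f -> measurable_fun setT (fun t => (f t)^-1).
Proof.
(* Squaring gives the real power a nonnegative base; the outer factor makes both sides 0 where
   [f t = 0]. *)
move=> mf; have -> : (fun t => (f t)^-1) = (fun t => f t * (f t ^+ 2) `^ (-1)).
  apply/funext => t; rewrite powRN powRr1 ?sqr_ge0//.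
  have [->|ft0] := eqVneq (f t) 0; first by rewrite invr0 mul0r.
  by field.
apply: measurable_funM => //.
apply: (measurableT_comp (f := fun x : R => x `^ (-1))); first exact: measurable_powR.
exact: measurable_funX.
Qed.

(** * Identities and bounds under the law of [W] *)

Section population.
Context {R : realType} (a b : R) (p : nat) d (Omega : measurableType d)
  (P : probability Omega R).
Variables (Y : Omega -> L2 a b) (D : {RV P >-> bool}) (X : {RV P >-> p.-tuple R})
  (pi0 : p.-tuple R -> R) (mu0 : p.-tuple R -> L2 a b) (c : R).
Hypothesis hY : random_curve Y.
Hypothesis hpi0 : is_cond_mean X setT (fun w => (D w)%:R) pi0.
Hypothesis hmu0 : is_cond_mean_curve X [set w | D w = false] Y mu0.
Hypothesis hc : 0 < c < 2^-1.
Hypothesis overlap : {ae P, forall w, c <= pi0 (X w) <= 1 - c}.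

Definition propensity x := clip c (pi0 x).

(** The difference of odds [e / (1 - e) - pi / (1 - pi)] over a common denominator, which displays
    the factor [e - pi]. *)
Definition odds_gap e x := (e - propensity x) / ((1 - e) * (1 - propensity x)).

(* D - (1 - D) pi / (1 - pi), simplified *)
Definition weight (D : bool) x := (D%:R - propensity x) / (1 - propensity x).

Let c0 : 0 < c. Proof. by case/andP: hc. Qed.

Let mX : measurable_fun setT X. Proof. exact: measurable_funPT. Qed.

Let mpi0 : measurable_fun setT pi0. Proof. by case: hpi0. Qed.

Lemma measurable_propensity : measurable_fun setT propensity.
Proof. exact: measurable_clip. Qed.

Lemma propensity_itv x : c <= propensity x <= 1 - c.
Proof. exact: clip_itv. Qed.

Let prop1 x : 0 < 1 - propensity x.
Proof. by have /andP[_] := propensity_itv x; have := c0; lra. Qed.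

Lemma pi0_propensity : {ae P, forall w, pi0 (X w) = propensity (X w)}.
Proof. by apply: filterS overlap => w h; rewrite /propensity clip_id. Qed.
Lemma measurable_odds_gap d' (T : measurableType d') (e : T -> R) (x : T -> p.-tuple R) :
  measurable_fun setT e -> measurable_fun setT x ->
  measurable_fun setT (fun t => odds_gap (e t) (x t)).
Proof.
move=> me mx; have mp := measurableT_comp measurable_propensity mx.
apply: measurable_funM; first exact: measurable_funB.
apply: measurable_funV.
by apply: measurable_funM; apply: measurable_funB.
Qed.

Lemma measurable_weight d' (T : measurableType d') (D' : T -> bool) (x : T -> p.-tuple R) :
  measurable_fun setT D' -> measurable_fun setT x ->
  measurable_fun setT (fun t => weight (D' t) (x t)).
Proof.
move=> mD mx; have mp := measurableT_comp measurable_propensity mx.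
apply: measurable_funM; last by apply: measurable_funV; exact: measurable_funB.
apply: measurable_funB => //.
rewrite (_ : (fun _ => _) = (fun t => if D' t then 1 else 0)).
  exact: measurable_fun_ifT.
by apply/funext => t; case: (D' t).
Qed.

Lemma odds_gap_le e x : c <= e <= 1 - c -> `|odds_gap e x| <= `|e - propensity x| / c ^+ 2.
Proof.
move=> /andP[_ ec]; have /andP[_ pc] := propensity_itv x.
have c_ := c0; have e1 : c <= 1 - e by lra.
have p1 : c <= 1 - propensity x by lra.
have m0 : 0 < (1 - e) * (1 - propensity x) by rewrite mulr_gt0 ?(lt_le_trans c_).
rewrite /odds_gap normrM ler_wpM2l// normfV (gtr0_norm m0).
by rewrite lef_pV2 ?posrE ?exprn_gt0// expr2 ler_pM// ltW.
Qed.

Lemma weight_le (D' : bool) x : `|weight D' x| <= c^-1.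
Proof.
have /andP[pc1 pc2] := propensity_itv x; have c_ := c0.
rewrite /weight normrM normfV (gtr0_norm (prop1 x)) -[leRHS]mul1r.
rewrite ler_pM ?invr_ge0 ?normr_ge0 ?(ltW (prop1 x))//.
  by rewrite ler_norml; case: D'; apply/andP; split => /=; lra.
by rewrite lef_pV2 ?posrE//; lra.
Qed.

Let mD : measurable_fun setT (fun w => (D w)%:R : R).
Proof. by case: hpi0 => _ /integrableP[/measurable_EFinP]. Qed.

Let m1D : measurable_fun setT (fun w => 1 - (D w)%:R : R).
Proof. exact: measurable_funB. Qed.

Let mXB B : measurable B -> measurable (X @^-1` B).
Proof. by move=> mB; rewrite -[_ @^-1` _]setTI; exact: mX. Qed.

Let mpX : measurable_fun setT (fun w => propensity (X w)).
Proof. exact: measurableT_comp measurable_propensity mX. Qed.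

Let bounded_integrable (f : Omega -> R) M : measurable_fun setT f ->
  (forall w, `|f w| <= M) -> P.-integrable setT (EFin \o f).
Proof.
move=> mf fM; have ic : P.-integrable setT (EFin \o cst M).
  exact: finite_measure_integrable_cst.
apply: le_integrable ic => //; first exact/measurable_EFinP.
by move=> w _ /=; rewrite lee_fin (le_trans (fM w))// ler_norm.
Qed.

Let iD : P.-integrable setT (EFin \o (fun w => (D w)%:R : R)).
Proof. by apply: (@bounded_integrable _ 1) => // w; case: (D w); rewrite ?normr1 ?normr0. Qed.

Let ipX : P.-integrable setT (EFin \o (fun w => propensity (X w))).
Proof.
apply: (@bounded_integrable _ 1) => // w.
have /andP[h1 h2] := propensity_itv (X w); have := c0.
by rewrite ler_norml => ?; apply/andP; split; lra.
Qed.

(** By definition of [pi0], and as clipping changes it only on a null set, [D - propensity (X)]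
    integrates to 0 over every event of [X]. This centres the term in the regression error. *)
Lemma propensity_eq0 (h : p.-tuple R -> R) : measurable_fun setT h ->
  P.-integrable setT (EFin \o (fun w => h (X w) * ((D w)%:R - propensity (X w)))) ->
  (\int[P]_w (h (X w) * ((D w)%:R - propensity (X w)))%:E = 0)%E.
Proof.
move=> mh ih; apply: (integral_comp_eq0 mX) => //.
  have := integrableB measurableT iD ipX.
  by apply: eq_integrable => // w _ /=; rewrite EFinB.
move=> B mB; have mB' := mXB mB.
have iDB := integrableS measurableT mB' (@subsetT _ _) iD.
have ipB := integrableS measurableT mB' (@subsetT _ _) ipX.
under eq_integral do rewrite EFinB.
rewrite (integralB_EFin mB' iDB ipB).
have [_ _ _ /(_ B mB)] := hpi0; rewrite setTI => ->.
have -> : (\int[P]_(w in X @^-1` B) (pi0 (X w))%:E =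
    \int[P]_(w in X @^-1` B) (propensity (X w))%:E)%E.
  apply: ae_eq_integral => //.
  - by apply/measurable_EFinP/measurable_funTS; exact: measurableT_comp mpi0 mX.
  - by apply/measurable_EFinP/measurable_funTS.
  - by apply: filterS pi0_propensity => w -> _.
by rewrite subee//; exact: integrable_fin_num ipB.
Qed.

Let indE B w : \1_([set w | D w = false] `&` X @^-1` B) w =
  (1 - (D w)%:R) * \1_B (X w) :> R.
Proof.
rewrite !indicE; have [xB|xB] := boolP (X w \in B).
  case: (boolP (D w)) => Dw.
    by rewrite memNset ?subrr ?mul0r// => -[/=]; rewrite Dw.
  rewrite mem_set ?subr0 ?mulr1//=; split; first exact/negbTE.
  by move: xB; rewrite inE.
rewrite mulr0 memNset// => -[_ /= h]; move/negP: xB; apply; exact/mem_set.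
Qed.

Let mD0 : measurable [set w | D w = false].
Proof.
rewrite -[X in measurable X]setTI; have := @measurable_funPT _ _ _ _ D.
by move=> /(_ measurableT [set false]); apply.
Qed.

(** On each event [D = 0], [X] in [B], the curves [Y] and [mu0 (X)] share a Bochner mean; testing it
    against [g] gives the centring over events, then over weights. This centres the term in the
    propensity error. *)
Lemma outcome_eq0 (h : p.-tuple R -> R) g : measurable_fun setT h ->
  P.-integrable setT
    (EFin \o (fun w => h (X w) * ((1 - (D w)%:R) * hinner (Y w - mu0 (X w)) g))) ->
  (\int[P]_w (h (X w) * ((1 - (D w)%:R) * hinner (Y w - mu0 (X w)) g))%:E = 0)%E.
Proof.
move=> mh ih.
have key B : measurable B -> P.-integrable setT
      (EFin \o (fun w => \1_B (X w) * ((1 - (D w)%:R) * hinner (Y w - mu0 (X w)) g))) /\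
    (\int[P]_w (\1_B (X w) * ((1 - (D w)%:R) * hinner (Y w - mu0 (X w)) g))%:E = 0)%E.
  move=> mB; have [m [m1 m2]] := hmu0.2 B mB.
  have [i1 E1] := has_mean_hinner g m1; have [i2 E2] := has_mean_hinner g m2.
  have EE w : \1_B (X w) * ((1 - (D w)%:R) * hinner (Y w - mu0 (X w)) g) =
      hinner (\1_([set w | D w = false] `&` X @^-1` B) w *: Y w) g -
      hinner (\1_([set w | D w = false] `&` X @^-1` B) w *: mu0 (X w)) g.
    by rewrite !indE !hinnerZl hinnerBl; ring.
  have ii : P.-integrable setT
      (EFin \o (fun w => \1_B (X w) * ((1 - (D w)%:R) * hinner (Y w - mu0 (X w)) g))).
    have := integrableB measurableT i1 i2.
    by apply: eq_integrable => // w _ /=; rewrite EE.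
  split => //; rewrite -[LHS]fineK; last exact: integrable_fin_num ii.
  congr EFin; rewrite -[LHS]/(Rintegral _ _ _).
  under eq_Rintegral do rewrite EE.
  by rewrite RintegralB// E1 E2 subrr.
apply: (integral_comp_eq0 mX) => //.
  have [iT _] := key setT measurableT.
  by move: iT; apply: eq_integrable => // w _ /=; rewrite indicE in_setT mul1r.
move=> B mB; rewrite integral_mkcond -[RHS](key B mB).2.
apply: eq_integral => w _; rewrite patchE indicE.
have -> : (w \in X @^-1` B) = (X w \in B) by apply/idP/idP; rewrite !inE.
by case: ifP => _; rewrite ?mul1r ?mul0r.
Qed.

(** Over each event of [X] the variable [(1 - D) |Y - mu0|^2] integrates to no more than the
    constant [M]; the comparison then extends to the weights [h (X w)]. *)
Lemma outcome_variance v M (h : p.-tuple R -> R) :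
  is_cond_mean X [set w | D w = false] (fun w => hnorm (Y w - mu0 (X w)) ^+ 2) v ->
  (forall x, v x <= M) -> 0 <= M ->
  measurable_fun setT h -> (forall x, 0 <= h x) ->
  (\int[P]_w (h (X w) * ((1 - (D w)%:R) * hnorm (Y w - mu0 (X w)) ^+ 2))%:E
   <= M%:E * \int[P]_w (h (X w))%:E)%E.
Proof.
move=> [mv iZ iv vE] vM M0 mh h0.
have mYmu : mcurve (fun w => Y w - mu0 (X w)).
  apply: mcurveB; first exact: random_mcurve.
  by apply: (mcurve_comp mX); apply: random_mcurve; case: hmu0.
have mZ1 : measurable_fun setT (fun w => (1 - (D w)%:R) * hnorm (Y w - mu0 (X w)) ^+ 2).
  by apply: measurable_funM => //; apply: measurable_funX; exact: mcurve_hnorm.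
have mhX : measurable_fun setT (fun w => (h (X w))%:E).
  by apply/measurable_EFinP; exact: measurableT_comp mh mX.
rewrite -(ge0_integralZl P measurableT mhX) ?lee_fin//; last by move=> w _; rewrite lee_fin.
under [leLHS]eq_integral do rewrite EFinM.
under [leRHS]eq_integral do rewrite muleC.
apply: (@ge0_integral_comp_le _ _ _ _ _ P X mX _ (cst M)) => //.
  by move=> w; rewrite mulr_ge0 ?sqr_ge0//; case: (D w); rewrite ?subrr ?subr0.
move=> B mB; have mEB := measurableI _ _ mD0 (mXB mB).
have -> : (\int[P]_(w in X @^-1` B) ((1 - (D w)%:R) * hnorm (Y w - mu0 (X w)) ^+ 2)%:E =
    \int[P]_(w in [set w | D w = false] `&` X @^-1` B) (hnorm (Y w - mu0 (X w)) ^+ 2)%:E)%E.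
  rewrite setIC integral_mkcondr; apply: eq_integral => w _; rewrite patchE.
  case: (boolP (D w)) => Dw.
    by rewrite subrr mul0r memNset//= Dw.
  by rewrite mem_set/= ?subr0 ?mul1r//; exact/negbTE.
rewrite vE//; apply: (@le_trans _ _ (\int[P]_(w in [set w | D w = false] `&` X @^-1` B) M%:E)%E).
  apply: le_integral => //.
  - by apply: integrableS iv => //; exact: subIsetl.
  - by apply: finite_measure_integrable_cst.
  - by move=> w _; rewrite lee_fin.
by apply: ge0_subset_integral => //; exact: mXB.
Qed.

End population.

(** * Square integrability and L^2 norms under the law of [X] *)

Section square_integrable.
Context {R : realType} (a b : R) d (T : measurableType d) (P : probability T R).

Lemma hinner_integrable_sqr (f : T -> L2 a b) g : mcurve f ->
  (\int[P]_w (hnorm (f w) ^+ 2)%:E < +oo)%E ->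
  P.-integrable setT (EFin \o (fun w => hinner (f w) g)).
Proof.
move=> mf f2.
have ic : P.-integrable setT (EFin \o cst (hnorm g ^+ 2)).
  exact: finite_measure_integrable_cst.
have if2 : P.-integrable setT (EFin \o (fun w => hnorm (f w) ^+ 2)).
  apply/integrableP; split; first exact/measurable_EFinP/measurable_funX/mcurve_hnorm.
  by under eq_integral do rewrite /= ger0_norm ?sqr_ge0//.
apply: le_integrable (integrableD measurableT if2 ic) => //.
  by apply/measurable_EFinP; apply: mcurve_hinner => //; exact: mcurve_cst.
move=> w _ /=; rewrite lee_fin (le_trans (hinner_le _ _))//.
rewrite ger0_norm ?addr_ge0 ?sqr_ge0//.
have := sqr_ge0 (hnorm (f w) - hnorm g); have := sqr_ge0 (hnorm (f w) + hnorm g).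
rewrite sqrrB sqrrD; lra.
Qed.

Lemma RintegralB4 (f1 f2 f3 f4 : T -> R) :
  P.-integrable setT (EFin \o f1) -> P.-integrable setT (EFin \o f2) ->
  P.-integrable setT (EFin \o f3) -> P.-integrable setT (EFin \o f4) ->
  P.-integrable setT (EFin \o (fun w => f1 w - f2 w - f3 w - f4 w)) /\
  \int[P]_w (f1 w - f2 w - f3 w - f4 w) =
  \int[P]_w f1 w - \int[P]_w f2 w - \int[P]_w f3 w - \int[P]_w f4 w.
Proof.
move=> i1 i2 i3 i4.
have i12 := integrableB measurableT i1 i2.
have i123 := integrableB measurableT i12 i3.
have i1234 := integrableB measurableT i123 i4.
split; first exact: eq_integrable i1234.
by rewrite (RintegralB measurableT i123 i4) (RintegralB measurableT i12 i3)
  (RintegralB measurableT i1 i2).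
Qed.

Lemma ae_integrable (f g : T -> R) : measurable_fun setT g ->
  {ae P, forall w, f w = g w} -> P.-integrable setT (EFin \o f) ->
  P.-integrable setT (EFin \o g).
Proof.
move=> mg fg /integrableP[mf fi]; apply/integrableP; split.
  exact/measurable_EFinP.
rewrite (le_lt_trans _ fi)// le_eqVlt; apply/orP; left; apply/eqP.
apply: ae_eq_integral => //.
- by apply: measurableT_comp => //; exact/measurable_EFinP.
- exact: measurableT_comp.
- by apply: filterS fg => w /= -> _.
Qed.

Lemma L2P_norm_sqr_le d' (T' : measurableType d') (X : {RV P >-> T'}) (h : T' -> R) e :
  measurable_fun setT h -> 0 <= e -> (L2P_norm X h <= e%:E)%E ->
  (\int[P]_w (h (X w) ^+ 2)%:E <= (e ^+ 2)%:E)%E.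
Proof.
move=> mh e0 he.
have -> : (\int[P]_w (h (X w) ^+ 2)%:E = L2P_norm X h `^ 2)%E.
  rewrite /L2P_norm powR_Lnorm// ge0_integral_distribution.
  - by apply: eq_integral => w _ /=; rewrite powR_mulrn// real_normK ?num_real.
  - apply: (@measurableT_comp _ _ _ _ _ _ (fun x : \bar R => (x `^ 2)%E)).
      exact: measurable_poweR.
    by apply: measurableT_comp => //; exact/measurable_EFinP.
  - by move=> x; exact: poweR_ge0.
rewrite -powR_mulrn// -poweR_EFin; apply: gt0_ler_poweR => //.
- by rewrite in_itv/= leey andbT Lnorm_ge0.
- by rewrite in_itv/= leey andbT lee_fin.
Qed.

End square_integrable.

(** * The error terms for one unit with frozen fits, and the mean of the influence function *)

Section population_terms.
Context {R : realType} (a b : R) (p : nat) d (Omega : measurableType d)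
  (P : probability Omega R).
Variables (Y : Omega -> L2 a b) (D : {RV P >-> bool}) (X : {RV P >-> p.-tuple R})
  (pi0 : p.-tuple R -> R) (mu0 : p.-tuple R -> L2 a b) (c : R).
Hypothesis hY : random_curve Y.
Hypothesis hpi0 : is_cond_mean X setT (fun w => (D w)%:R) pi0.
Hypothesis hmu0 : is_cond_mean_curve X [set w | D w = false] Y mu0.
Hypothesis hc : 0 < c < 2^-1.
Hypothesis overlap : {ae P, forall w, c <= pi0 (X w) <= 1 - c}.

Local Notation prop := (propensity pi0 c).
Local Notation gap := (odds_gap pi0 c).
Local Notation wt := (weight pi0 c).

Let c0 : 0 < c. Proof. by case/andP: hc. Qed.
Let mX : measurable_fun setT X. Proof. exact: measurable_funPT. Qed.
Let mD : measurable_fun setT D. Proof. exact: measurable_funPT. Qed.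
Let mpi0 : measurable_fun setT pi0. Proof. by case: hpi0. Qed.
Let mDR : measurable_fun setT (fun w => (D w)%:R : R).
Proof. by case: hpi0 => _ /integrableP[/measurable_EFinP]. Qed.
Let mcY : mcurve Y. Proof. exact: random_mcurve. Qed.
Let mcmu0 : mcurve mu0. Proof. by apply: random_mcurve; case: hmu0. Qed.
Let mcmu0X : mcurve (fun w => mu0 (X w)). Proof. exact: mcurve_comp. Qed.
Let mprop : measurable_fun setT prop. Proof. exact: measurable_propensity hpi0. Qed.

Let prop1 x : 0 < 1 - prop x.
Proof. by have /andP[_] := propensity_itv pi0 hc x; have := c0; lra. Qed.

Let clip_gap (e : p.-tuple R -> R) : measurable_fun setT e ->
  (\int[P]_w ((clip c (e (X w)) - prop (X w)) ^+ 2)%:E <=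
   \int[P]_w ((e (X w) - pi0 (X w)) ^+ 2)%:E)%E.
Proof.
move=> me; have meX := measurableT_comp me mX.
apply: ae_ge0_le_integral => //.
- by move=> w _; rewrite lee_fin sqr_ge0.
- apply/measurable_EFinP; apply: measurable_funX; apply: measurable_funB.
    exact: measurable_clip.
  exact: measurableT_comp.
- by move=> w _; rewrite lee_fin sqr_ge0.
- apply/measurable_EFinP; apply: measurable_funX; apply: measurable_funB => //.
  exact: measurableT_comp.
- apply: filterS overlap => w h _; rewrite lee_fin /propensity (clip_id h).
  by rewrite -real_normK ?num_real// -[leRHS]real_normK ?num_real//
    ler_pXn2r ?nnegrE// clip_dist.
Qed.

(** The factor [c ^+ 4] comes from squaring the bound [|gap| <= |e - pi| / c ^+ 2], and [M] from the
    conditional variance. The coefficient is [1 - D] times a function of [X], so centring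
    persists. *)
Lemma outcome_term v (M : R) (e : p.-tuple R -> R) (eta : R) :
  is_cond_mean X [set w | D w = false] (fun w => hnorm (Y w - mu0 (X w)) ^+ 2) v ->
  (forall x, v x <= M) -> 0 <= M -> measurable_fun setT e -> 0 <= eta ->
  (L2P_norm X (fun x => (e x - pi0 x)%R) <= eta%:E)%E ->
  (\int[P]_w (hnorm (((1 - (D w)%:R) * gap (clip c (e (X w))) (X w)) *:
      (Y w - mu0 (X w))) ^+ 2)%:E <= ((M / c ^+ 4) * eta ^+ 2)%:E)%E /\
  forall g, (\int[P]_w (hinner (((1 - (D w)%:R) * gap (clip c (e (X w))) (X w)) *:
      (Y w - mu0 (X w))) g)%:E = 0)%E.
Proof.
move=> hv vM M0 me eta0 heta.
have mgap : measurable_fun setT (fun x => gap (clip c (e x)) x).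
  by apply: (measurable_odds_gap c hpi0) => //; exact: measurable_clip.
pose F w := ((1 - (D w)%:R) * gap (clip c (e (X w))) (X w)) *: (Y w - mu0 (X w)).
have mF : mcurve F.
  apply: mcurveZ; last exact: mcurveB.
  by apply: measurable_funM; [exact: measurable_funB|exact: measurableT_comp mgap mX].
have F2 : (\int[P]_w (hnorm (F w) ^+ 2)%:E <= ((M / c ^+ 4) * eta ^+ 2)%:E)%E.
  have -> : (\int[P]_w (hnorm (F w) ^+ 2)%:E = \int[P]_w (gap (clip c (e (X w))) (X w) ^+ 2 *
      ((1 - (D w)%:R) * hnorm (Y w - mu0 (X w)) ^+ 2))%:E)%E.
    apply: eq_integral => w _; rewrite /F hnormZ exprMn real_normK ?num_real//.
    by case: (D w); congr EFin => /=; ring.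
  rewrite (le_trans (outcome_variance hY hpi0 hmu0 hv vM M0
    (h := fun x => gap (clip c (e x)) x ^+ 2) _ _))//.
  - exact: measurable_funX.
  - by move=> x; exact: sqr_ge0.
  have -> : ((M / c ^+ 4) * eta ^+ 2)%:E = (M%:E * ((c ^+ 4)^-1%:E * (eta ^+ 2)%:E))%E.
    by rewrite -!EFinM mulrA.
  rewrite lee_wpmul2l ?lee_fin//.
  apply: (@le_trans _ _ ((c ^+ 4)^-1%:E *
      \int[P]_w ((clip c (e (X w)) - prop (X w)) ^+ 2)%:E)%E); last first.
    rewrite lee_wpmul2l ?lee_fin ?invr_ge0 ?exprn_ge0 ?(ltW c0)//.
    rewrite (le_trans (clip_gap me))//.
    by apply: L2P_norm_sqr_le heta => //; exact: measurable_funB.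
  have mG : measurable_fun setT (fun w => ((clip c (e (X w)) - prop (X w)) ^+ 2)%:E).
    apply/measurable_EFinP; apply: measurable_funX; apply: measurable_funB.
      by apply: measurable_clip; exact: measurableT_comp me mX.
    exact: measurableT_comp mprop mX.
  rewrite -(ge0_integralZl P measurableT mG) ?lee_fin ?invr_ge0 ?exprn_ge0 ?(ltW c0)//;
    last by move=> w _; rewrite lee_fin sqr_ge0.
  apply: ge0_le_integral => //.
  - by move=> w _; rewrite lee_fin sqr_ge0.
  - by apply/measurable_EFinP; apply: measurable_funX; exact: measurableT_comp mgap mX.
  - by apply: emeasurable_funM.
  move=> w _; rewrite -EFinM lee_fin mulrC.
  have h := odds_gap_le pi0 hc (X w) (clip_itv (e (X w)) hc).
  rewrite -(real_normK (num_real (gap _ _))) -(real_normK (num_real (_ - prop _))).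
  have -> : c ^+ 4 = (c ^+ 2) ^+ 2 by rewrite -exprM.
  by rewrite -exprVn -exprMn ler_pXn2r ?nnegrE ?divr_ge0 ?exprn_ge0 ?(ltW c0).
split => // g.
have E w : gap (clip c (e (X w))) (X w) * ((1 - (D w)%:R) * hinner (Y w - mu0 (X w)) g) =
    hinner (F w) g by rewrite /F hinnerZl; ring.
have ih := hinner_integrable_sqr g mF (le_lt_trans F2 (ltry _)).
rewrite -[RHS](outcome_eq0 hmu0 (g := g) mgap).
  by apply: eq_integral => w _; rewrite E.
by move: ih; apply: eq_integrable => // w _; rewrite /= E.
Qed.

(** The weight is at most [c^-1] in absolute value; it is [D - pi] times a function of [X], and so
    is its inner product with any fixed curve, whence the zero mean. *)
Lemma regression_term (dl : p.-tuple R -> L2 a b) (eta : R) : mcurve dl -> 0 <= eta ->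
  (L2PH_norm X dl <= eta%:E)%E ->
  (\int[P]_w (hnorm (wt (D w) (X w) *: dl (X w)) ^+ 2)%:E
    <= (c ^- 2 * eta ^+ 2)%:E)%E /\
  forall g, (\int[P]_w (hinner (wt (D w) (X w) *: dl (X w)) g)%:E = 0)%E.
Proof.
move=> mdl eta0 heta.
have mwt : measurable_fun setT (fun w => wt (D w) (X w)).
  exact: (measurable_weight c hpi0).
have mdlX : mcurve (fun w => dl (X w)) by exact: mcurve_comp.
have mF : mcurve (fun w => wt (D w) (X w) *: dl (X w)) by exact: mcurveZ.
have F2 : (\int[P]_w (hnorm (wt (D w) (X w) *: dl (X w)) ^+ 2)%:E
    <= (c ^- 2 * eta ^+ 2)%:E)%E.
  have mN2 : measurable_fun setT (fun w => (hnorm (dl (X w)) ^+ 2)%:E).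
    by apply/measurable_EFinP; apply: measurable_funX; exact: mcurve_hnorm.
  have c2 : 0 <= c ^- 2 by rewrite invr_ge0 exprn_ge0// ltW.
  apply: (@le_trans _ _ ((c ^- 2)%:E * \int[P]_w (hnorm (dl (X w)) ^+ 2)%:E)%E).
    rewrite -(ge0_integralZl P measurableT mN2) ?lee_fin//;
      last by move=> w _; rewrite lee_fin sqr_ge0.
    apply: ge0_le_integral => //.
    - by move=> w _; rewrite lee_fin sqr_ge0.
    - by apply/measurable_EFinP; apply: measurable_funX; exact: mcurve_hnorm.
    - by apply: emeasurable_funM.
    move=> w _; rewrite -EFinM lee_fin hnormZ exprMn ler_wpM2r ?sqr_ge0//.
    by rewrite -exprVn ler_pXn2r ?nnegrE ?invr_ge0 ?(ltW c0)// (weight_le pi0 hc).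
  rewrite EFinM lee_wpmul2l ?lee_fin//.
  by apply: (L2P_norm_sqr_le (mcurve_hnorm mdl)).
split => // g.
have mh : measurable_fun setT (fun x => hinner (dl x) g / (1 - prop x)).
  apply: measurable_funM; first by apply: mcurve_hinner => //; exact: mcurve_cst.
  by apply: measurable_funV; exact: measurable_funB.
have E w : hinner (dl (X w)) g / (1 - prop (X w)) * ((D w)%:R - prop (X w)) =
    hinner (wt (D w) (X w) *: dl (X w)) g.
  by rewrite hinnerZl /weight; ring.
have ih := hinner_integrable_sqr g mF (le_lt_trans F2 (ltry _)).
rewrite -[RHS](propensity_eq0 hpi0 hc overlap mh).
  by apply: eq_integral => w _; rewrite E.
by move: ih; apply: eq_integrable => // w _; rewrite /= E.
Qed.

(** Hoelder with both exponents 2 under the law of [X]; [c ^- 2] comes from the bound on the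
    difference of odds. *)
Lemma product_term (e : p.-tuple R -> R) (dl : p.-tuple R -> L2 a b) (eta : R) :
  measurable_fun setT e -> mcurve dl ->
  (L2PH_norm X dl * L2P_norm X (fun x => (e x - pi0 x)%R) <= eta%:E)%E ->
  (\int[P]_w (`|gap (clip c (e (X w))) (X w)| * hnorm (dl (X w)))%:E
    <= (c ^- 2 * eta)%:E)%E.
Proof.
move=> me mdl heta.
have mepi : measurable_fun setT (fun x => e x - pi0 x) by exact: measurable_funB.
have mndl : measurable_fun setT (fun x => hnorm (dl x)) by exact: mcurve_hnorm.
have mprod : measurable_fun setT (fun x => `|e x - pi0 x| * hnorm (dl x)).
  by apply: measurable_funM => //; exact: measurableT_comp.
have mprodX : measurable_fun setT
    (fun w => (`|e (X w) - pi0 (X w)| * hnorm (dl (X w)))%:E).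
  by apply/measurable_EFinP; exact: measurableT_comp mprod mX.
have c2 : 0 <= c ^- 2 by rewrite invr_ge0 exprn_ge0// ltW.
apply: (@le_trans _ _ ((c ^- 2)%:E *
    \int[P]_w (`|e (X w) - pi0 (X w)| * hnorm (dl (X w)))%:E)%E); last first.
  rewrite EFinM lee_wpmul2l ?lee_fin// (le_trans _ heta)//.
  have -> : (\int[P]_w (`|e (X w) - pi0 (X w)| * hnorm (dl (X w)))%:E =
      'N[distribution P X]_1[EFin \o ((fun x => hnorm (dl x)) \* (fun x => e x - pi0 x))%R])%E.
    rewrite Lnorm1 ge0_integral_distribution//.
      apply: eq_integral => w _ /=.
      by rewrite normrM (ger0_norm (hnorm_ge0 _)) mulrC.
    apply: measurableT_comp => //; apply/measurable_EFinP; exact: measurable_funM.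
  by apply: hoelder => //; lra.
rewrite -(ge0_integralZl P measurableT mprodX) ?lee_fin//;
  last by move=> w _; rewrite lee_fin mulr_ge0 ?hnorm_ge0.
apply: ae_ge0_le_integral => //.
- by move=> w _; rewrite lee_fin mulr_ge0 ?hnorm_ge0.
- apply/measurable_EFinP; apply: measurable_funM; last exact: measurableT_comp mndl mX.
  apply: measurableT_comp => //.
  apply: (measurable_odds_gap c hpi0) => //; apply: measurable_clip.
  exact: measurableT_comp me mX.
- by move=> w _; rewrite mule_ge0 ?lee_fin// mulr_ge0 ?hnorm_ge0.
- by apply: emeasurable_funM.
- apply: filterS overlap => w h _.
  rewrite -EFinM lee_fin mulrA ler_wpM2r ?hnorm_ge0//.
  rewrite (le_trans (odds_gap_le pi0 hc (X w) (clip_itv (e (X w)) hc)))//.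
  rewrite mulrC ler_wpM2l// /propensity (clip_id h); exact: clip_dist.
Qed.

Lemma mcurve_influence p0 tau0 d' (T : measurableType d') (y : T -> L2 a b)
    (D' : T -> bool) (x : T -> p.-tuple R) :
  mcurve y -> measurable_fun setT D' -> measurable_fun setT x ->
  mcurve (fun t => influence p0 pi0 mu0 tau0 (y t, D' t, x t)).
Proof.
move=> my mD' mx; have mpx := measurableT_comp mpi0 mx.
have mmx : mcurve (fun t => mu0 (x t)) by exact: mcurve_comp.
have mDR' : measurable_fun setT (fun t => (D' t)%:R : R).
  rewrite (_ : (fun _ => _) = (fun t => if D' t then 1 else 0)).
    exact: measurable_fun_ifT.
  by apply/funext => t; case: (D' t).
apply: mcurveB; apply: mcurveZ; do ?exact: mcurveB.
- exact: measurable_funM.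
- by apply: mcurveB; [exact: mcurveB|exact: mcurve_cst].
- apply: measurable_funM; first by apply: measurable_funM => //; exact: measurable_funB.
  by apply: measurable_funV; apply: measurable_funM => //; exact: measurable_funB.
Qed.

(** Apart from its [mu0] part, the influence function tested against [g] has mean
    [<m1 - m2 - tau0, g> = 0]. The [mu0] part has the coefficient [(D - pi) / (p0 (1 - pi))],
    centred given [X]. *)
Lemma influence_mean0 p0 tau0 m1 m2 g : p0 = fine (P [set w | D w = true]) -> 0 < p0 ->
  has_mean P (fun w => ((D w)%:R / p0) *: Y w) m1 ->
  has_mean P (fun w => ((1 - (D w)%:R) * pi0 (X w) / (p0 * (1 - pi0 (X w)))) *: Y w) m2 ->
  hnorm (tau0 - (m1 - m2)) = 0 ->
  (\int[P]_w (hnorm (influence p0 pi0 mu0 tau0 (Y w, D w, X w)) ^+ 2)%:E < +oo)%E ->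
  (\int[P]_w (hinner (influence p0 pi0 mu0 tau0 (Y w, D w, X w)) g)%:E = 0)%E.
Proof.
have comb (x0 x1 x2 x3 x4 y1 y2 y3 : R) : x0 = x1 - x2 - x3 - x4 -> x0 = 0 ->
  x1 = y1 -> x2 = y2 -> x3 = y3 -> x4 = y1 - y2 - y3 by move=> *; lra.
move=> p0E p00 hm1 hm2 tau0E phi2.
have mphi : mcurve (fun w => influence p0 pi0 mu0 tau0 (Y w, D w, X w)).
  exact: mcurve_influence.
have iphi := hinner_integrable_sqr g mphi phi2.
have [i1 E1] := has_mean_hinner g hm1; have [i2 E2] := has_mean_hinner g hm2.
have iD : P.-integrable setT (EFin \o (fun w => (D w)%:R : R)) by case: hpi0.
have i3 : P.-integrable setT (EFin \o (fun w => hinner tau0 g / p0 * (D w)%:R)).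
  by have := integrableZl measurableT (hinner tau0 g / p0) iD; apply: eq_integrable.
have mh : measurable_fun setT (fun x => hinner (mu0 x) g / (p0 * (1 - prop x))).
  apply: measurable_funM; first by apply: mcurve_hinner => //; exact: mcurve_cst.
  apply: measurable_funV; apply: measurable_funM => //; exact: measurable_funB.
(* The [mu0] part, written as a combination of four integrable variables from which it inherits the
   integrability required for its mean to vanish. *)
pose Q w := hinner (((D w)%:R / p0) *: Y w) g -
  hinner (((1 - (D w)%:R) * pi0 (X w) / (p0 * (1 - pi0 (X w)))) *: Y w) g -
  hinner tau0 g / p0 * (D w)%:R -
  hinner (influence p0 pi0 mu0 tau0 (Y w, D w, X w)) g.
have [iQ QE] := RintegralB4 i1 i2 i3 iphi.
have Qae : {ae P, forall w, Q w =
    hinner (mu0 (X w)) g / (p0 * (1 - prop (X w))) * ((D w)%:R - prop (X w))}.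
  apply: filterS (pi0_propensity overlap) => w E; rewrite /Q /influence E.
  rewrite !(hinnerZl, hinnerBl).
  have p1 : 1 - prop (X w) != 0 by rewrite gt_eqF.
  by field; rewrite p1 gt_eqF.
have mQ : measurable_fun setT Q by apply/measurable_EFinP; case/integrableP: iQ.
have mhX : measurable_fun setT (fun w => hinner (mu0 (X w)) g / (p0 * (1 - prop (X w))) *
    ((D w)%:R - prop (X w))).
  apply: measurable_funM; first exact: measurableT_comp mh mX.
  by apply: measurable_funB => //; exact: measurableT_comp mprop mX.
have Q0 : (\int[P]_w (Q w)%:E = 0)%E.
  rewrite -(propensity_eq0 hpi0 hc overlap mh (ae_integrable mhX Qae iQ)).
  by apply: ae_eq_integral; [|exact/measurable_EFinP|exact/measurable_EFinP|
    apply: filterS Qae => w -> _].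
have D1 : \int[P]_w (D w)%:R = p0.
  rewrite p0E /Rintegral; congr fine.
  transitivity (\int[P]_w (\1_([set w | D w = true]) w)%:E)%E.
    apply: eq_integral => w _; rewrite indicE.
    by case: (boolP (D w)) => Dw; [rewrite mem_set|rewrite memNset//=; exact/negP].
  rewrite integral_indic ?setIT// -[X in measurable X]setTI.
  exact: (mD measurableT (Y := [set true])).
have RQ0 : \int[P]_w Q w = 0 by rewrite /Rintegral Q0.
have E3 : \int[P]_w (hinner tau0 g / p0 * (D w)%:R) = hinner tau0 g.
  by rewrite (RintegralZl _ measurableT iD) D1 mulfVK ?gt_eqF.
have E4 := comb _ _ _ _ _ _ _ _ QE RQ0 E1 E2 E3.
rewrite -[LHS](fineK (integrable_fin_num measurableT iphi)); congr EFin.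
(* [tau0] agrees with [m1 - m2] only up to [hnorm], so Cauchy-Schwarz concludes. *)
apply: etrans E4 _; rewrite -!hinnerBl.
apply/eqP; rewrite -normr_le0 (le_trans (hinner_le _ _))//.
by rewrite hnorm_distC tau0E mul0r.
Qed.

End population_terms.

(** * Transfer between equal laws, and measurability of L^2 errors in the training data *)

Section equal_laws.
Local Open Scope ereal_scope.
Context {R : realType} d d' (T : measurableType d) (T' : measurableType d')
  (P : probability T R) (U V : T -> T').
Hypothesis mU : measurable_fun setT U.
Hypothesis mV : measurable_fun setT V.
Hypothesis UV : forall B, measurable B -> P (U @^-1` B) = P (V @^-1` B).

Lemma ge0_integral_eq_law (f : T' -> \bar R) : measurable_fun setT f ->
  (forall x, 0 <= f x) -> \int[P]_w f (U w) = \int[P]_w f (V w).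
Proof.
move=> mf f0; pose rU : {mfun T >-> T'} := mfun_Sub (mem_set mU).
pose rV : {mfun T >-> T'} := mfun_Sub (mem_set mV).
have EU : \int[distribution P rU]_x f x = \int[P]_w f (U w).
  by rewrite ge0_integral_distribution.
have EV : \int[distribution P rV]_x f x = \int[P]_w f (V w).
  by rewrite ge0_integral_distribution.
by rewrite -EU -EV; apply: eq_measure_integral => B mB _; exact: UV.
Qed.

Lemma integral_eq_law (f : T' -> \bar R) : measurable_fun setT f ->
  \int[P]_w f (U w) = \int[P]_w f (V w).
Proof.
move=> mf; rewrite integralE [RHS]integralE.
have Ep := ge0_integral_eq_law (measurable_funepos mf) (funepos_ge0 f).
have En := ge0_integral_eq_law (measurable_funeneg mf) (funeneg_ge0 f).
congr (_ - _).
  transitivity (\int[P]_w f^\+ (U w)); first by apply: eq_integral => w _; rewrite !funeposE.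
  by rewrite Ep; apply: eq_integral => w _; rewrite !funeposE.
transitivity (\int[P]_w f^\- (U w)); first by apply: eq_integral => w _; rewrite !funenegE.
by rewrite En; apply: eq_integral => w _; rewrite !funenegE.
Qed.

End equal_laws.

(** The square of the norm is a partial integral of a jointly measurable function, so Tonelli
    applies. *)
Lemma measurable_L2P_norm (R : realType) d d1 d2 (T : measurableType d)
    (T1 : measurableType d1) (T2 : measurableType d2) (P : probability T R)
    (X : {RV P >-> T2}) (h : T1 * T2 -> R) : measurable_fun setT h ->
  measurable_fun setT (fun u => L2P_norm X (fun x => h (u, x))).
Proof.
move=> mh.
have mh2 : measurable_fun setT (fun z => (`|(h z)%:E| `^ 2)%E).
  apply: (@measurableT_comp _ _ _ _ _ _ (fun x : \bar R => (x `^ 2)%E)).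
    exact: measurable_poweR.
  by apply: measurableT_comp => //; exact/measurable_EFinP.
have := @measurable_fun_fubini_tonelli_F _ _ T1 T2 R (distribution P X) _ mh2
  (fun z => poweR_ge0 _ _).
move=> mF; rewrite /L2P_norm unlock.
exact: (measurableT_comp (measurable_poweR _) mF).
Qed.

Lemma bool_dist_le1 (R : realType) (t : bool) (x : R) : 0 <= x <= 1 -> `|t%:R - x| <= 1.
Proof. by move=> /andP[x0 x1]; rewrite ler_norml; case: t => /=; apply/andP; split; lra. Qed.

(** * The deterministic bound on the remainder at one sample point *)

Section remainder.
Context {R : realType} (a b : R) (n K : nat).
Variables (c : {ffun 'I_n -> 'I_K}) (D : 'I_n -> bool) (e pi : 'I_n -> R)
  (y yhat m mhat : 'I_n -> L2 a b) (tau0 : L2 a b) (cc p0 : R).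
Local Notation phat := (n%:R^-1 * \sum_(i < n) (D i)%:R : R).
Local Notation gap i := ((e i - pi i) / ((1 - e i) * (1 - pi i))).

Let psi i := (((D i)%:R - pi i) / (1 - pi i)) *: (y i - m i).
Let psihat i := (((D i)%:R - e i) / (1 - e i)) *: (yhat i - mhat i).

Lemma dr_summandE q i : q != 0 -> 1 - e i != 0 ->
  dr_summand q (e i) (mhat i) (yhat i) (D i) = q^-1 *: psihat i.
Proof.
move=> q0 e0; rewrite /dr_summand /psihat -scalerBl scalerA.
by congr (_ *: _); field; rewrite q0 e0.
Qed.

Lemma influenceE p (pi0 : p.-tuple R -> R) (mu0 : p.-tuple R -> L2 a b)
    (x : p.-tuple R) i :
  p0 != 0 -> 1 - pi i != 0 -> pi0 x = pi i -> mu0 x = m i ->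
  influence p0 pi0 mu0 tau0 (y i, D i, x) = p0^-1 *: (psi i - (D i)%:R *: tau0).
Proof.
move=> p00 pi1 piE mE; rewrite /influence piE mE /psi.
rewrite [X in X - _]scalerBr addrAC -scalerBl [RHS]scalerBr !scalerA.
have -> : (D i)%:R / p0 - (1 - (D i)%:R) * pi i / (p0 * (1 - pi i)) =
    p0^-1 * (((D i)%:R - pi i) / (1 - pi i)) by field; rewrite p00 pi1.
by rewrite [in LHS](mulrC _ p0^-1).
Qed.

Lemma sum_folds (V : nmodType) (f : 'I_K -> 'I_n -> V) :
  \sum_(k < K) \sum_(i < n | c i == k) f k i = \sum_(i < n) f (c i) i.
Proof.
rewrite (partition_big c predT)//=; apply: eq_bigr => k _.
by apply: eq_bigr => i /eqP ->.
Qed.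

Hypothesis n0 : (0 < n)%N.
Hypothesis c0 : 0 < cc.
Hypothesis ec : forall i, cc <= e i <= 1 - cc.
Hypothesis pic : forall i, cc <= pi i <= 1 - cc.
Hypothesis p00 : 0 < p0.
Hypothesis phat0 : p0 / 2 <= phat.

Let e1 i : 1 - e i != 0.
Proof. by have /andP[_ h] := ec i; rewrite gt_eqF// subr_gt0 (le_lt_trans h)// gtrBl. Qed.

Let pi1 i : 1 - pi i != 0.
Proof. by have /andP[_ h] := pic i; rewrite gt_eqF// subr_gt0 (le_lt_trans h)// gtrBl. Qed.

Let psi_diff i : psihat i - psi i =
  (((D i)%:R - e i) / (1 - e i)) *: (yhat i - y i)
  - ((1 - (D i)%:R) * gap i) *: (y i - m i)
  - (((D i)%:R - pi i) / (1 - pi i)) *: (mhat i - m i)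
  + ((1 - (D i)%:R) * gap i) *: (mhat i - m i).
Proof.
rewrite /psihat /psi; set s := (_ - e i) / _; set r := (_ - pi i) / _.
(* Both weights equal 1 on treated units, so their difference lives on the controls. *)
have -> : (1 - (D i)%:R) * gap i = r - s by rewrite /r /s; field; rewrite e1 pi1.
have -> : yhat i - mhat i = (yhat i - y i) + (y i - m i) - (mhat i - m i).
  by rewrite addrA subrK opprB addrA subrK.
rewrite scalerBr scalerDr !scalerBl opprB [RHS]addrA subrK.
by rewrite addrA [RHS]addrAC addrAC.
Qed.

Let phat_gt0 : 0 < phat.
Proof. by rewrite (lt_le_trans _ phat0)// divr_gt0. Qed.

(** The factor [2 / p0] bounds [phat^-1]. The bound is written in exactly the normalized sums that
    are shown to vanish, with already clipped propensities [e] and [pi]. *)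
Lemma remainder_le (p : nat) (pi0 : p.-tuple R -> R) (mu0 : p.-tuple R -> L2 a b)
    (x : 'I_n -> p.-tuple R)
    (pihat : 'I_K -> p.-tuple R -> R) (muhat : 'I_K -> p.-tuple R -> L2 a b) B :
  (forall i, pi0 (x i) = pi i) -> (forall i, mu0 (x i) = m i) ->
  (forall i, pihat (c i) (x i) = e i) -> (forall i, muhat (c i) (x i) = mhat i) ->
  (forall i, hnorm (yhat i - y i) <= B) ->
  hnorm (Num.sqrt n%:R *: (tau_hat c pihat muhat yhat D x - tau0)
    - (Num.sqrt n%:R)^-1 *: \sum_(i < n) influence p0 pi0 mu0 tau0 (y i, D i, x i)) <=
  2 / p0 * (cc^-1 * (Num.sqrt n%:R * B) +
    \sum_(k < K) (
      (Num.sqrt n%:R)^-1 * hnorm (\sum_(i < n | c i == k)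
        ((1 - (D i)%:R) * gap i) *: (y i - m i)) +
      (Num.sqrt n%:R)^-1 * hnorm (\sum_(i < n | c i == k)
        (((D i)%:R - pi i) / (1 - pi i)) *: (mhat i - m i)) +
      (Num.sqrt n%:R)^-1 * \sum_(i < n | c i == k) `|gap i| * hnorm (mhat i - m i)) +
    `|phat - p0| * ((Num.sqrt n%:R)^-1 *
      hnorm (\sum_(i < n) influence p0 pi0 mu0 tau0 (y i, D i, x i)))).
Proof.
move=> piE mE eE mhE yB.
set sn := Num.sqrt n%:R; set Phi := \sum_(i < n) influence _ _ _ _ _.
have sn0 : 0 < sn by rewrite sqrtr_gt0 ltr0n.
have snE : n%:R = sn * sn by rewrite -expr2 sqr_sqrtr.
have ph0 : phat != 0 by rewrite gt_eqF.
have p0n : p0 != 0 by rewrite gt_eqF.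
have sn_n : sn != 0 by rewrite gt_eqF.
(* The treated indicators sum to [n * phat], so [tau0] enters with [phat] rather than [p0]; this
   produces the term in [p0 - phat]. *)
have PhiE : Phi = p0^-1 *: (\sum_i psi i - (n%:R * phat) *: tau0).
  rewrite mulrA divff ?pnatr_eq0 -?lt0n// mul1r scaler_suml -sumrB scaler_sumr.
  by apply: eq_bigr => i _; exact: influenceE.
have tauE : tau_hat c pihat muhat yhat D x = (n%:R^-1 * phat^-1) *: \sum_i psihat i.
  rewrite /tau_hat (sum_folds (fun k i => dr_summand phat (pihat k (x i))
    (muhat k (x i)) (yhat i) (D i))) -scalerA; congr (_ *: _).
  rewrite scaler_sumr; apply: eq_bigr => i _.
  by rewrite eE mhE dr_summandE.
pose S := \sum_i (psihat i - psi i).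
have SE : \sum_i psihat i = S + (p0 *: Phi + (n%:R * phat) *: tau0).
  rewrite PhiE scalerA divff// scale1r subrK /S -big_split/=.
  by apply: eq_bigr => i _; rewrite subrK.
have n_n : n%:R != 0 :> R by rewrite pnatr_eq0 -lt0n.
have rE : sn *: (tau_hat c pihat muhat yhat D x - tau0) - sn^-1 *: Phi =
    (sn^-1 * phat^-1) *: S + (sn^-1 * ((p0 - phat) * phat^-1)) *: Phi.
  have -> : tau_hat c pihat muhat yhat D x - tau0 =
      (n%:R^-1 * phat^-1) *: (S + p0 *: Phi).
    have K1 : n%:R^-1 * phat^-1 * (n%:R * phat) = 1.
      by rewrite -invfM mulVf// mulf_neq0.
    by rewrite tauE SE addrA scalerDr [X in _ + X - _]scalerA K1 scale1r addrK.
  rewrite scalerA mulrA (_ : sn * n%:R^-1 = sn^-1); last first.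
    by rewrite snE invfM mulrA divff// mul1r.
  rewrite scalerDr scalerA -addrA -scalerBl; congr (_ + _ *: _).
  by rewrite mulrBl divff// mulrBr mulr1 [p0 / _]mulrC mulrA.
have nS : hnorm S <= n%:R * (cc^-1 * B) + \sum_(k < K) (
    hnorm (\sum_(i < n | c i == k) ((1 - (D i)%:R) * gap i) *: (y i - m i)) +
    hnorm (\sum_(i < n | c i == k) (((D i)%:R - pi i) / (1 - pi i)) *: (mhat i - m i)) +
    \sum_(i < n | c i == k) `|gap i| * hnorm (mhat i - m i)).
  have -> : S = \sum_i (((D i)%:R - e i) / (1 - e i)) *: (yhat i - y i)
      - \sum_i ((1 - (D i)%:R) * gap i) *: (y i - m i)
      - \sum_i (((D i)%:R - pi i) / (1 - pi i)) *: (mhat i - m i)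
      + \sum_i ((1 - (D i)%:R) * gap i) *: (mhat i - m i).
    by rewrite -!sumrB -big_split/=; apply: eq_bigr => i _; exact: psi_diff.
  rewrite (le_trans (hnormD _ _))// big_split/= addrA lerD//; last first.
    rewrite (sum_folds (fun _ i => `|gap i| * hnorm (mhat i - m i))) (le_trans (hnorm_sum _ _ _))// ler_sum// => i _.
    rewrite hnormZ ler_wpM2r ?hnorm_ge0// normrM ler_piMl//.
    by case: (D i); rewrite ?subrr ?subr0 ?normr0 ?normr1.
  rewrite big_split/= addrA (le_trans (hnormB _ _))// lerD//; last first.
    rewrite -(sum_folds (fun _ i => (((D i)%:R - pi i) / (1 - pi i)) *: (mhat i - m i))).
    exact: hnorm_sum.
  rewrite (le_trans (hnormB _ _))// lerD//; last first.
    rewrite -(sum_folds (fun _ i => ((1 - (D i)%:R) * gap i) *: (y i - m i))).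
    exact: hnorm_sum.
  rewrite (le_trans (hnorm_sum _ _ _))//.
  rewrite (@le_trans _ _ (\sum_(i < n) cc^-1 * B))//; last first.
    by rewrite sumr_const card_ord mulr_natl.
  apply: ler_sum => i _; rewrite hnormZ ler_pM ?hnorm_ge0//.
  have /andP[h1 h2] := ec i.
  have h3 : 0 < 1 - e i by rewrite lt_neqAle eq_sym e1/= subr_ge0 (le_trans h2)// gerBl ltW.
  rewrite normrM normfV (gtr0_norm h3) -[leRHS]mul1r ler_pM ?invr_ge0 ?(ltW h3)//.
    have e0 : 0 <= e i by rewrite (le_trans (ltW c0)).
    by apply: bool_dist_le1; rewrite e0 (le_trans h2)// gerBl ltW.
  by rewrite lef_pV2 ?posrE// lerBrDr addrC -lerBrDr.
rewrite rE (le_trans (hnormD _ _))// !hnormZ.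
have -> : `|sn^-1 * phat^-1| * hnorm S + `|sn^-1 * ((p0 - phat) * phat^-1)| * hnorm Phi =
    phat^-1 * (sn^-1 * hnorm S + `|phat - p0| * (sn^-1 * hnorm Phi)).
  rewrite !normrM !(@gtr0_norm _ _^-1) ?invr_gt0// distrC; ring.
have Phi0 := hnorm_ge0 Phi; have S0 := hnorm_ge0 S.
rewrite ler_pM ?invr_ge0 ?(ltW phat_gt0)//.
- by rewrite addr_ge0 ?mulr_ge0 ?invr_ge0// ltW.
- by rewrite -[2 / p0]invf_div lef_pV2 ?posrE// divr_gt0.
rewrite lerD2r (le_trans (ler_wpM2l _ nS))// ?invr_ge0 ?(ltW sn0)//.
rewrite mulrDr lerD//.
  have -> : n%:R * (cc^-1 * B) = sn * (cc^-1 * (sn * B)) by rewrite snE; ring.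
  by rewrite mulrA mulVf// mul1r.
by rewrite mulr_sumr ler_sum// => k _; rewrite !mulrDr.
Qed.

End remainder.

(** * Each remainder term vanishes in probability *)

Section sample.
Context {R : realType} {a b : R} {p K : nat} {d dS : measure_display}
  {Omega : measurableType d} {S : measurableType dS} (P : probability Omega R).
Variables (Y : Omega -> L2 a b) (D : {RV P >-> bool}) (X : {RV P >-> p.-tuple R})
  (pi0 : p.-tuple R -> R) (mu0 : p.-tuple R -> L2 a b) (c : R).
Hypothesis hY : random_curve Y.
Hypothesis hpi0 : is_cond_mean X setT (fun w => (D w)%:R) pi0.
Hypothesis hmu0 : is_cond_mean_curve X [set w | D w = false] Y mu0.
Hypothesis hc : 0 < c < 2^-1.
Hypothesis overlap : {ae P, forall w, c <= pi0 (X w) <= 1 - c}.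
Variables (Yi : nat -> Omega -> L2 a b) (Di : nat -> {RV P >-> bool})
  (Xi : nat -> {RV P >-> p.-tuple R}) (Z : nat -> nat -> {RV P >-> S}).
Hypothesis hcopies : forall i (B : set (obs a b p)), measurable B ->
  P [set w | B (Yi i w, Di i w, Xi i w)] = P [set w | B (Y w, D w, X w)].
Hypothesis hindep : forall n, mutually_independent P
  (fun (i : 'I_n) w => ((Yi i w, Di i w, Xi i w), Z n i w) : obs a b p * S).
Variable fold : forall n, Omega -> {ffun 'I_n -> 'I_K}.
Hypothesis hfold : forall n c', measurable (fold n @^-1` [set c']).

Let U n (i : 'I_n) w : obs a b p * S := ((Yi i w, Di i w, Xi i w), Z n i w).
Let rec n w := [tuple U i w | i < n].

Hypothesis hfold_indep : forall n,
  independent_of P (@fold n) (fun w => [tuple U i w | i < n]).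
(** Stands for the identity on the curve component of a record: it makes the summands limits of
    simple curves on the whole record space and fixes every curve that occurs. *)
Variable kap : L2 a b -> L2 a b.
Hypothesis mkap : mcurve kap.
Hypothesis kapY : forall w, kap (Y w) = Y w.
Hypothesis kapYi : forall i w, kap (Yi i w) = Yi i w.
Hypothesis mY : measurable_fun setT Y.
Hypothesis mYi : forall i, measurable_fun setT (Yi i).

Local Notation prop := (propensity pi0 c).
Local Notation gap := (odds_gap pi0 c).
Local Notation wt := (weight pi0 c).

Let c0 : 0 < c. Proof. by case/andP: hc. Qed.
Let mpi0 : measurable_fun setT pi0. Proof. by case: hpi0. Qed.
Let mcmu0 : mcurve mu0. Proof. by apply: random_mcurve; case: hmu0. Qed.

Let mW : measurable_fun setT (fun w => (Y w, D w, X w) : obs a b p).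
Proof.
apply: measurable_fun_pair; last exact: measurable_funPT.
by apply: measurable_fun_pair => //; exact: measurable_funPT.
Qed.

Let mWi i : measurable_fun setT (fun w => (Yi i w, Di i w, Xi i w) : obs a b p).
Proof.
apply: measurable_fun_pair; last exact: measurable_funPT.
by apply: measurable_fun_pair => //; exact: measurable_funPT.
Qed.

Let mU n i : measurable_fun setT (@U n i).
Proof. by apply: measurable_fun_pair; [exact: mWi|exact: measurable_funPT]. Qed.

Let mrec n : measurable_fun setT (@rec n).
Proof. exact: measurable_record (@mU n). Qed.

Lemma integral_copy i (f : obs a b p -> \bar R) : measurable_fun setT f ->
  (\int[P]_w f (Yi i w, Di i w, Xi i w) = \int[P]_w f (Y w, D w, X w))%E.
Proof. exact: (integral_eq_law (mWi i) mW (hcopies i)). Qed.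

Local Notation O := (obs a b p * S)%type.

Let mzo n : measurable_fun setT (fun z : n.-tuple O * O => z.2.1).
Proof. exact: (measurableT_comp measurable_fst measurable_snd). Qed.

Let mzy n : measurable_fun setT (fun z : n.-tuple O * O => z.2.1.1.1).
Proof. exact: (measurableT_comp measurable_fst (measurableT_comp measurable_fst (@mzo n))). Qed.

Let mzD n : measurable_fun setT (fun z : n.-tuple O * O => z.2.1.1.2).
Proof. exact: (measurableT_comp measurable_snd (measurableT_comp measurable_fst (@mzo n))). Qed.

Let mzx n : measurable_fun setT (fun z : n.-tuple O * O => z.2.1.2).
Proof. exact: (measurableT_comp measurable_snd (@mzo n)). Qed.

Let mzux n : measurable_fun setT (fun z : n.-tuple O * O => (z.1, z.2.1.2)).
Proof. by apply: measurable_fun_pair; [exact: measurable_fst|exact: mzx]. Qed.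

Let mzDR n : measurable_fun setT (fun z : n.-tuple O * O => (z.2.1.1.2)%:R : R).
Proof.
rewrite (_ : (fun _ => _) = (fun z : n.-tuple O * O => if z.2.1.1.2 then 1 else 0)).
  by apply: measurable_fun_ifT => //; exact: mzD.
by apply/funext => z; case: z.2.1.1.2.
Qed.

Let mkapz n : mcurve (fun z : n.-tuple O * O => kap z.2.1.1.1).
Proof. exact: (mcurve_comp (@mzy n) mkap). Qed.

Let mmu0z n : mcurve (fun z : n.-tuple O * O => mu0 z.2.1.2).
Proof. exact: (mcurve_comp (@mzx n) mcmu0). Qed.

(** For a function blind to the further data of the unit, that component is set to [point]; what
    remains depends only on the law of [(Yi, Di, Xi)], which is that of [W]. *)
Let integral_record n (f : n.-tuple O * O -> R) u (i : 'I_n) :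
  measurable_fun setT f -> (forall o s s', f (u, (o, s)) = f (u, (o, s'))) ->
  (\int[P]_w (f (u, U i w))%:E =
   \int[P]_w (f (u, ((Y w, D w, X w), point)))%:E)%E.
Proof.
move=> mf fs; transitivity (\int[P]_w (f (u, ((Yi i w, Di i w, Xi i w), point)))%:E)%E.
  by apply: eq_integral => w _; rewrite /U (fs _ _ point).
apply: (@integral_copy i (fun o => (f (u, (o, point)))%:E)).
apply/measurable_EFinP; apply: (measurableT_comp mf).
by apply: measurable_fun_pair => //; apply: measurable_fun_pair.
Qed.

Section folds.
Variables (gpi : forall n, {ffun 'I_n -> 'I_K} -> 'I_K -> n.-tuple (obs a b p * S) ->
    p.-tuple R -> R)
  (gmu : forall n, {ffun 'I_n -> 'I_K} -> 'I_K -> n.-tuple (obs a b p * S) ->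
    p.-tuple R -> L2 a b).
Hypothesis mgpi : forall n (c' : {ffun 'I_n -> 'I_K}) k,
  measurable_fun setT (fun z => gpi c' k z.1 z.2).
Hypothesis mgmu : forall n (c' : {ffun 'I_n -> 'I_K}) k,
  mcurve (fun z => gmu c' k z.1 z.2).
Hypothesis gpi_off : forall n (c' : {ffun 'I_n -> 'I_K}) k
    (u v : n.-tuple (obs a b p * S)),
  (forall i, c' i != k -> tnth u i = tnth v i) -> gpi c' k u = gpi c' k v.
Hypothesis gmu_off : forall n (c' : {ffun 'I_n -> 'I_K}) k
    (u v : n.-tuple (obs a b p * S)),
  (forall i, c' i != k -> tnth u i = tnth v i) -> gmu c' k u = gmu c' k v.
Variable k : 'I_K.

Let Npi n (c' : {ffun 'I_n -> 'I_K}) (u : n.-tuple (obs a b p * S)) : \bar R :=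
  L2P_norm X (fun x => gpi c' k u x - pi0 x).
Let Nmu n (c' : {ffun 'I_n -> 'I_K}) (u : n.-tuple (obs a b p * S)) : \bar R :=
  L2PH_norm X (fun x => gmu c' k u x - mu0 x).

Let mNpi n c' : measurable_fun setT (@Npi n c').
Proof.
apply: (measurable_L2P_norm X (h := fun z => gpi c' k z.1 z.2 - pi0 z.2)).
by apply: measurable_funB; [exact: mgpi|exact: measurableT_comp mpi0 measurable_snd].
Qed.

Let mNmu n c' : measurable_fun setT (@Nmu n c').
Proof.
apply: (measurable_L2P_norm X (h := fun z => hnorm (gmu c' k z.1 z.2 - mu0 z.2))).
apply: mcurve_hnorm; apply: mcurveB; first exact: mgmu.
exact: mcurve_comp measurable_snd mcmu0.
Qed.

Let case_likely (N : forall n, {ffun 'I_n -> 'I_K} -> n.-tuple (obs a b p * S) -> \bar R) r :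
  (forall n c', measurable_fun setT (@N n c')) ->
  little_op P (fun n w => N n (fold n w) (rec n w)) r ->
  forall e : R, 0 < e -> likely P (fun n w => (N n (fold n w) (rec n w) <= (e * r n)%:E)%E).
Proof.
move=> mN oN e e0; apply: likelyS (little_op_likely _ oN e0).
  by apply: nearW => n w; apply: le_trans; exact: lee_abs.
move=> n; apply: (measurable_fun_case (@hfold n) (H := fun c' w => N n c' (rec n w))) => c'.
exact: measurableT_comp (mN n c') (@mrec n).
Qed.

Let F1 n (c' : {ffun 'I_n -> 'I_K}) (z : n.-tuple O * O) :=
  ((1 - (z.2.1.1.2)%:R) * gap (clip c (gpi c' k z.1 z.2.1.2)) z.2.1.2) *:
    (kap z.2.1.1.1 - mu0 z.2.1.2).

Let F2 n (c' : {ffun 'I_n -> 'I_K}) (z : n.-tuple O * O) :=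
  wt z.2.1.1.2 z.2.1.2 *: (gmu c' k z.1 z.2.1.2 - mu0 z.2.1.2).

Let F3 n (c' : {ffun 'I_n -> 'I_K}) (z : n.-tuple O * O) :=
  `|gap (clip c (gpi c' k z.1 z.2.1.2)) z.2.1.2| *
  hnorm (gmu c' k z.1 z.2.1.2 - mu0 z.2.1.2).

Let mgap n (c' : {ffun 'I_n -> 'I_K}) :
  measurable_fun setT (fun z : n.-tuple O * O => gap (clip c (gpi c' k z.1 z.2.1.2)) z.2.1.2).
Proof.
apply: (measurable_odds_gap c hpi0); last exact: mzx.
by apply: measurable_clip; exact: (measurableT_comp (mgpi c' k) (@mzux n)).
Qed.

Let mgmuz n (c' : {ffun 'I_n -> 'I_K}) :
  mcurve (fun z : n.-tuple O * O => gmu c' k z.1 z.2.1.2 - mu0 z.2.1.2).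
Proof. by apply: mcurveB => //; exact: (mcurve_comp (@mzux n) (mgmu c' k)). Qed.

Let mF1 n c' : mcurve (@F1 n c').
Proof.
apply: mcurveZ; last exact: mcurveB.
apply: measurable_funM; last exact: mgap.
by apply: measurable_funB; [exact: measurable_cst|exact: mzDR].
Qed.

Let mF2 n c' : mcurve (@F2 n c').
Proof. by apply: mcurveZ => //; apply: (measurable_weight c hpi0); [exact: mzD|exact: mzx]. Qed.

Let mF3 n c' : measurable_fun setT (@F3 n c').
Proof.
apply: measurable_funM; last exact: (mcurve_hnorm (@mgmuz n c')).
apply: (measurableT_comp (f := fun x : R => `|x|)) (@mgap n c').
exact: normr_measurable.
Qed.

Let Npi_off n (c' : {ffun 'I_n -> 'I_K}) (u u' : n.-tuple O) :
  (forall j, c' j != k -> tnth u j = tnth u' j) -> Npi c' u = Npi c' u'.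
Proof. by move=> uu'; rewrite /Npi (gpi_off uu'). Qed.

Let Nmu_off n (c' : {ffun 'I_n -> 'I_K}) (u u' : n.-tuple O) :
  (forall j, c' j != k -> tnth u j = tnth u' j) -> Nmu c' u = Nmu c' u'.
Proof. by move=> uu'; rewrite /Nmu (gmu_off uu'). Qed.

Lemma vanishing_outcome v M :
  is_cond_mean X [set w | D w = false] (fun w => hnorm (Y w - mu0 (X w)) ^+ 2) v ->
  (forall x, v x <= M) ->
  little_op P (fun n w => L2P_norm X
    (fun x => gpi (fold n w) k [tuple U i w | i < n] x - pi0 x)) (fun=> 1) ->
  vanishing P (fun n w => (Num.sqrt n%:R)^-1 * hnorm (\sum_(i < n | fold n w i == k)
    ((1 - (Di i w)%:R) * gap (clip c (gpi (fold n w) k [tuple U i w | i < n] (Xi i w)))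
      (Xi i w)) *: (Yi i w - mu0 (Xi i w)))).
Proof.
(* [M] need not be positive, whereas the variance constant must be. *)
move=> hv vM oN; set M' := Num.max M 1.
have vM' x : v x <= M' by rewrite le_max vM.
have M'0 : 0 < M' by rewrite lt_max ltr01 orbT.
have mgx n c' (u : n.-tuple O) : measurable_fun setT (gpi c' k u).
  exact: (measurableT_comp (mgpi c' k) (pair1_measurable u)).
have Nlikely (e : R) : 0 < e -> likely P (fun n w =>
    (Npi (fold n w) [tuple U i w | i < n] <= e%:E)%E).
  move=> e0; apply: likelyS (case_likely mNpi oN e0); apply: nearW => n w.
  by rewrite mulr1.
have := cross_variance_vanishing mU hindep hfold hfold_indep mNpi Npi_off
  (C := M' / c ^+ 4) (F := F1) _ mF1 _ _ Nlikely.
move=> H; apply: vanishing_le (H _ _ _).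
- apply: likelyT; apply: nearW => n w; rewrite ler_wpM2l ?invr_ge0 ?sqrtr_ge0//.
  rewrite le_eqVlt; apply/orP; left; apply/eqP; congr hnorm.
  by apply: eq_bigr => i _; rewrite /F1 /= kapYi.
- by rewrite divr_gt0// exprn_gt0.
- by move=> n c' o u u' uu'; rewrite /F1 /= (gpi_off uu').
- move=> n c' u i e e0 Ne.
  have [T1 T2] := outcome_term hY hpi0 hmu0 hc overlap hv vM' (ltW M'0)
    (mgx n c' u) (ltW e0) Ne.
  split.
    have mf := measurable_funX 2 (mcurve_hnorm (mF1 c')).
    have E := @integral_record n _ u i mf (fun _ _ _ => erefl).
    apply: (le_trans _ T1); rewrite le_eqVlt; apply/orP; left; apply/eqP.
    apply: (etrans E); apply: eq_integral => w _.
    by rewrite /F1 /= kapY.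
  move=> g; have mf := mcurve_hinner (mF1 c') (mcurve_cst _ g).
  apply: etrans (T2 g); apply: etrans (@integral_record n _ u i mf (fun _ _ _ => erefl)) _.
  by apply: eq_integral => w _; rewrite /F1 /= kapY.
Qed.

Lemma vanishing_regression :
  little_op P (fun n w => L2PH_norm X
    (fun x => gmu (fold n w) k [tuple U i w | i < n] x - mu0 x)) (fun=> 1) ->
  vanishing P (fun n w => (Num.sqrt n%:R)^-1 * hnorm (\sum_(i < n | fold n w i == k)
    wt (Di i w) (Xi i w) *: (gmu (fold n w) k [tuple U i w | i < n] (Xi i w) - mu0 (Xi i w)))).
Proof.
move=> oN.
have mgx n c' (u : n.-tuple O) : mcurve (fun x => gmu c' k u x - mu0 x).
  by apply: mcurveB => //; exact: (mcurve_comp (pair1_measurable u) (mgmu c' k)).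
have Nlikely (e : R) : 0 < e -> likely P (fun n w =>
    (Nmu (fold n w) [tuple U i w | i < n] <= e%:E)%E).
  move=> e0; apply: likelyS (case_likely mNmu oN e0); apply: nearW => n w.
  by rewrite mulr1.
apply: (cross_variance_vanishing mU hindep hfold hfold_indep mNmu Nmu_off
  (C := c ^- 2) (F := F2) _ mF2 _ _ Nlikely).
- by rewrite invr_gt0 exprn_gt0.
- by move=> n c' o u u' uu'; rewrite /F2 /= (gmu_off uu').
- move=> n c' u i e e0 Ne.
  have [T1 T2] := regression_term hpi0 hc overlap (mgx n c' u) (ltW e0) Ne.
  split.
    have mf := measurable_funX 2 (mcurve_hnorm (mF2 c')).
    apply: (le_trans _ T1); rewrite le_eqVlt; apply/orP; left; apply/eqP.
    exact: (@integral_record n _ u i mf (fun _ _ _ => erefl)).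
  move=> g; have mf := mcurve_hinner (mF2 c') (mcurve_cst _ g).
  by apply: etrans (T2 g); exact: (@integral_record n _ u i mf (fun _ _ _ => erefl)).
Qed.

Lemma vanishing_product :
  little_op P (fun n w => (L2PH_norm X
      (fun x => (gmu (fold n w) k [tuple U i w | i < n] x - mu0 x)%R) *
    L2P_norm X (fun x => (gpi (fold n w) k [tuple U i w | i < n] x - pi0 x)%R))%E)
    (fun n => (Num.sqrt n%:R)^-1) ->
  vanishing P (fun n w => (Num.sqrt n%:R)^-1 * \sum_(i < n | fold n w i == k)
    `|gap (clip c (gpi (fold n w) k [tuple U i w | i < n] (Xi i w))) (Xi i w)| *
    hnorm (gmu (fold n w) k [tuple U i w | i < n] (Xi i w) - mu0 (Xi i w))).
Proof.
move=> oN.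
pose N n (c' : {ffun 'I_n -> 'I_K}) (u : n.-tuple O) := (Nmu c' u * Npi c' u)%E.
have mN n c' : measurable_fun setT (@N n c').
  exact: (emeasurable_funM (@mNmu n c') (@mNpi n c')).
have Noff n (c' : {ffun 'I_n -> 'I_K}) (u u' : n.-tuple O) :
    (forall j, c' j != k -> tnth u j = tnth u' j) -> N n c' u = N n c' u'.
  by move=> uu'; rewrite /N (Nmu_off uu') (Npi_off uu').
have mgx n c' (u : n.-tuple O) : mcurve (fun x => gmu c' k u x - mu0 x).
  by apply: mcurveB => //; exact: (mcurve_comp (pair1_measurable u) (mgmu c' k)).
have mgpx n c' (u : n.-tuple O) : measurable_fun setT (gpi c' k u).
  exact: (measurableT_comp (mgpi c' k) (pair1_measurable u)).
apply: (cross_mean_vanishing mU hindep hfold hfold_indep mN Noff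
  (C := c ^- 2) (G := F3) _ mF3 _ _ _ (case_likely mN oN)).
- by rewrite invr_gt0 exprn_gt0.
- by move=> n c' z; rewrite mulr_ge0 ?hnorm_ge0.
- by move=> n c' o u u' uu'; rewrite /F3 /= (gmu_off uu') (gpi_off uu').
- move=> n c' u i e e0 Ne.
  apply: (le_trans _ (product_term hpi0 hc overlap (mgpx n c' u) (mgx n c' u) Ne)).
  rewrite le_eqVlt; apply/orP; left; apply/eqP.
  exact: (@integral_record n _ u i (mF3 c') (fun _ _ _ => erefl)).
Qed.

End folds.

Variables (p0 : R) (tau0 : L2 a b).
Hypothesis p0E : p0 = fine (P [set w | D w = true]).
Local Notation phi := (influence p0 pi0 mu0 tau0).

(** The fold bound with all units in a single fold: the summand is a function of its own record
    alone. *)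
Lemma influence_sum_sqr V n :
  (\int[P]_w (hnorm (phi (Y w, D w, X w)) ^+ 2)%:E <= V%:E)%E ->
  (forall g, (\int[P]_w (hinner (phi (Y w, D w, X w)) g)%:E = 0)%E) ->
  (\int[P]_w (hnorm (\sum_(i < n) phi (Yi i w, Di i w, Xi i w)) ^+ 2)%:E
    <= (n%:R * V)%:E)%E.
Proof.
move=> phi2 phi0.
pose F (z : n.-tuple O * O) := phi (kap z.2.1.1.1, z.2.1.1.2, z.2.1.2).
have mF : mcurve F.
  exact: (mcurve_influence hpi0 hmu0 p0 tau0 (@mkapz n) (@mzD n) (@mzx n)).
have FE w (i : 'I_n) : F ([tuple U j w | j < n], U i w) = phi (Yi i w, Di i w, Xi i w).
  by rewrite /F /= kapYi.
have Foff o (u u' : n.-tuple O) :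
  (forall j, ~~ predT j -> tnth u j = tnth u' j) -> F (u, o) = F (u', o) by [].
have FV (i : 'I_n) : predT i -> forall u, (\int[P]_w (hnorm (F (u, U i w)) ^+ 2)%:E <= V%:E)%E.
  move=> _ u; have mf := measurable_funX 2 (mcurve_hnorm mF).
  apply: (le_trans _ phi2); rewrite le_eqVlt; apply/orP; left; apply/eqP.
  apply: (etrans (@integral_record n _ u i mf (fun _ _ _ => erefl))).
  by apply: eq_integral => w _; rewrite /F /= kapY.
have F0 (i : 'I_n) : predT i -> forall u g, (\int[P]_w (hinner (F (u, U i w)) g)%:E = 0)%E.
  move=> _ u g; have mf := mcurve_hinner mF (mcurve_cst _ g).
  apply: etrans (phi0 g); apply: etrans (@integral_record n _ u i mf (fun _ _ _ => erefl)) _.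
  by apply: eq_integral => w _; rewrite /F /= kapY.
have := variance_le (@mU n) (@hindep n) mF Foff FV F0.
rewrite card_ord; apply: le_trans; rewrite le_eqVlt; apply/orP; left; apply/eqP.
apply: eq_integral => w _; congr ((hnorm _ ^+ 2)%:E).
by apply: eq_bigr => i _; rewrite FE.
Qed.

Let mD : measurable_fun setT (fun w => (D w)%:R : R).
Proof. by case: hpi0 => _ /integrableP[/measurable_EFinP]. Qed.

Let p0_itv : 0 <= p0 <= 1.
Proof.
have mA : measurable [set w | D w = true].
  rewrite -[X in measurable X]setTI.
  have mDb : measurable_fun setT D by exact: measurable_funPT.
  by apply: (mDb measurableT [set true]).
rewrite p0E fine_ge0//= -lee_fin fineK ?fin_num_measure//; exact: probability_le1.
Qed.

Let mean_treated : (\int[P]_w ((D w)%:R - p0)%:E = 0)%E.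
Proof.
have iD : P.-integrable setT (EFin \o (fun w => (D w)%:R : R)) by case: hpi0.
have ic : P.-integrable setT (EFin \o cst p0) by exact: finite_measure_integrable_cst.
have mA : measurable [set w | D w = true].
  rewrite -[X in measurable X]setTI.
  have mDb : measurable_fun setT D by exact: measurable_funPT.
  by apply: (mDb measurableT [set true]).
under eq_integral do rewrite EFinB.
rewrite (integralB_EFin measurableT iD ic).
have -> : (\int[P]_w (cst p0 w)%:E = p0%:E)%E.
  apply: etrans (integral_cst P measurableT p0%:E) _.
  by apply: etrans (congr1 (mule p0%:E) (probability_setT P)) _; rewrite mule1.
have -> : (\int[P]_w (D w)%:R%:E = P [set w | D w = true])%E.
  transitivity (\int[P]_w (\1_([set w | D w = true]) w)%:E)%E.
    apply: eq_integral => w _; rewrite indicE.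
    by case: (boolP (D w)) => Dw; [rewrite mem_set|rewrite memNset//=; exact/negP].
  by rewrite integral_indic ?setIT.
by rewrite p0E fineK ?subee ?fin_num_measure.
Qed.

Let share n w : R := n%:R^-1 * \sum_(i < n) (Di i w)%:R - p0.

Let mshare n : measurable_fun setT (@share n).
Proof.
apply: measurable_funB => //; apply: measurable_funM => //.
apply: measurable_sum => i; rewrite (_ : (fun _ => _) = (fun w => if Di i w then 1 else 0)).
  exact: measurable_fun_ifT.
by apply/funext => w; case: (Di i w).
Qed.

(* The H-valued second moment bound is applied to multiples of a fixed h. *)
Lemma treated_share_sqr (h : L2 a b) n : hnorm h != 0 -> (0 < n)%N ->
  (\int[P]_w ((n%:R^-1 * \sum_(i < n) (Di i w)%:R - p0) ^+ 2)%:E <= (n%:R^-1)%:E)%E.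
Proof.
move=> h0 n0; have nR : n%:R != 0 :> R by rewrite pnatr_eq0 -lt0n.
pose F (z : n.-tuple O * O) := ((z.2.1.1.2)%:R - p0) *: h.
have mF : mcurve F.
  apply: mcurveZ; last exact: mcurve_cst.
  by apply: measurable_funB; [exact: mzDR|exact: measurable_cst].
have hp : 0 < hnorm h by rewrite lt_neqAle eq_sym h0 hnorm_ge0.
have Foff o (u u' : n.-tuple O) :
  (forall j, ~~ predT j -> tnth u j = tnth u' j) -> F (u, o) = F (u', o) by [].
have FV (i : 'I_n) : predT i ->
    forall u, (\int[P]_w (hnorm (F (u, U i w)) ^+ 2)%:E <= (hnorm h ^+ 2)%:E)%E.
  move=> _ u; apply: (@le_trans _ _ (\int[P]_w (cst (hnorm h ^+ 2)%:E w))%E).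
    apply: ge0_le_integral => //.
    - by move=> w _; rewrite lee_fin sqr_ge0.
    - have mf := measurable_funX 2 (mcurve_hnorm mF).
      apply/measurable_EFinP; apply: (measurableT_comp mf).
      by apply: measurable_fun_pair; [exact: measurable_cst|exact: mU].
    - move=> w _; rewrite lee_fin /F hnormZ exprMn ler_piMl ?sqr_ge0//.
      by rewrite expr_le1// bool_dist_le1.
  by rewrite integral_cst// -[leRHS]mule1 lee_wpmul2l ?lee_fin ?sqr_ge0// probability_le1.
have F0 (i : 'I_n) : predT i -> forall u g, (\int[P]_w (hinner (F (u, U i w)) g)%:E = 0)%E.
  move=> _ u g; have mf := mcurve_hinner mF (mcurve_cst _ g).
  apply: etrans (@integral_record n _ u i mf (fun _ _ _ => erefl)) _.
  have iD : P.-integrable setT (EFin \o (fun w => (D w)%:R - p0)).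
    have iD : P.-integrable setT (EFin \o (fun w => (D w)%:R : R)) by case: hpi0.
    have ic : P.-integrable setT (EFin \o cst p0) by exact: finite_measure_integrable_cst.
    by have := integrableB measurableT iD ic; apply: eq_integrable.
  transitivity (\int[P]_w (((D w)%:R - p0)%:E * (hinner h g)%:E))%E.
    by apply: eq_integral => w _; rewrite /F /= hinnerZl EFinM.
  by rewrite (integralZr measurableT iD) [X in (X * _)%E]mean_treated mul0e.
have H := variance_le (@mU n) (@hindep n) mF Foff FV F0.
move: H; rewrite card_ord.
have -> : (\int[P]_w (hnorm (\sum_(i < n | predT i) F ([tuple U j w | j < n], U i w)) ^+ 2)%:E =
    (n%:R ^+ 2 * hnorm h ^+ 2)%:E * \int[P]_w (share n w ^+ 2)%:E)%E.
  have ms : measurable_fun setT (fun w => (share n w ^+ 2)%:E).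
    exact/measurable_EFinP/measurable_funX.
  have k0 : (0 <= (n%:R ^+ 2 * hnorm h ^+ 2)%:E :> \bar R)%E.
    by rewrite lee_fin mulr_ge0 ?sqr_ge0.
  have s0 w : setT w -> (0 <= (share n w ^+ 2)%:E)%E by rewrite lee_fin sqr_ge0.
  rewrite -(ge0_integralZl P measurableT ms s0 k0).
  apply: eq_integral => w _; rewrite /F /= -scaler_suml hnormZ exprMn.
  rewrite real_normK ?num_real// sumrB sumr_const card_ord /share.
  rewrite -EFinM; congr EFin; rewrite -mulr_natl; field.
  exact: nR.
move=> {}H; have k0 : (0 < (n%:R ^+ 2 * hnorm h ^+ 2)%:E :> \bar R)%E.
  by rewrite lte_fin mulr_gt0// exprn_gt0// ltr0n.
rewrite -(@lee_pmul2l _ (n%:R ^+ 2 * hnorm h ^+ 2)%:E)//.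
rewrite (le_trans H)// -EFinM lee_fin le_eqVlt; apply/orP; left; apply/eqP.
by field.
Qed.

Let inv_sqrt_small (e : R) : 0 < e -> \forall n \near \oo, (Num.sqrt n%:R)^-1 <= e /\ (0 < n)%N.
Proof.
move=> e0; near=> n.
have n0 : (0 < n)%N by near: n; exists 1%N.
split => //; rewrite -[leRHS]invrK lef_pV2 ?posrE ?invr_gt0 ?sqrtr_gt0 ?ltr0n//.
rewrite -(@ler_pXn2r _ 2) ?nnegrE ?invr_ge0 ?sqrtr_ge0 ?(ltW e0)// sqr_sqrtr//.
by near: n; exact: nbhs_infty_ger.
Unshelve. all: by end_near. Qed.

Lemma vanishing_share (h : L2 a b) : hnorm h != 0 ->
  vanishing P (fun n w => `|n%:R^-1 * \sum_(i < n) (Di i w)%:R - p0|).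
Proof.
move=> h0; apply: vanishing_sqr => //; apply: vanishing_markov => eta eta0.
exists (fun n w => `|share n w| ^+ 2); split.
- by move=> n; apply: measurable_funX; apply: measurableT_comp.
- by move=> n w; exact: sqr_ge0.
- have se0 : 0 < Num.sqrt eta by rewrite sqrtr_gt0.
  apply: filterS (inv_sqrt_small se0) => n [ne n0].
  under eq_integral do rewrite real_normK ?num_real//.
  rewrite (le_trans (treated_share_sqr h0 n0))// lee_fin.
  rewrite -(sqr_sqrtr (ltW eta0)) -[X in X^-1](@sqr_sqrtr _ n%:R)// -exprVn.
  by rewrite ler_pXn2r ?nnegrE ?invr_ge0 ?sqrtr_ge0.
- by apply: likelyT; apply: nearW.
Qed.

(** Rather than multiplying stochastic orders, the product is dominated pointwise by a weighted sum
    of squares whose mean is at most [(1 + V) / sqrt n]. *)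
Lemma vanishing_share_influence (h : L2 a b) V : hnorm h != 0 -> 0 <= V ->
  (\int[P]_w (hnorm (phi (Y w, D w, X w)) ^+ 2)%:E <= V%:E)%E ->
  (forall g, (\int[P]_w (hinner (phi (Y w, D w, X w)) g)%:E = 0)%E) ->
  vanishing P (fun n w => `|n%:R^-1 * \sum_(i < n) (Di i w)%:R - p0| *
    ((Num.sqrt n%:R)^-1 * hnorm (\sum_(i < n) phi (Yi i w, Di i w, Xi i w)))).
Proof.
move=> h0 V0 phi2 phi0; apply: vanishing_markov => eta eta0.
pose Phi n w := \sum_(i < n) phi (Yi i w, Di i w, Xi i w).
have mPhi n : measurable_fun setT (fun w => hnorm (Phi n w) ^+ 2).
  apply: measurable_funX; apply: mcurve_hnorm; apply: mcurve_sum => i _.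
  have mYk : mcurve (fun w => kap (Yi i w)) by exact: (mcurve_comp (mYi i) mkap).
  have := mcurve_influence hpi0 hmu0 p0 tau0 mYk (measurable_funPT (Di i)) (measurable_funPT (Xi i)).
  by congr mcurve; apply/funext => w; rewrite kapYi.
pose s n : R := Num.sqrt n%:R.
(* The weights balance the two means: [share ^+ 2] has mean at most [1 / n] and [|Phi|^2 / n] at
   most [V], giving [1 / s] and [V / s]. *)
exists (fun n w => s n * share n w ^+ 2 + (s n)^-1 * (n%:R^-1 * hnorm (Phi n w) ^+ 2)); split.
- move=> n; apply: measurable_funD; apply: measurable_funM => //.
    exact: measurable_funX.
  exact: measurable_funM.
- move=> n w; have g1 := sqr_ge0 (share n w); have g2 := sqr_ge0 (hnorm (Phi n w)).
  by apply: addr_ge0; apply: mulr_ge0; rewrite ?invr_ge0 ?sqrtr_ge0// mulr_ge0 ?invr_ge0.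
- have V1 : 0 < 1 + V by rewrite ltr_pwDl.
  have eV0 : 0 < eta / (1 + V) by rewrite divr_gt0.
  apply: filterS (inv_sqrt_small eV0) => n [ne n0].
  have s0 : 0 < s n by rewrite sqrtr_gt0 ltr0n.
  have m1 : measurable_fun setT (fun w => (share n w ^+ 2)%:E).
    exact/measurable_EFinP/measurable_funX.
  have m2 : measurable_fun setT (fun w => (hnorm (Phi n w) ^+ 2)%:E).
    exact/measurable_EFinP.
  suff : ((s n)%:E * \int[P]_w (share n w ^+ 2)%:E + ((s n)^-1 * n%:R^-1)%:E *
      \int[P]_w (hnorm (Phi n w) ^+ 2)%:E <= eta%:E)%E.
    have k1 : (0 <= (s n)%:E)%E by rewrite lee_fin ltW.
    have k2 : (0 <= ((s n)^-1 * n%:R^-1)%:E)%E by rewrite lee_fin mulr_ge0 ?invr_ge0// ltW.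
    have g1 w : setT w -> (0 <= (share n w ^+ 2)%:E)%E by rewrite lee_fin sqr_ge0.
    have g2 w : setT w -> (0 <= (hnorm (Phi n w) ^+ 2)%:E)%E by rewrite lee_fin sqr_ge0.
    rewrite -(ge0_integralZl P measurableT m1 g1 k1) -(ge0_integralZl P measurableT m2 g2 k2).
    rewrite -(ge0_integralD P measurableT (fun w h => mule_ge0 k1 (g1 w h)) (emeasurable_funM (measurable_cst _) m1)
      (fun w h => mule_ge0 k2 (g2 w h)) (emeasurable_funM (measurable_cst _) m2)).
    apply: le_trans; rewrite le_eqVlt; apply/orP; left; apply/eqP.
    by apply: eq_integral => w _; rewrite /= -!EFinM -EFinD mulrA.
  apply: (@le_trans _ _ ((s n)%:E * (n%:R^-1)%:E + ((s n)^-1 * n%:R^-1)%:E * (n%:R * V)%:E)%E).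
    apply: leeD; rewrite lee_wpmul2l ?lee_fin ?mulr_ge0 ?invr_ge0 ?(ltW s0)//.
      exact: treated_share_sqr h0 n0.
    exact: influence_sum_sqr.
  rewrite -!EFinM -EFinD lee_fin.
  have nE : n%:R = s n ^+ 2 by rewrite sqr_sqrtr.
  have s_n : s n != 0 by rewrite gt_eqF.
  have -> : s n * n%:R^-1 + (s n)^-1 * n%:R^-1 * (n%:R * V) = (s n)^-1 * (1 + V).
    by rewrite nE; field.
  by rewrite -ler_pdivlMr.
- apply: likelyT; exists 1%N => // n /= n0 w.
  have s0 : 0 < s n by rewrite sqrtr_gt0 ltr0n.
  have nE : n%:R = s n ^+ 2 by rewrite sqr_sqrtr.
  pose q := `|share n w|; pose B := hnorm (Phi n w).
  suff : q * ((s n)^-1 * B) <= s n * q ^+ 2 + (s n)^-1 * ((s n ^+ 2)^-1 * B ^+ 2).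
    by rewrite /q real_normK ?num_real// -nE.
  rewrite -subr_ge0.
  (* With [x = s q] and [y = B / s] this is [x^2 - x y + y^2 = (x - y / 2)^2 + 3 y^2 / 4]. *)
  have -> : s n * q ^+ 2 + (s n)^-1 * ((s n ^+ 2)^-1 * B ^+ 2) - q * ((s n)^-1 * B) =
      (s n)^-1 * ((s n * q - 2^-1 * ((s n)^-1 * B)) ^+ 2 + 3 / 4 * ((s n)^-1 * B) ^+ 2).
    by field; rewrite gt_eqF.
  apply: mulr_ge0; first by rewrite invr_ge0 ltW.
  by apply: addr_ge0; [exact: sqr_ge0|apply: mulr_ge0; [rewrite divr_ge0|exact: sqr_ge0]].
Qed.

(** The points where clipping alters [pi0] form a measurable set that is null for the law of [X],
    hence for that of each [Xi]; countably many units give one negligible set for all [n]. *)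
Lemma likely_propensity :
  likely P (fun n w => forall i : 'I_n, pi0 (Xi i w) = prop (Xi i w)).
Proof.
pose B := [set x | pi0 x <> prop x].
have mB : measurable B.
  have md : measurable_fun setT (fun x => pi0 x - prop x).
    by apply: measurable_funB => //; exact: measurable_propensity hpi0.
  rewrite (_ : B = ~` ((fun x => pi0 x - prop x) @^-1` [set 0])).
    by apply: measurableC; rewrite -[_ @^-1` _]setTI; exact: md.
  apply/seteqP; split=> x /= h; first by move=> /eqP; rewrite subr_eq0 => /eqP.
  by move=> E; apply: h; rewrite E subrr.
have PX0 : P (X @^-1` B) = 0%E.
  have mXB : measurable (X @^-1` B).
    by rewrite -[_ @^-1` _]setTI; exact: (measurable_funPT X).
  by apply: measure_negligible => //; exact: (pi0_propensity overlap).
have Ni i : P.-negligible (Xi i @^-1` B).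
  have mXB : measurable (Xi i @^-1` B).
    by rewrite -[_ @^-1` _]setTI; exact: (measurable_funPT (Xi i)).
  have mB' : measurable [set o : obs a b p | B o.2].
    by rewrite -[X in measurable X]setTI; exact: (measurable_snd measurableT B mB).
  exists (Xi i @^-1` B); split => //.
  exact: etrans (hcopies i mB') PX0.
have := likely_negligible (fun _ => negligible_bigcup Ni).
apply: likelyS; apply: nearW => n w h i; apply: contrapT => pine.
by apply: h; exists i.
Qed.

End sample.

(** * Measurability of the estimator and assembly of the theorem *)

Lemma mcurve_dr_summand (R : realType) (a b : R) d (T : measurableType d)
    (q e : T -> R) (m y : T -> L2 a b) (D : T -> bool) :
  measurable_fun setT q -> measurable_fun setT e -> mcurve m -> mcurve y ->
  measurable_fun setT D ->
  mcurve (fun t => dr_summand (q t) (e t) (m t) (y t) (D t)).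
Proof.
move=> mq me mm my mD.
have mDR : measurable_fun setT (fun t => (D t)%:R : R).
  rewrite (_ : (fun _ => _) = (fun t => if D t then 1 else 0)).
    exact: measurable_fun_ifT.
  by apply/funext => t; case: (D t).
have m1D : measurable_fun setT (fun t => 1 - (D t)%:R : R) by exact: measurable_funB.
have m1e : measurable_fun setT (fun t => 1 - e t) by exact: measurable_funB.
have mym : mcurve (fun t => y t - m t) by exact: mcurveB.
apply: mcurveB; apply: mcurveZ mym.
  by apply: measurable_funM => //; exact: measurable_funV.
apply: measurable_funM; first exact: measurable_funM.
by apply: measurable_funV; exact: measurable_funM.
Qed.

Lemma measurable_bigmaxr (R : realType) d (T : measurableType d) (J : Type)
    (s : seq J) (f : J -> T -> R) : (forall j, measurable_fun setT (f j)) ->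
  measurable_fun setT (fun t => \big[Num.max/0]_(j <- s) f j t).
Proof.
move=> mf; elim: s => [|j s IH].
  rewrite (_ : (fun _ => _) = cst 0); first exact: measurable_cst.
  by apply/funext => t; rewrite big_nil.
rewrite (_ : (fun _ => _) = (fun t => Num.max (f j t) (\big[Num.max/0]_(i <- s) f i t))).
  exact: measurable_maxr.
by apply/funext => t; rewrite big_cons.
Qed.

Lemma measurable_fold_itv (R : realType) d (T : measurableType d) (n K : nat)
    (fold : T -> {ffun 'I_n -> 'I_K}) (f : {ffun 'I_n -> 'I_K} -> 'I_n -> T -> R) (x y : R) :
  (forall c, measurable (fold @^-1` [set c])) ->
  (forall c i, measurable_fun setT (f c i)) ->
  measurable [set w | forall i, x <= f (fold w) i w <= y].
Proof.
move=> mfold mf.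
rewrite (_ : [set _ | _] = \bigcup_(c in [set: {ffun 'I_n -> 'I_K}])
    (fold @^-1` [set c] `&` \bigcap_(i in [set: 'I_n]) (f c i @^-1` `[x, y]))).
  apply: fin_bigcup_measurable => // c _; apply: measurableI => //.
  apply: fin_bigcap_measurable => // i _; rewrite -[_ @^-1` _]setTI.
  exact: mf.
apply/seteqP; split=> w /=.
  by move=> h; exists (fold w) => //; split => // i _ /=; rewrite in_itv/=; exact: h.
by move=> [c _ [<- h]] i; have := h i I; rewrite /= in_itv.
Qed.

Lemma half_le (R : realType) (x y : R) : `|x - y| <= y / 2 -> y / 2 <= x.
Proof. by rewrite ler_norml => /andP[]; lra. Qed.

(** The deterministic bound names the fit by [c i], the vanishing terms by [k]; the two agree on
    fold [k], and this carries the equality through the bound. *)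
Lemma eq_remainder_bound (R : realType) (a b : R) (K : nat) (A B s C : R)
    (u u' v v' : 'I_K -> L2 a b) (x x' : 'I_K -> R) :
  (forall k, u k = u' k) -> (forall k, v k = v' k) -> (forall k, x k = x' k) ->
  A * (B + \sum_(k < K) (s * hnorm (u k) + s * hnorm (v k) + s * x k) + C) <=
  A * (B + \sum_(k < K) (s * hnorm (u' k) + s * hnorm (v' k) + s * x' k) + C).
Proof. by move=> /funext-> /funext-> /funext->. Qed.

Theorem theorem1 (R : realType) (a b : R) (hab : a <= b) (p K : nat)
  (d dS : measure_display) (Omega : measurableType d) (S : measurableType dS)
  (P : probability Omega R)
  (* W = (Y, D, X), the law of W and its features *)
  (Y : Omega -> L2 a b) (D : {RV P >-> bool}) (X : {RV P >-> p.-tuple R})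
  (hY : random_curve Y)
  (p0 : R) (hp0 : p0 = fine (P [set w | D w = true]))
  (pi0 : p.-tuple R -> R)
  (hpi0 : is_cond_mean X setT (fun w => (D w)%:R) pi0)
  (mu0 : p.-tuple R -> L2 a b)
  (hmu0 : is_cond_mean_curve X [set w | D w = false] Y mu0)
  (tau0 : L2 a b)
  (htau0 : exists m1 m2 : L2 a b,
    [/\ has_mean P (fun w => ((D w)%:R / p0) *: Y w) m1,
        has_mean P (fun w => ((1 - (D w)%:R) * pi0 (X w)
                              / (p0 * (1 - pi0 (X w)))) *: Y w) m2
      & hnorm (tau0 - (m1 - m2)) = 0])
  (* the sample: W_i = (Yi i, Di i, Xi i); Z n i is the further data of unit i
     (e.g. its discrete noisy observations) available at sample size n *)
  (Yi : nat -> Omega -> L2 a b) (Di : nat -> {RV P >-> bool})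
  (Xi : nat -> {RV P >-> p.-tuple R}) (Z : nat -> nat -> {RV P >-> S})
  (hYi : forall i, random_curve (Yi i))
  (hcopies : forall i (B : set (obs a b p)), measurable B ->
    P [set w | B (Yi i w, Di i w, Xi i w)] = P [set w | B (Y w, D w, X w)])
  (hindep : forall n, mutually_independent P
    (fun (i : 'I_n) w => ((Yi i w, Di i w, Xi i w), Z n i w) : obs a b p * S))
  (* reconstructed curves *)
  (Yhat : forall n, 'I_n -> Omega -> L2 a b)
  (hYhat : forall n i, random_curve (Yhat n i))
  (* fold assignment: I_k = {i | fold n w i = k} *)
  (fold : forall n, Omega -> {ffun 'I_n -> 'I_K})
  (hfold : forall n c, measurable (fold n @^-1` [set c]))
  (records : forall n, Omega -> n.-tuple (obs a b p * S))
  (hrecords : forall n w, records n w =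
    [tuple ((Yi i w, Di i w, Xi i w), Z n i w) | i < n])
  (hfold_indep : forall n, independent_of P (fold n) (records n))
  (* nuisance estimators *)
  (pihat : nat -> Omega -> 'I_K -> p.-tuple R -> R)
  (muhat : nat -> Omega -> 'I_K -> p.-tuple R -> L2 a b)
  (* (A1) *)
  (A1_overlap : exists c : R, 0 < c < 2^-1 /\
    {ae P, forall w, c <= pi0 (X w) <= 1 - c})
  (A1_p0 : 0 < p0 < 1)
  (A1_Y : (\int[P]_w (hnorm (Y w) ^+ 2)%:E < +oo)%E)
  (A1_phi : (\int[P]_w
    (hnorm (influence p0 pi0 mu0 tau0 (Y w, D w, X w)) ^+ 2)%:E < +oo)%E)
  (A1_var : exists (v : p.-tuple R -> R) (M : R),
    is_cond_mean X [set w | D w = false]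
      (fun w => hnorm (Y w - mu0 (X w)) ^+ 2) v /\
    forall x, v x <= M)
  (* (A2) *)
  (A2_pihat : forall n, cross_fitted
    (fun g : n.-tuple (obs a b p * S) * p.-tuple R -> R => measurable_fun setT g)
    (fold n) (records n) (pihat n))
  (A2_muhat : forall n, cross_fitted
    (fun g : n.-tuple (obs a b p * S) * p.-tuple R -> L2 a b => random_curve g)
    (fold n) (records n) (muhat n))
  (A2_overlap : exists c : R, 0 < c < 2^-1 /\
    P [set w | forall (k : 'I_K) (i : 'I_n), fold n w i = k ->
         c <= pihat n w k (Xi i w) <= 1 - c] @[n --> \oo] --> 1%E)
  (A2_bounded : big_Op P
    (fun n w => \big[maxe/0%E]_(k < K) L2PH_norm X (muhat n w k)) (fun=> 1))
  (* (A3) *)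
  (A3_mu : forall k, little_op P
    (fun n w => L2PH_norm X (fun x => muhat n w k x - mu0 x)) (fun=> 1))
  (A3_pi : forall k, little_op P
    (fun n w => L2P_norm X (fun x => pihat n w k x - pi0 x)) (fun=> 1))
  (A3_prod : forall k, little_op P
    (fun n w => (L2PH_norm X (fun x => (muhat n w k x - mu0 x)%R)
                 * L2P_norm X (fun x => (pihat n w k x - pi0 x)%R))%E)
    (fun n => (Num.sqrt n%:R)^-1))
  (* (A4) *)
  (A4 : little_op P
    (fun n w => (\big[Num.max/0]_(i < n) hnorm (Yhat n i w - Yi i w))%:E)
    (fun n => (Num.sqrt n%:R)^-1)) :
  exists r : nat -> Omega -> L2 a b,
    (forall n w,
       Num.sqrt n%:R *: (tau_hat (fold n w) (pihat n w) (muhat n w)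
                           (fun i : 'I_n => Yhat n i w) (fun i : 'I_n => Di i w)
                           (fun i : 'I_n => Xi i w) - tau0) =
       (Num.sqrt n%:R)^-1 *: \sum_(i < n)
          influence p0 pi0 mu0 tau0 (Yi i w, Di i w, Xi i w) + r n w) /\
    little_op P (fun n w => (hnorm (r n w))%:E) (fun=> 1).
Proof.
have recE : records = (fun n w => [tuple ((Yi i w, Di i w, Xi i w), Z n i w) | i < n]).
  by apply: functional_extensionality_dep => n; apply/funext => w; exact: hrecords.
subst records.
(* Choice over [n] gathers the training maps into one family, so that the fits become explicit
   functions of folds and records. *)
have [gpi gpiP] : exists g : forall n, {ffun 'I_n -> 'I_K} -> 'I_K ->
    n.-tuple (obs a b p * S) -> p.-tuple R -> R, forall n, [/\
      forall c k, measurable_fun setT (fun z => g n c k z.1 z.2),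
      forall (c : {ffun 'I_n -> 'I_K}) (k : 'I_K) (u v : n.-tuple (obs a b p * S)),
        (forall i, c i != k -> tnth u i = tnth v i) -> g n c k u = g n c k v
    & forall w k, pihat n w k = g n (fold n w) k
        [tuple ((Yi i w, Di i w, Xi i w), Z n i w) | i < n]].
  by exists (fun n => sval (cid (A2_pihat n))) => n; exact: svalP (cid (A2_pihat n)).
have [gmu gmuP] : exists g : forall n, {ffun 'I_n -> 'I_K} -> 'I_K ->
    n.-tuple (obs a b p * S) -> p.-tuple R -> L2 a b, forall n, [/\
      forall c k, random_curve (fun z => g n c k z.1 z.2),
      forall (c : {ffun 'I_n -> 'I_K}) (k : 'I_K) (u v : n.-tuple (obs a b p * S)),
        (forall i, c i != k -> tnth u i = tnth v i) -> g n c k u = g n c k v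
    & forall w k, muhat n w k = g n (fold n w) k
        [tuple ((Yi i w, Di i w, Xi i w), Z n i w) | i < n]].
  by exists (fun n => sval (cid (A2_muhat n))) => n; exact: svalP (cid (A2_muhat n)).
have pihatE : pihat = (fun n w k => gpi n (fold n w) k
    [tuple ((Yi i w, Di i w, Xi i w), Z n i w) | i < n]).
  apply/funext => n; apply/funext => w; apply/funext => k.
  by have [_ _] := gpiP n.
have muhatE : muhat = (fun n w k => gmu n (fold n w) k
    [tuple ((Yi i w, Di i w, Xi i w), Z n i w) | i < n]).
  apply/funext => n; apply/funext => w; apply/funext => k.
  by have [_ _] := gmuP n.
have mgpi n (c' : {ffun 'I_n -> 'I_K}) k : measurable_fun setT (fun z => gpi n c' k z.1 z.2).
  by have [+ _ _] := gpiP n; apply.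
have gpi_off n (c' : {ffun 'I_n -> 'I_K}) k (u v : n.-tuple (obs a b p * S)) :
    (forall i, c' i != k -> tnth u i = tnth v i) -> gpi n c' k u = gpi n c' k v.
  by have [_ + _] := gpiP n; apply.
have mgmu n (c' : {ffun 'I_n -> 'I_K}) k : mcurve (fun z => gmu n c' k z.1 z.2).
  by apply: random_mcurve; have [+ _ _] := gmuP n; apply.
have gmu_off n (c' : {ffun 'I_n -> 'I_K}) k (u v : n.-tuple (obs a b p * S)) :
    (forall i, c' i != k -> tnth u i = tnth v i) -> gmu n c' k u = gmu n c' k v.
  by have [_ + _] := gmuP n; apply.
clear gpiP gmuP; subst pihat muhat.
have [c1 [hc1 ov1]] := A1_overlap; have [c2 [hc2 ov2]] := A2_overlap.
(* One clipping level that respects the overlap of both the true and the fitted propensities. *)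
pose c := Num.min c1 c2.
have cc1 : c <= c1 by rewrite ge_min lexx.
have cc2 : c <= c2 by rewrite ge_min lexx orbT.
have hc : 0 < c < 2^-1.
  have /andP[a1 b1] := hc1; have /andP[a2 _] := hc2.
  by rewrite lt_min a1 a2/= (le_lt_trans cc1).
have itv_mono c' x : c <= c' -> c' <= x <= 1 - c' -> c <= x <= 1 - c.
  by move=> cc' /andP[h1 h2]; rewrite (le_trans cc')//= (le_trans h2)// lerD2l lerN2.
have overlap : {ae P, forall w, c <= pi0 (X w) <= 1 - c}.
  by apply: filterS ov1 => w; exact: itv_mono.
(* [Y] is put in front of the sample, so that a single dense sequence and a single [kap] serve all
   the curves. *)
pose f l := if l is i.+1 then Yi i else Y.
have hf l : random_curve (f l) by case: l => [|i]; [exact: hY|exact: hYi].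
have [h hdense] := random_curve_dense hf.
have [kap mkap kapE] := dense_retraction h.
have mY := dense_range_measurable (random_mcurve hY) (hdense 0%N).
have mYi i := dense_range_measurable (random_mcurve (hYi i)) (hdense i.+1).
have kapY w : kap (Y w) = Y w by apply: kapE; exact: (hdense 0%N).
have kapYi i w : kap (Yi i w) = Yi i w by apply: kapE; exact: (hdense i.+1).
have mrec n : measurable_fun setT (fun w =>
    [tuple ((Yi i w, Di i w, Xi i w), Z n i w) : obs a b p * S | i < n]).
  apply: measurable_record => i; apply: measurable_fun_pair; last exact: measurable_funPT.
  apply: measurable_fun_pair; last exact: measurable_funPT.
  by apply: measurable_fun_pair; [exact: mYi|exact: measurable_funPT].
have mx n (i : 'I_n) : measurable_fun setT (fun w =>
    ([tuple ((Yi j w, Di j w, Xi j w), Z n j w) : obs a b p * S | j < n], Xi i w)).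
  by apply: measurable_fun_pair; [exact: mrec|exact: measurable_funPT].
have p00 : 0 < p0 by case/andP: A1_p0.
set r := fun (n : nat) w => Num.sqrt n%:R *: (tau_hat (fold n w)
    (fun k => gpi n (fold n w) k [tuple ((Yi i w, Di i w, Xi i w), Z n i w) | i < n])
    (fun k => gmu n (fold n w) k [tuple ((Yi i w, Di i w, Xi i w), Z n i w) | i < n])
    (fun i : 'I_n => Yhat n i w) (fun i : 'I_n => Di i w) (fun i : 'I_n => Xi i w) - tau0)
  - (Num.sqrt n%:R)^-1 *: \sum_(i < n) influence p0 pi0 mu0 tau0 (Yi i w, Di i w, Xi i w).
exists r; split; first by move=> n w; rewrite /r addrCA subrr addr0.
(* The conclusion concerns [P] of actual sets, so passing from outer probability requires a
   measurable remainder. *)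
have mr n : mcurve (r n).
  apply: mcurveB; apply: mcurveZ => //.
    apply: mcurveB; last exact: mcurve_cst.
    apply: (mcurve_case (hfold n) (H := fun c' w => tau_hat c'
      (fun k => gpi n c' k [tuple ((Yi i w, Di i w, Xi i w), Z n i w) | i < n])
      (fun k => gmu n c' k [tuple ((Yi i w, Di i w, Xi i w), Z n i w) | i < n])
      (fun i : 'I_n => Yhat n i w) (fun i : 'I_n => Di i w) (fun i : 'I_n => Xi i w))) => c'.
    apply: mcurveZ => //; apply: mcurve_sum => k _; apply: mcurve_sum => i _.
    apply: mcurve_dr_summand.
    - apply: measurable_funM => //; apply: measurable_sum => j.
      rewrite (_ : (fun _ => _) = (fun w => if Di j w then 1 else 0)).
        exact: measurable_fun_ifT.
      by apply/funext => w; case: (Di j w).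
    - exact: (measurableT_comp (mgpi n c' k) (mx n i)).
    - exact: (mcurve_comp (mx n i) (mgmu n c' k)).
    - exact: random_mcurve.
    - exact: measurable_funPT.
  apply: mcurve_sum => i _.
  exact: (mcurve_influence hpi0 hmu0 p0 tau0 (random_mcurve (hYi i))
    (measurable_funPT (Di i)) (measurable_funPT (Xi i))).
apply: vanishing_little_op; [by move=> n; exact: mcurve_hnorm|by move=> n w; exact: hnorm_ge0|].
(* If [hnorm] vanishes identically, as it does when [a = b], the remainder has norm 0; otherwise
   [h1] serves to control the treated share. *)
have [[h1 h10]|triv] := pselect (exists h1 : L2 a b, hnorm h1 != 0); last first.
  apply: vanishing_le (vanishing0 P); apply: likelyT; apply: nearW => n w.
  by rewrite leNgt; apply/negP => rn; apply: triv; exists (r n w); rewrite gt_eqF.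
have [v [M [hv vM]]] := A1_var.
have vO k := vanishing_outcome hY hpi0 hmu0 hc overlap hcopies hindep hfold hfold_indep
  mkap kapY kapYi mY mYi mgpi gpi_off hv vM (A3_pi k).
have vR k := vanishing_regression hpi0 hmu0 hc overlap hcopies hindep hfold hfold_indep
  mY mYi mgmu gmu_off (A3_mu k).
have vP k := vanishing_product hpi0 hmu0 hc overlap hcopies hindep hfold hfold_indep
  mY mYi mgpi mgmu gpi_off gmu_off (A3_prod k).
have vS := vanishing_share hpi0 hcopies hindep mY mYi hp0 h10.
have vSI : vanishing P (fun n w => `|n%:R^-1 * \sum_(i < n) (Di i w)%:R - p0| *
    ((Num.sqrt n%:R)^-1 *
      hnorm (\sum_(i < n) influence p0 pi0 mu0 tau0 (Yi i w, Di i w, Xi i w)))).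
  pose I2 := (\int[P]_w (hnorm (influence p0 pi0 mu0 tau0 (Y w, D w, X w)) ^+ 2)%:E)%E.
  have I20 : (0 <= I2)%E by apply: integral_ge0 => w _; rewrite lee_fin sqr_ge0.
  have phi2 : (I2 <= (fine I2)%:E)%E by rewrite fineK// ge0_fin_numE.
  have [m1 [m2 [hm1 hm2 tauE]]] := htau0.
  have phi0 g := influence_mean0 hY hpi0 hmu0 hc overlap g hp0 p00 hm1 hm2 tauE A1_phi.
  exact: (vanishing_share_influence hpi0 hmu0 hcopies hindep mkap kapY kapYi mY mYi hp0
    h10 (fine_ge0 I20) phi2 phi0).
have vA4 : vanishing P (fun n w =>
    Num.sqrt n%:R * \big[Num.max/0]_(i < n) hnorm (Yhat n i w - Yi i w)).
  move=> e e0; apply: likelyS (little_op_likely _ A4 e0).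
    exists 1%N => // n /= n0 w.
    have s0 : 0 < Num.sqrt n%:R :> R by rewrite sqrtr_gt0 ltr0n.
    rewrite lee_fin => /(le_trans (ler_norm _)).
    by rewrite ler_pdivlMr// mulrC.
  move=> n; apply/measurable_EFinP.
  apply: (measurable_bigmaxr _ (f := fun (i : 'I_n) w => hnorm (Yhat n i w - Yi i w))) => i.
  by apply: mcurve_hnorm; apply: mcurveB; exact: random_mcurve.
have lprop := likely_propensity hpi0 overlap hcopies.
have mE n : measurable [set w | forall (k : 'I_K) (i : 'I_n), fold n w i = k ->
    c2 <= gpi n (fold n w) k [tuple ((Yi i w, Di i w, Xi i w), Z n i w) | i < n] (Xi i w)
      <= 1 - c2].
  have := measurable_fold_itv (f := fun c' (i : 'I_n) w => gpi n c' (c' i)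
    [tuple ((Yi i w, Di i w, Xi i w), Z n i w) | i < n] (Xi i w)) c2 (1 - c2) (hfold n)
    (fun c' i => measurableT_comp (mgpi n c' (c' i)) (mx n i)).
  congr measurable; apply/seteqP; split=> w /= H; first by move=> k i <-; exact: H.
  by move=> i; exact: H.
have lE := likely_cvg1 mE ov2.
have p02 : 0 < 2 / p0 by rewrite divr_gt0.
have c0 : 0 < c by case/andP: hc.
have ci0 : 0 < c^-1 by rewrite invr_gt0.
have p0h : 0 < p0 / 2 by rewrite divr_gt0.
apply: (vanishing_le _ (vanishingZ p02 (vanishingD (vanishingD (vanishingZ ci0 vA4)
  (vanishing_sum (fun k => vanishingD (vanishingD (vO k) (vR k)) (vP k)))) vSI))).
(* On this event clipping alters neither the true nor the fitted propensities at the sample, and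
   [phat] is within [p0 / 2] of [p0], hence at least [p0 / 2]. *)
apply: likelyS (likelyI (likelyI lprop lE) (vS _ p0h)).
exists 1%N => // n /= n0 w [[Gprop GE] Gshare].
have clipE (i : 'I_n) : gpi n (fold n w) (fold n w i)
    [tuple ((Yi i w, Di i w, Xi i w), Z n i w) | i < n] (Xi i w) =
  clip c (gpi n (fold n w) (fold n w i)
    [tuple ((Yi i w, Di i w, Xi i w), Z n i w) | i < n] (Xi i w)).
  by rewrite clip_id//; exact: (itv_mono c2 _ cc2 (GE _ i erefl)).
have bnd := remainder_le (c := fold n w) (D := fun i : 'I_n => Di i w)
  (e := fun i : 'I_n => clip c (gpi n (fold n w) (fold n w i)
    [tuple ((Yi i w, Di i w, Xi i w), Z n i w) | i < n] (Xi i w)))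
  (pi := fun i : 'I_n => propensity pi0 c (Xi i w))
  (y := fun i : 'I_n => Yi i w) (yhat := fun i : 'I_n => Yhat n i w)
  (m := fun i : 'I_n => mu0 (Xi i w))
  (mhat := fun i : 'I_n => gmu n (fold n w) (fold n w i)
    [tuple ((Yi i w, Di i w, Xi i w), Z n i w) | i < n] (Xi i w))
  tau0 n0 c0 (fun i => clip_itv _ hc) (fun i => propensity_itv pi0 hc _) p00 (half_le Gshare)
  (pi0 := pi0) (mu0 := mu0) (x := fun i : 'I_n => Xi i w)
  (pihat := fun k => gpi n (fold n w) k [tuple ((Yi i w, Di i w, Xi i w), Z n i w) | i < n])
  (muhat := fun k => gmu n (fold n w) k [tuple ((Yi i w, Di i w, Xi i w), Z n i w) | i < n])
  (B := \big[Num.max/0]_(i < n) hnorm (Yhat n i w - Yi i w))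
  Gprop (fun i => erefl) clipE (fun i => erefl)
  (fun i => le_bigmax _ (fun i => hnorm (Yhat n i w - Yi i w)) i).
apply: (le_trans bnd); apply: eq_remainder_bound => k.
- by apply: eq_bigr => i /eqP <-; rewrite /odds_gap.
- by apply: eq_bigr => i /eqP <-; rewrite /weight.
- by apply: eq_bigr => i /eqP <-; rewrite /odds_gap.
Qed.
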